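(* Let $\Gamma$ be $\mathrm{SO}_2\mathbb{R}$ or $\mathrm{O}_2\mathbb{R}$, let $\mathcal{C}$ be a $\Gamma$-rotational spread of $\mathrm{PG}(3,\mathbb{R})$, and let $\Omega\le \mathrm{AGL}_3\mathbb{R}$, $\Omega\cong\mathrm{SO}_3\mathbb{R}$, be $\Gamma$-admissible for $\mathcal{C}$. Let $\mathcal{C}^+$ be one of the two oriented spreads obtained from $\mathcal{C}$. Put $\Omega(\mathcal{C})=\{\omega(\mathcal{C}) \mid \omega\in\Omega\}$ and $\Omega(\mathcal{C}^+)=\{\omega(\mathcal{C}^+)\mid \omega\in\Omega\}$. (1) If $\Gamma=\mathrm{O}_2\mathbb{R}$, then $\Omega(\mathcal{C})$ is a topological parallelism of $\mathrm{PG}(3,\mathbb{R})$. (2) If $\mathcal{C}$ is not an $\mathrm{O}_2\mathbb{R}$-rotational spread or $\Omega$ is not $\mathrm{O}_2\mathbb{R}$-admissible for $\mathcal{C}$, then $\Omega(\mathcal{C})$ is not a topological parallelism, but $\Omega(\mathcal{C}^+)$ is an oriented topological parallelism. (3) The oriented parallelism $\Omega(\mathcal{C}^+)$ in (2) does not arise from any ordinary parallelism; that is, there is no topological parallelism $\Pi$ of $\mathrm{PG}(3,\mathbb{R})$ with $\Omega(\mathcal{C}^+)=\Pi^+$.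
   Context: Spreads and orientation. $\mathcal{L}$ is the space of lines of $\mathrm{PG}(3,\mathbb{R})$ (2-dimensional subspaces of $\mathbb{R}^4$) and $\mathcal{L}^+$ the space of oriented lines (2-dimensional subspaces with a vector space orientation), both topologized as coset spaces of $\mathrm{PGL}(4,\mathbb{R})$; forgetting orientation gives a twofold covering $\mathcal{L}^+\to\mathcal{L}$. A compact spread is a compact set of pairwise disjoint lines covering the point set of $\mathrm{PG}(3,\mathbb{R})$; ''spread'' always means compact spread. A spread $\mathcal{C}$ is a 2-sphere, its inverse image in $\mathcal{L}^+$ is a disjoint union of two 2-spheres, each mapped homeomorphically onto $\mathcal{C}$; each of these is called an oriented spread (obtained from, or covering, $\mathcal{C}$). Parallelisms. A topological parallelism $\Pi$ (also: ordinary parallelism) is a set of pairwise disjoint compact spreads covering $\mathcal{L}$ that is a compact subset of the hyperspace of compact subsets of $\mathcal{L}$ (Hausdorff topology). An oriented topological parallelism is a set of pairwise disjoint oriented spreads covering $\mathcal{L}^+$ that is a compact subset of the hyperspace of compact subsets of $\mathcal{L}^+$. For a topological parallelism $\Pi$, $\Pi^+$ is the oriented topological parallelism consisting of all oriented spreads covering members of $\Pi$. Rotational spreads. View $\mathbb{R}^3$ as the affine complement of a plane $F$ of $\mathrm{PG}(3,\mathbb{R})$. Let $Z$ be the (projective closure of the) $z$-axis and $V$ the line at infinity of the $xy$-plane. For functions $a:(0,\infty)\to(0,\infty)$, $b:(0,\infty)\to\mathbb{R}$ and $r>0$ let $\mathcal{R}_r$ be the right-screwed regulus carried by the hyperboloid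 $x^2+y^2-(z-b(r))^2/a(r)^2=r^2$, i.e. the set of all images of the line $\{(r,t,b(r)+a(r)t) \mid t\in\mathbb{R}\}$ under rotations about the $z$-axis. A compact spread is $\mathrm{SO}_2\mathbb{R}$-rotational if it is isomorphic (equivalent under a collineation of $\mathrm{PG}(3,\mathbb{R})$) to a compact spread of the form $\{Z,V\}\cup\bigcup_{r>0}\mathcal{R}_r$ for some $a,b$; it is $\mathrm{O}_2\mathbb{R}$-rotational if this is possible with $b$ constant. Admissibility. $\mathrm{AGL}_3\mathbb{R}\le\mathrm{PGL}_4\mathbb{R}$ is the group of affine transformations of $\mathbb{R}^3$. For $\Omega\le\mathrm{AGL}_3\mathbb{R}$ with $\Omega\cong\mathrm{SO}_3\mathbb{R}$ and a spread $\mathcal{C}$, $\Omega$ is called $\Gamma$-admissible for $\mathcal{C}$ (where $\Gamma$ is $\mathrm{SO}_2\mathbb{R}$ or $\mathrm{O}_2\mathbb{R}$) if $\Omega$ contains a subgroup isomorphic to $\Gamma$ (again denoted $\Gamma$) under which $\mathcal{C}$ is invariant. Isomorphisms of groups are isomorphisms of topological groups. *)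

(* Defs.v *)
From HB Require Import structures.
From mathcomp Require Import all_boot all_order all_algebra.
From mathcomp Require Import all_classical all_reals all_analysis.

Set Implicit Arguments.
Unset Strict Implicit.
Unset Printing Implicit Defensive.

Import Order.TTheory GRing.Theory Num.Theory.
Import numFieldNormedType.Exports.

Local Open Scope classical_set_scope.
Local Open Scope ring_scope.

Definition homeomorphism_on (S T : topologicalType) (f : S -> T)
    (A : set S) (B : set T) : Prop :=
  [/\ set_bij A B f,
      {within A, continuous f} &
      exists g : T -> S, {within B, continuous g} /\ {in A, cancel f g}].

(** ** The hyperspace of compact sets

    The topology below is the one induced by the Hausdorff uniformity of the
    family of all neighbourhoods of the diagonal of [T * T].  It is meant for
    compact Hausdorff [T]: these neighbourhoods are then the entourages of the
    only uniformity of [T], so that for metrizable [T] this is the topology of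
    the Hausdorff distance of any metric defining the topology of [T]. *)

Record hyperspace (T : topologicalType) := Hyperspace {
  hset :> set T;
  hset_compact : compact hset
}.

Section Hyperspace.
Variable T : topologicalType.

HB.instance Definition _ := gen_eqMixin (hyperspace T).
HB.instance Definition _ := gen_choiceMixin (hyperspace T).

Definition hausdorff_close (E : set (T * T)) (K K' : set T) : Prop :=
  (forall x, K x -> exists2 y, K' y & E (x, y)) /\
  (forall y, K' y -> exists2 x, K x & E (x, y)).

Definition hyper_open (O : set (hyperspace T)) : Prop :=
  forall K, O K ->
    exists2 E : set (T * T), (forall x : T, nbhs (x, x) E) &
      [set K' : hyperspace T | hausdorff_close E K K'] `<=` O.

Let hyper_openT : hyper_open setT.
Proof. by move=> K _; exists setT => // x; exact: filterT. Qed.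

Let hyper_openI : setI_closed hyper_open.
Proof.
move=> O1 O2 o1 o2 K [/o1[E1 nE1 s1] /o2[E2 nE2 s2]].
exists (E1 `&` E2); first by move=> x; exact: filterI.
move=> K' [h1 h2]; split.
- apply: s1; split.
  + by move=> x /h1[y Ky [Exy _]]; exists y.
  + by move=> x /h2[y Ky [Exy _]]; exists y.
- apply: s2; split.
  + by move=> x /h1[y Ky [_ Exy]]; exists y.
  + by move=> x /h2[y Ky [_ Exy]]; exists y.
Qed.

Let hyper_open_bigU (I : Type) (f : I -> set (hyperspace T)) :
  (forall i, hyper_open (f i)) -> hyper_open (\bigcup_i f i).
Proof.
move=> fo K [i _ /(fo i)[E nE sE]]; exists E => //.
by move=> K' /sE fK'; exists i.
Qed.

HB.instance Definition _ := isOpenTopological.Build (hyperspace T)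
  hyper_openT hyper_openI hyper_open_bigU.
End Hyperspace.

Definition hypercompact (T : topologicalType) (P : set (set T)) : Prop :=
  P `<=` compact /\ compact [set K : hyperspace T | P K].

(** ** Points and lines of PG(3,R), and the action of GL(4,R) *)

Definition flat (R : realType) (k : nat) : Type :=
  {U : {vspace 'cV[R]_4} | \dim U == k}.
Notation point R := (flat R 1).

(* A separate constant, because lines (unlike points) carry a topology. *)
Definition line (R : realType) : Type := flat R 2.
HB.instance Definition _ (R : realType) := Choice.copy (line R)
  {U : {vspace 'cV[R]_4} | \dim U == 2}.

Definition GL4 (R : realType) : Type :=
  set_type [set g : 'M[R]_4 | g \in unitmx].
HB.instance Definition _ (R : realType) := Topological.copy (GL4 R)
  (set_type [set g : 'M[R]_4 | g \in unitmx]).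

Section Lines.
Variable R : realType.
Local Notation V := 'cV[R]_4.
Implicit Types (g : GL4 R) (L M : line R) (U : {vspace V}).

Definition vs_of_flat k (F : flat R k) : {vspace V} := sval F.
Definition vs_of_line L : {vspace V} := sval L.
Definition mx_of_GL g : 'M[R]_4 := set_val g.

Definition mx_image (A : 'M[R]_4) U : {vspace V} := (linfun (mulmx A) @: U)%VS.

Lemma mx_of_GL_unit g : mx_of_GL g \in unitmx.
Proof. exact: (set_valP g). Qed.

Lemma GL_lker0 g : lker (linfun (mulmx (mx_of_GL g)) : 'End(V)) == 0%VS.
Proof.
apply/lker0P => u v; rewrite !lfunE /=.
move=> /(congr1 (mulmx (invmx (mx_of_GL g)))).
by rewrite !mulKmx // mx_of_GL_unit.
Qed.

Lemma dim_GL_line g L : \dim (mx_image (mx_of_GL g) (vs_of_line L)) == 2.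
Proof.
rewrite /mx_image limg_dim_eq; first by case: L.
by rewrite (eqP (GL_lker0 g)) capv0.
Qed.

Definition GL_line g L : line R :=
  exist _ (mx_image (mx_of_GL g) (vs_of_line L)) (dim_GL_line g L).

(** The topology of [line R] as a coset space: the final topology with respect
    to the orbit maps [g |-> g L] (by transitivity a single [L] would do).
    Since GL(4,R) -> PGL(4,R) is a quotient map that these maps factor through,
    GL(4,R) and PGL(4,R) give the same topology. *)
Definition line_open (O : set (line R)) : Prop :=
  forall L, open [set g : GL4 R | O (GL_line g L)].

Let line_openT : line_open setT.
Proof. by move=> L; exact: openT. Qed.
Let line_openI : setI_closed line_open.
Proof. by move=> O1 O2 o1 o2 L; exact: openI (o1 L) (o2 L). Qed.
Let line_open_bigU (I : Type) (f : I -> set (line R)) :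
  (forall i, line_open (f i)) -> line_open (\bigcup_i f i).
Proof. by move=> fo L; apply: bigcup_open => i _; exact: fo. Qed.
HB.instance Definition _ := isOpenTopological.Build (line R)
  line_openT line_openI line_open_bigU.

End Lines.

(** ** Oriented lines *)

Section OrientedLines.
Variable R : realType.
Local Notation V := 'cV[R]_4.
Implicit Types (g : GL4 R) (L : line R) (U : {vspace V}) (X Y : 2.-tuple V).

Definition change_of_basis X Y : 'M[R]_2 := \matrix_(i, j) coord X j (tnth Y i).

Definition orientation_class U X : set (2.-tuple V) :=
  [set Y : 2.-tuple V | basis_of U Y /\ 0 < \det (change_of_basis X Y)].

Definition is_orientation U (o : set (2.-tuple V)) : Prop :=
  exists2 X : 2.-tuple V, basis_of U X & o = orientation_class U X.

Record oline := OLine {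
  forget : line R;
  orient : set (2.-tuple V);
  orientP : is_orientation (vs_of_line forget) orient
}.

HB.instance Definition _ := gen_eqMixin oline.
HB.instance Definition _ := gen_choiceMixin oline.

Definition mx_map_tuple (A : 'M[R]_4) X : 2.-tuple V := map_tuple (mulmx A) X.

Lemma basis_GL g U X : basis_of U X ->
  basis_of (mx_image (mx_of_GL g) U) (mx_map_tuple (mx_of_GL g) X).
Proof.
move=> bX; rewrite (_ : val _ = map (linfun (mulmx (mx_of_GL g))) X) /=; last first.
  by apply/eq_in_map => v _; rewrite lfunE.
by apply: limg_basis_of => //; rewrite (eqP (GL_lker0 g)) capv0.
Qed.

Lemma basis_GLV g U X : basis_of (mx_image (mx_of_GL g) U) X ->
  exists2 Y : 2.-tuple V, basis_of U Y & X = mx_map_tuple (mx_of_GL g) Y.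
Proof.
move=> bX; have gU := mx_of_GL_unit g.
have gVU : invmx (mx_of_GL g) \in unitmx by rewrite unitmx_inv.
pose h : GL4 R := exist _ (invmx (mx_of_GL g)) (mem_set gVU).
exists (mx_map_tuple (mx_of_GL h) X); last first.
  by apply/val_inj; rewrite /= -map_comp map_id_in // => v _ /=; rewrite mulKVmx.
rewrite [U](_ : _ = mx_image (mx_of_GL h) (mx_image (mx_of_GL g) U)); last first.
  rewrite /mx_image -limg_comp -[LHS]lim1g; congr (_ @: _)%VS.
  by apply/lfunP => v; rewrite comp_lfunE !lfunE /= mulKmx.
exact: basis_GL.
Qed.

Lemma change_of_basis_GL g U X Y : basis_of U X -> basis_of U Y ->
  change_of_basis (mx_map_tuple (mx_of_GL g) X) (mx_map_tuple (mx_of_GL g) Y) =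
  change_of_basis X Y.
Proof.
move=> bX bY; apply/matrixP => i j; rewrite !mxE tnth_map.
have YiU : tnth Y i \in U by apply: (basis_mem bY); exact: mem_tnth.
rewrite {1}(coord_basis bX YiU) mulmx_sumr.
rewrite (eq_bigr (fun k : 'I_2 => coord X k (tnth Y i) *:
    (mx_map_tuple (mx_of_GL g) X)`_k)); last first.
  by move=> k _; rewrite -scalemxAr (nth_map 0) ?size_tuple.
by rewrite coord_sum_free // (basis_free (basis_GL g bX)).
Qed.

Lemma is_orientation_GL g U (o : set (2.-tuple V)) : is_orientation U o ->
  is_orientation (mx_image (mx_of_GL g) U) (mx_map_tuple (mx_of_GL g) @` o).
Proof.
move=> [X bX ->]; exists (mx_map_tuple (mx_of_GL g) X); first exact: basis_GL.
apply/seteqP; split=> [_ [Y [bY dY] <-]|Z [/basis_GLV[Y bY ->] dY]].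
  by split; [exact: basis_GL | rewrite (change_of_basis_GL g bX bY)].
exists Y => //; split=> //.
by rewrite -(change_of_basis_GL g bX bY).
Qed.

Definition GL_oline g (l : oline) : oline :=
  @OLine (GL_line g (forget l)) (mx_map_tuple (mx_of_GL g) @` orient l)
    (is_orientation_GL g (orientP l)).

Definition oline_open (O : set oline) : Prop :=
  forall l, open [set g : GL4 R | O (GL_oline g l)].

Let oline_openT : oline_open setT.
Proof. by move=> L; exact: openT. Qed.
Let oline_openI : setI_closed oline_open.
Proof. by move=> O1 O2 o1 o2 L; exact: openI (o1 L) (o2 L). Qed.
Let oline_open_bigU (I : Type) (f : I -> set oline) :
  (forall i, oline_open (f i)) -> oline_open (\bigcup_i f i).
Proof. by move=> fo L; apply: bigcup_open => i _; exact: fo. Qed.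
HB.instance Definition _ := isOpenTopological.Build oline
  oline_openT oline_openI oline_open_bigU.

End OrientedLines.

(** ** Spreads and parallelisms *)

Section Spreads.
Variable R : realType.
Local Notation line := (line R).
Local Notation oline := (oline R).
Implicit Types (C : set line) (D : set oline).

Definition incident (p : point R) (L : line) : Prop :=
  (vs_of_flat p <= vs_of_line L)%VS.

Definition disjoint_lines (L M : line) : Prop :=
  forall p, ~ (incident p L /\ incident p M).

Definition compact_spread C : Prop :=
  [/\ compact C,
      forall L M, C L -> C M -> L <> M -> disjoint_lines L M &
      forall p, exists2 L, C L & incident p L].

(** [D] is one of the two oriented spreads covering the compact spread [C]. *)
Definition oriented_spread_over C D : Prop :=
  exists D' : set oline,
    [/\ D `|` D' = @forget R @^-1` C,
        D `&` D' = set0,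
        homeomorphism_on (@forget R) D C &
        homeomorphism_on (@forget R) D' C].

Definition oriented_spread D : Prop :=
  exists2 C, compact_spread C & oriented_spread_over C D.

Definition topological_parallelism (P : set (set line)) : Prop :=
  [/\ forall C, P C -> compact_spread C,
      trivIset P id,
      \bigcup_(C in P) C = setT &
      hypercompact P].

Definition oriented_topological_parallelism (P : set (set oline)) : Prop :=
  [/\ forall D, P D -> oriented_spread D,
      trivIset P id,
      \bigcup_(D in P) D = setT &
      hypercompact P].

(** The family called Pi^+ for a parallelism Pi. *)
Definition oriented_cover (P : set (set line)) : set (set oline) :=
  [set D | exists2 C, P C & oriented_spread_over C D].

(** Isomorphism of sets of lines is defined through collineations in the sense
    of incidence geometry, not only through PGL(4,R). *)
Definition collineation (f : point R -> point R) (h : line -> line) : Prop :=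
  [/\ bijective f, bijective h &
      forall p L, incident (f p) (h L) <-> incident p L].

Definition isomorphic_sets (C C' : set line) : Prop :=
  exists f h, collineation f h /\ h @` C = C'.

End Spreads.

(** ** Matrix groups *)

Section MatrixGroups.
Variable R : realType.

Definition matrix_group n (G : set 'M[R]_n) : Prop :=
  [/\ G `<=` [set A | A \in unitmx],
      G 1%:M,
      forall A B, G A -> G B -> G (A *m B) &
      forall A, G A -> G (invmx A)].

Definition orthogonal_group n : set 'M[R]_n := [set A | A^T *m A = 1%:M].
Definition special_orthogonal_group n : set 'M[R]_n :=
  [set A | orthogonal_group A /\ \det A = 1].

Definition topological_group_iso m n (G : set 'M[R]_m) (H : set 'M[R]_n) :=
  exists f : 'M[R]_m -> 'M[R]_n,
    homeomorphism_on f G H /\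
    forall A B, G A -> G B -> f (A *m B) = f A *m f B.

(** The affine map [v |-> A v + t] of R^3 acts on the homogeneous coordinates
    [(v, 1)]; normalizing the last row to [(0, 0, 0, 1)] identifies AGL_3(R)
    with its image in PGL(4,R), as a topological group. *)
Definition AGL3 : set 'M[R]_4 :=
  [set g | exists (A : 'M[R]_3) (t : 'cV[R]_3),
     A \in unitmx /\ g = block_mx A t 0 1%:M :> 'M[R]_(3 + 1)].

End MatrixGroups.

(** ** Rotational spreads *)

Inductive rotation_type := SO2 | O2.

Section Rotational.
Variable R : realType.
Local Notation line := (line R).
Implicit Types (C : set line).

Definition rotation_group (G : rotation_type) : set 'M[R]_2 :=
  match G with
  | SO2 => @special_orthogonal_group R 2
  | O2 => @orthogonal_group R 2
  end.

(** Homogeneous coordinates: the point [(x, y, z)] of R^3 is spanned by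
    [hvec x y z 1], the point at infinity in direction [(x, y, z)] by
    [hvec x y z 0]. *)
Definition hvec (x y z w : R) : 'cV[R]_4 := \col_(i < 4) [:: x; y; z; w]`_i.

Definition z_axis : {vspace 'cV[R]_4} := <<[:: hvec 0 0 0 1; hvec 0 0 1 0]>>%VS.
Definition xy_horizon : {vspace 'cV[R]_4} :=
  <<[:: hvec 1 0 0 0; hvec 0 1 0 0]>>%VS.

Definition rot2 (t : R) : 'M[R]_2 :=
  \matrix_(i < 2, j < 2)
    (nth [::] [:: [:: cos t; - sin t]; [:: sin t; cos t]] i)`_j.

Definition rotz (t : R) : 'M[R]_4 := (block_mx (rot2 t) 0 0 1%:M : 'M[R]_(2 + 2)).

(** The line of all points [(r, t, b + a t)], where [t] ranges over R. *)
Definition generator (r a b : R) : {vspace 'cV[R]_4} :=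
  <<[:: hvec r 0 b 1; hvec 0 1 a 0]>>%VS.

Definition regulus (r a b : R) : set line :=
  [set L | exists t, vs_of_line L = mx_image (rotz t) (generator r a b)].

Definition standard_lines (a b : R -> R) : set line :=
  [set L | vs_of_line L = z_axis \/ vs_of_line L = xy_horizon] `|`
  \bigcup_(r in [set r : R | 0 < r]) regulus r (a r) (b r).

(** Only the values of [a] and [b] at positive arguments matter. *)
Definition rotational (G : rotation_type) C : Prop :=
  compact_spread C /\
  exists a b : R -> R,
    [/\ forall r : R, 0 < r -> 0 < a r,
        G = O2 -> exists b0 : R, forall r : R, 0 < r -> b r = b0,
        compact_spread (standard_lines a b) &
        isomorphic_sets (standard_lines a b) C].

Definition admissible (Omega : set 'M[R]_4) (G : rotation_type) C : Prop :=
  exists H : set 'M[R]_4,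
    [/\ H `<=` Omega, matrix_group H,
        topological_group_iso H (rotation_group G) &
        forall g : GL4 R, H (mx_of_GL g) -> GL_line g @` C = C].

Definition orbit_lines (Omega : set 'M[R]_4) C : set (set line) :=
  [set GL_line g @` C | g in [set g : GL4 R | Omega (mx_of_GL g)]].

Definition orbit_olines (Omega : set 'M[R]_4) (D : set (oline R)) :
    set (set (oline R)) :=
  [set GL_oline g @` D | g in [set g : GL4 R | Omega (mx_of_GL g)]].

End Rotational.

(* Main.v *)
Require Import Defs.
From HB Require Import structures.
From mathcomp Require Import all_boot all_order all_algebra.
From mathcomp Require Import all_classical all_reals all_analysis.
From mathcomp Require Import ring lra.

Set Implicit Arguments.
Unset Strict Implicit.
Unset Printing Implicit Defensive.

Import Order.TTheory GRing.Theory Num.Theory.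
Import numFieldNormedType.Exports.

Local Open Scope classical_set_scope.
Local Open Scope ring_scope.

(** Among suitable positive definite forms, the maximum of the Frobenius norm
    over the [Omega]-orbit has a unique minimizer; this is an [Omega]-invariant
    form, obtained without a Haar measure.  Hence, after a change of coordinates,
    [Omega] is SO(3) and its given subgroup contains the group of rotations about
    the [z]-axis (the [axial] elements).

    A spread [C] invariant under the axial rotations contains the [z]-axis and
    its horizon.  On any other line of [C] the squared distance to the [z]-axis
    is, in homogeneous coordinates, a positive definite binary form in [(z, w)].
    Two of these forms either belong to lines in the same axial orbit or have a
    definite difference, because the lines of [C] are disjoint.  So they form a
    chain, along which the distance from the origin is strictly monotone.  This
    distance is all that SO(3) sees of a line not at infinity, hence every line
    is mapped into [C] by SO(3), and an SO(3)-orbit meets [C] in a single axial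
    orbit.  The SO(3)-stabilizer of an oriented line of [C] is axial, so the
    orbit of an oriented spread is an oriented parallelism.

    For unoriented lines the only obstruction is a half-turn reversing a line of
    [C], and it disappears exactly if [C] is invariant under a non-axial element
    of [Omega].  Such an element makes [C] invariant under a copy of O(2) in
    [Omega], in particular under a half-turn about a horizontal axis, which
    forces every regulus of [C] to be centred at the origin. *)

(** ** The topological group GL(4,R) and its action on lines *)

(** The isomorphism of [Omega] with SO(3) is abstract, and an invariant form only places a conjugate
    of [Omega] among the orthogonal maps that fix the origin and the plane at infinity. That the
    determinants are 1 and that nothing of SO(3) is missing comes from group theory: every rotation
    is a product of squares, SO(3) is not commutative, and a subgroup of SO(3) that contains the
    axial rotations and moves the axis is everything.

    The collineation that puts [C] into standard form bears no relation to these coordinates, so the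
    lines of [C] come without a continuous parameter, and the intermediate value theorem cannot show
    that every distance from the origin occurs. Compactness of an interval of heights, applied to
    the chain of lines, takes its place.

    Orientations enter through signs of 2 by 2 determinants. These are open conditions; hence the
    connected group of axial rotations, which preserves [C], cannot exchange its two oriented
    lifts. *)

Section MatrixContinuity.
Variable R : realType.

Lemma mx_cvg (T : Type) (F : set_system T) (FF : Filter F) m n
    (f : T -> 'M[R]_(m, n)) (A : 'M[R]_(m, n)) :
  (forall i j, f t i j @[t --> F] --> A i j) -> f t @[t --> F] --> A.
Proof.
move=> fA U [P AP PU]; rewrite nbhs_filterE.
suff H : F [set t | forall i j, P i j (f t i j)] by apply: filterS H => t; exact: PU.
have Hi i : F [set t | forall j, P i j (f t i j)].
  by apply: filter_forall => j; exact: fA (AP i j).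
exact: filter_forall.
Qed.

Lemma mulmx_cvg (T : Type) (F : set_system T) (FF : Filter F) m n p
    (f : T -> 'M[R]_(m, n)) (g : T -> 'M[R]_(n, p)) (A : 'M[R]_(m, n)) (B : 'M[R]_(n, p)) :
  f t @[t --> F] --> A -> g t @[t --> F] --> B ->
  (f t *m g t) @[t --> F] --> A *m B.
Proof.
move=> fA gB; apply: mx_cvg => i j; rewrite mxE.
under eq_cvg do rewrite mxE.
apply: cvg_big; first exact: add_continuous.
move=> k _; apply: cvgM.
  by apply: (cvg_comp f (fun X : 'M[R]_(m, n) => X i k) fA); exact: coord_continuous.
by apply: (cvg_comp g (fun X : 'M[R]_(n, p) => X k j) gB); exact: coord_continuous.
Qed.

Lemma mulmx_continuousl m n p (B : 'M[R]_(n, p)) :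
  continuous (fun A : 'M[R]_(m, n) => A *m B).
Proof.
by move=> A; apply: (@mulmx_cvg _ (nbhs A) _ _ _ _ id (fun=> B)); [exact: cvg_id|exact: cvg_cst].
Qed.

Lemma mulmx_continuousr m n p (A : 'M[R]_(m, n)) :
  continuous (fun B : 'M[R]_(n, p) => A *m B).
Proof.
by move=> B; apply: (@mulmx_cvg _ (nbhs B) _ _ _ _ (fun=> A) id); [exact: cvg_cst|exact: cvg_id].
Qed.

Lemma det_cvg (T : Type) (F : set_system T) (FF : Filter F) n
    (f : T -> 'M[R]_n) (A : 'M[R]_n) :
  f t @[t --> F] --> A -> \det (f t) @[t --> F] --> \det A.
Proof.
move=> fA; have fij i j : f t i j @[t --> F] --> A i j.
  by apply: (cvg_comp f (fun X : 'M[R]_n => X i j) fA); exact: coord_continuous.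
rewrite /determinant.
apply: cvg_big; first exact: add_continuous.
move=> s _; apply: cvgM; first exact: cvg_cst.
apply: cvg_big; first exact: mul_continuous.
by move=> i _; exact: fij.
Qed.

End MatrixContinuity.

Section GeneralLinearGroup.
Variable R : realType.
Implicit Types (g h : GL4 R) (A : 'M[R]_4).

Definition mkGL A (uA : A \in unitmx) : GL4 R := exist _ A (mem_set uA).

Lemma mkGLE A (uA : A \in unitmx) : mx_of_GL (mkGL uA) = A.
Proof. by []. Qed.

Lemma GL_inj g h : mx_of_GL g = mx_of_GL h -> g = h.
Proof. exact: val_inj. Qed.

Fact mulGL_subproof g h : mx_of_GL g *m mx_of_GL h \in unitmx.
Proof. by rewrite unitmx_mul !mx_of_GL_unit. Qed.

Fact invGL_subproof g : invmx (mx_of_GL g) \in unitmx.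
Proof. by rewrite unitmx_inv mx_of_GL_unit. Qed.

Definition mulGL g h : GL4 R := mkGL (mulGL_subproof g h).
Definition invGL g : GL4 R := mkGL (invGL_subproof g).
Definition oneGL : GL4 R := mkGL (unitmx1 _ _).

Lemma mulGLA g h k : mulGL g (mulGL h k) = mulGL (mulGL g h) k.
Proof. by apply: GL_inj; rewrite !mkGLE mulmxA. Qed.

Lemma mulGLV g : mulGL g (invGL g) = oneGL.
Proof. by apply: GL_inj; rewrite !mkGLE mulmxV// mx_of_GL_unit. Qed.

Lemma mulVGL g : mulGL (invGL g) g = oneGL.
Proof. by apply: GL_inj; rewrite !mkGLE mulVmx// mx_of_GL_unit. Qed.

Lemma mulGL1 g : mulGL g oneGL = g.
Proof. by apply: GL_inj; rewrite !mkGLE mulmx1. Qed.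

Lemma mul1GL g : mulGL oneGL g = g.
Proof. by apply: GL_inj; rewrite !mkGLE mul1mx. Qed.

Lemma mx_of_GL_continuous : continuous (@mx_of_GL R).
Proof. exact: initial_continuous. Qed.

Lemma cvg_GL (T : Type) (F : set_system T) (FF : Filter F) (f : T -> GL4 R) g :
  mx_of_GL (f t) @[t --> F] --> mx_of_GL g -> f t @[t --> F] --> g.
Proof.
move=> fg U; rewrite nbhsE => -[V [oV Vg] VU].
case: oV => W oW WV; rewrite nbhs_filterE; apply: filterS VU _.
rewrite -WV in Vg *.
by apply: fg; exact: open_nbhs_nbhs.
Qed.

End GeneralLinearGroup.

(** * Actions of GL(4,R) on spaces with the final topology *)

Section FinalTopologyAction.
Variables (R : realType) (T : topologicalType) (act : GL4 R -> T -> T).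
Hypothesis act_openE : forall O : set T,
  open O <-> forall x, open [set g : GL4 R | O (act g x)].
Hypothesis actM : forall g h x, act (mulGL g h) x = act g (act h x).
Hypothesis act1 : forall x, act (@oneGL R) x = x.
Hypothesis act_trans : forall x y, exists g, act g x = y.

Lemma mulGL_continuous : continuous (fun p : GL4 R * GL4 R => mulGL p.1 p.2).
Proof.
move=> [g h] /=; apply: cvg_GL => /=; apply: mulmx_cvg.
  by apply: (cvg_comp fst (@mx_of_GL R)); [exact: cvg_fst|exact: mx_of_GL_continuous].
by apply: (cvg_comp snd (@mx_of_GL R)); [exact: cvg_snd|exact: mx_of_GL_continuous].
Qed.

Lemma mulGL_continuousl h : continuous (fun g : GL4 R => mulGL g h).
Proof.
move=> g; have H := continuous2_cvg (nbhs_filter g) (h := @mulGL R)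
  (@mulGL_continuous (g, h)).
by apply: H; [exact: cvg_id|exact: cvg_cst].
Qed.

(** In the final topology, openness is tested along the orbit map of each [y = act h x]. There the
    preimage is a union of right translates of [U], one for each [s] in the stabilizer of [x]. *)
Lemma orbit_map_open x (U : set (GL4 R)) : open U -> open ((act^~ x) @` U).
Proof.
move=> oU; apply/act_openE => y; have [h hx] := act_trans x y.
rewrite [X in open X](_ : _ = \bigcup_(s in [set s | act s x = x])
    ((fun g => mulGL g (mulGL h s)) @^-1` U)); last first.
  apply/seteqP; split => [g /= [u Uu ux]|g /= [s /= sx Us]].
    exists (mulGL (invGL (mulGL g h)) u) => /=.
      by rewrite actM ux -[in LHS]hx -(actM g) -actM mulVGL act1.
    by rewrite mulGLA mulGLA mulGLV mul1GL.
  by exists (mulGL g (mulGL h s)) => //=; rewrite !actM sx hx.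
apply: bigcup_open => s _.
by move/continuousP : (@mulGL_continuousl (mulGL h s)); exact.
Qed.

(** Openness of the orbit maps supplies neighbourhoods of [y] of the form [N1 y], on which the
    action is multiplication in [GL4]. *)
Lemma act_continuous : continuous (fun p : GL4 R * T => act p.1 p.2).
Proof.
move=> [g y] /= O; rewrite nbhsE => -[W [oW Wgy] WO].
have oW' : nbhs g [set g | W (act g y)].
  by apply: open_nbhs_nbhs; split => //; exact: ((act_openE W).1 oW y).
have : nbhs (g, @oneGL R) [set p | W (act (mulGL p.1 p.2) y)].
  by apply: (@mulGL_continuous (g, @oneGL R) [set g | W (act g y)]); rewrite /= mulGL1.
move=> [[N N'] /= [Ng N1] NN]; rewrite nbhs_filterE.
move: N1; rewrite nbhsE => -[N1 [oN1 N11] N1N].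
exists (N, (act^~ y) @` N1).
  split => //=; apply: open_nbhs_nbhs; split; first exact: orbit_map_open.
  by exists (@oneGL R).
by move=> [a _] /= [Na [b N1b <-]]; rewrite -actM; apply/WO/(NN (a, b)); split => //; exact: N1N.
Qed.

Lemma act_continuous_at g : continuous (act g).
Proof.
move=> x; have H := continuous2_cvg (nbhs_filter x) (h := act) (@act_continuous (g, x)).
by apply: H; [exact: cvg_cst|exact: cvg_id].
Qed.

Lemma orbit_map_continuous x : continuous (act^~ x).
Proof.
move=> g; have H := continuous2_cvg (nbhs_filter g) (h := act) (@act_continuous (g, x)).
by apply: H; [exact: cvg_id|exact: cvg_cst].
Qed.

Lemma compact_act g (A : set T) : compact A -> compact (act g @` A).
Proof.
by move=> cA; apply: continuous_compact => //; apply/continuous_subspaceT/act_continuous_at.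
Qed.

(** The image of [A] under [g] depends continuously on [g]: each point of [A] leaves some room for
    [g], and compactness of [A] makes this room uniform. *)
Lemma hypercompact_orbit (K : set (GL4 R)) (A : set T) : compact K -> compact A ->
  hypercompact [set act g @` A | g in K].
Proof.
move=> cK cA; split; first by move=> _ [g _ <-]; exact: compact_act.
pose F g := Hyperspace (@compact_act g A cA).
rewrite [X in compact X](_ : _ = F @` K); last first.
  apply/seteqP; split => [[B cB] /= [g Kg AB]|_ [g Kg <-]]; last by exists g.
  by exists g => //; rewrite /F; case: _ / AB cB => cB; congr Hyperspace; exact: Prop_irrelevance.
apply: continuous_compact => //; apply: continuous_subspaceT => g.
move=> O; rewrite nbhsE => -[W [oW Wg] WO].
have [E nE EW] := oW _ Wg; rewrite nbhs_filterE.
suff H : \forall g' \near g, A `<=` [set x | E (act g x, act g' x)].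
  apply: filterS H => g' Ag'; apply/WO/EW; split => [_ [x Ax <-]|_ [x Ax <-]].
    by exists (act g' x); [exists x|exact: Ag'].
  by exists (act g x); [exists x|exact: Ag'].
apply: ((compact_near_coveringP A).1 cA (GL4 R) (nbhs g)
  (fun g' x => E (act g x, act g' x)) (nbhs_filter g)).
move=> x Ax; have := nE (act g x).
move=> [[P Q] /= [nP nQ] PQ].
have nP' : nbhs x [set x' | P (act g x')] by exact: act_continuous_at nP.
have := @act_continuous (g, x) _ nQ.
move=> [[N M] /= [Ng Mx] NM].
exists ([set x' | P (act g x')] `&` M, N); first by split => //=; exact: filterI.
by move=> [x' g'] /= [[Px' Mx'] Ng']; apply: PQ; split => //=; exact: (NM (g', x')).
Qed.

End FinalTopologyAction.

(** * The transitive actions on lines and on oriented lines *)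

Section LineAction.
Variable R : realType.
Local Notation V := 'cV[R]_4.
Implicit Types (g h : GL4 R) (L M : line R) (U : {vspace V}) (l m : oline R).

Lemma line_eq L M : vs_of_line L = vs_of_line M -> L = M.
Proof. exact: val_inj. Qed.

Lemma line_eqP L M : (forall v, (v \in vs_of_line L) = (v \in vs_of_line M)) -> L = M.
Proof. by move=> LM; apply/line_eq/vspaceP. Qed.

Lemma mem_mx_image g U v :
  (v \in mx_image (mx_of_GL g) U) = (invmx (mx_of_GL g) *m v \in U).
Proof.
have gU := mx_of_GL_unit g; apply/memv_imgP/idP => [[u uU ->]|vU].
  by rewrite lfunE /= mulKmx.
by exists (invmx (mx_of_GL g) *m v) => //; rewrite lfunE /= mulKVmx.
Qed.

Lemma mem_mx_image2 g U v :
  (mx_of_GL g *m v \in mx_image (mx_of_GL g) U) = (v \in U).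
Proof. by rewrite mem_mx_image mulKmx // mx_of_GL_unit. Qed.

Lemma mx_imageM g h U : mx_image (mx_of_GL (mulGL g h)) U =
  mx_image (mx_of_GL g) (mx_image (mx_of_GL h) U).
Proof.
apply/vspaceP => v; rewrite -[v](mulKVmx (mx_of_GL_unit (mulGL g h))).
by rewrite mem_mx_image2 {2}mkGLE -mulmxA !mem_mx_image2.
Qed.

Lemma GL_lineM g h L : GL_line (mulGL g h) L = GL_line g (GL_line h L).
Proof. by apply: line_eq; exact: mx_imageM. Qed.

Lemma GL_line1 L : GL_line (@oneGL R) L = L.
Proof. by apply: line_eqP => v; rewrite mem_mx_image invmx1 mul1mx. Qed.

Lemma oline_eq l m : forget l = forget m -> orient l = orient m -> l = m.
Proof.
case: l m => L o p [M o' p'] /= LM oo'; case: _ / LM p p' => p p'.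
by case: _ / oo' p p' => p p'; congr OLine; exact: Prop_irrelevance.
Qed.

Lemma mx_map_tupleM (A B : 'M[R]_4) (X : 2.-tuple V) :
  mx_map_tuple (A *m B) X = mx_map_tuple A (mx_map_tuple B X).
Proof.
by apply/val_inj; rewrite /= -map_comp; apply/eq_map => v /=; rewrite mulmxA.
Qed.

Lemma mx_map_tuple1 (X : 2.-tuple V) : mx_map_tuple 1%:M X = X.
Proof. by apply/val_inj; rewrite /= map_id_in // => v _; rewrite mul1mx. Qed.

Lemma GL_olineM g h l : GL_oline (mulGL g h) l = GL_oline g (GL_oline h l).
Proof.
apply: oline_eq; first exact: GL_lineM.
by rewrite /= image_comp; apply: eq_imagel => X _ /=; rewrite -mx_map_tupleM.
Qed.

Lemma GL_oline1 l : GL_oline (@oneGL R) l = l.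
Proof.
apply: oline_eq; first exact: GL_line1.
by rewrite /= -[RHS]image_id; apply: eq_imagel => X _ /=; rewrite mx_map_tuple1.
Qed.

Lemma orientation_class_GL g U (X : 2.-tuple V) : basis_of U X ->
  mx_map_tuple (mx_of_GL g) @` orientation_class U X =
  orientation_class (mx_image (mx_of_GL g) U) (mx_map_tuple (mx_of_GL g) X).
Proof.
move=> bX; apply/seteqP; split=> [_ [Y [bY dY] <-]|Z [/basis_GLV[Y bY ->] dY]].
  by split; [exact: basis_GL | rewrite (change_of_basis_GL g bX bY)].
exists Y => //; split=> //.
by rewrite -(change_of_basis_GL g bX bY).
Qed.

Lemma line_basis L : exists X : 2.-tuple V, basis_of (vs_of_line L) X.
Proof.
case: L => U dU; exists (tcast (eqP dU) (vbasis U)).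
by rewrite val_tcast; exact: vbasisP.
Qed.

Definition std_tuple : 2.-tuple V := [tuple delta_mx ord0 0; delta_mx 1 0].

(** Gaussian elimination writes the matrix [B] with rows [X] as a partial identity between two
    invertible matrices. Enlarging [col_ebase] by an identity block and dropping the partial
    identity gives an invertible matrix with upper half [B]. *)
Lemma free_completion (X : 2.-tuple V) : free X ->
  exists g, mx_map_tuple (mx_of_GL g) std_tuple = X.
Proof.
move=> fX; pose B : 'M[R]_(2, 2 + 2) := \matrix_(i, j) (tnth X i) j 0.
have fB : row_free B.
  apply/inj_row_free => u uB.
  have H i : u 0 i = 0.
    move/freeP : fX => /(_ (fun i => u 0 i)); apply.
    apply/matrixP => j k; rewrite ord1 summxE [RHS]mxE.
    move/matrixP : uB => /(_ 0 j); rewrite !mxE => uB; rewrite -[RHS]uB.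
    by apply: eq_bigr => a _; rewrite !mxE (tnth_nth 0).
  by apply/rowP => i; rewrite H mxE.
pose A : 'M[R]_(2 + 2) := block_mx (col_ebase B) 0 0 1%:M *m row_ebase B.
have uA : A^T \in unitmx.
  rewrite unitmx_tr unitmx_mul row_ebase_unit andbT.
  by rewrite unitmxE det_ublock det1 mulr1 -unitmxE col_ebase_unit.
have AB : usubmx A = B.
  rewrite -[RHS]mulmx_ebase (eqP fB).
  rewrite /A block_mxEv mul_col_mx col_mxKu; congr (_ *m _).
  by rewrite pid_mx_row mul_mx_row mulmx1 mulmx0.
exists (@mkGL R A^T uA); rewrite mkGLE; apply: eq_from_tnth => i.
rewrite tnth_map; apply/matrixP => j k; rewrite ord1.
have -> : tnth std_tuple i = delta_mx (lshift 2 i) 0.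
  rewrite (tnth_nth 0); case: i => -[|[|]] //= ? ; congr delta_mx; exact/val_inj.
rewrite -colE !mxE; have := AB; move/matrixP => /(_ i j); rewrite !mxE => <-.
by [].
Qed.

Lemma free_transitive (X Y : 2.-tuple V) : free X -> free Y ->
  exists g, mx_map_tuple (mx_of_GL g) X = Y.
Proof.
move=> /free_completion[g gX] /free_completion[h hY].
exists (mulGL h (invGL g)); rewrite mkGLE mx_map_tupleM -gX.
rewrite -[X in mx_map_tuple _ X]mx_map_tupleM mkGLE mulVmx ?mx_of_GL_unit//.
by rewrite mx_map_tuple1.
Qed.

Lemma mx_image_basis g U W (X : 2.-tuple V) : basis_of U X ->
  basis_of W (mx_map_tuple (mx_of_GL g) X) -> mx_image (mx_of_GL g) U = W.
Proof. by move=> /(basis_GL g)/span_basis <- /span_basis <-. Qed.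

Lemma GL_line_transitive L M : exists g, GL_line g L = M.
Proof.
have [X bX] := line_basis L; have [Y bY] := line_basis M.
have [g gX] := free_transitive (basis_free bX) (basis_free bY).
by exists g; apply/line_eq/(mx_image_basis bX); rewrite gX.
Qed.

Lemma GL_oline_transitive l m : exists g, GL_oline g l = m.
Proof.
have [X bX oX] := orientP l; have [Y bY oY] := orientP m.
have [g gX] := free_transitive (basis_free bX) (basis_free bY).
have gl : mx_image (mx_of_GL g) (vs_of_line (forget l)) = vs_of_line (forget m).
  by apply: (mx_image_basis bX); rewrite gX.
exists g; apply: oline_eq; first exact: line_eq.
by rewrite /= oX orientation_class_GL// gl gX.
Qed.

Lemma line_openE (O : set (line R)) :
  open O <-> forall L, open [set g : GL4 R | O (GL_line g L)].
Proof. by []. Qed.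

Lemma oline_openE (O : set (oline R)) :
  open O <-> forall l, open [set g : GL4 R | O (GL_oline g l)].
Proof. by []. Qed.

Definition GL_line_continuous :=
  act_continuous_at line_openE GL_lineM GL_line1 GL_line_transitive.
Definition GL_oline_continuous :=
  act_continuous_at oline_openE GL_olineM GL_oline1 GL_oline_transitive.
Definition GL_oline_orbit_continuous :=
  orbit_map_continuous oline_openE GL_olineM GL_oline1 GL_oline_transitive.
Definition GL_line_orbit_continuous :=
  orbit_map_continuous line_openE GL_lineM GL_line1 GL_line_transitive.
Definition hypercompact_lines :=
  hypercompact_orbit line_openE GL_lineM GL_line1 GL_line_transitive.
Definition hypercompact_olines :=
  hypercompact_orbit oline_openE GL_olineM GL_oline1 GL_oline_transitive.

Lemma forget_continuous : continuous (@forget R).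
Proof. by apply/continuousP => O oO; apply/oline_openE => l; exact: oO. Qed.

End LineAction.

(** ** Oriented lines and oriented spreads *)

Section Orientations.
Variable R : realType.
Local Notation V := 'cV[R]_4.
Implicit Types (g h : GL4 R) (L M : line R) (U : {vspace V}) (l m : oline R).
Implicit Types (X Y Z : 2.-tuple V) (B : 'M[R]_(2, 4)).

Definition tuple_mx X : 'M[R]_(4, 2) := \matrix_(i, j) (tnth X j) i 0.

Lemma tuple_mx_map (A : 'M[R]_4) X : tuple_mx (mx_map_tuple A X) = A *m tuple_mx X.
Proof.
by apply/matrixP => i j; rewrite !mxE tnth_map !mxE; apply: eq_bigr => k _; rewrite mxE.
Qed.

Lemma change_of_basisM U X Y Z : basis_of U X -> basis_of U Y -> basis_of U Z ->
  change_of_basis X Z = change_of_basis Y Z *m change_of_basis X Y.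
Proof.
move=> bX bY bZ; apply/matrixP => i j; rewrite !mxE.
have ZU : tnth Z i \in U by apply: (basis_mem bZ); exact: mem_tnth.
rewrite {1}(coord_basis bY ZU) linear_sum; apply: eq_bigr => k _ /=.
by rewrite linearZ /= !mxE !(tnth_nth 0).
Qed.

Lemma tuple_mx_change U X Y : basis_of U X -> basis_of U Y ->
  tuple_mx Y = tuple_mx X *m (change_of_basis X Y)^T.
Proof.
move=> bX bY; apply/matrixP => i j; rewrite !mxE.
have YU : tnth Y j \in U by apply: (basis_mem bY); exact: mem_tnth.
rewrite {1}(coord_basis bX YU) summxE; apply: eq_bigr => k _.
by rewrite !mxE mulrC !(tnth_nth 0).
Qed.

Lemma change_of_basis_id U X : basis_of U X -> change_of_basis X X = 1%:M.
Proof.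
move=> bX; apply/matrixP => i j; rewrite !mxE (tnth_nth 0) coord_free //.
exact: basis_free bX.
Qed.

Lemma det_change_neq0 U X Y : basis_of U X -> basis_of U Y ->
  \det (change_of_basis X Y) != 0.
Proof.
move=> bX bY; have := congr1 determinant (change_of_basisM bX bY bX).
rewrite (change_of_basis_id bX) det1 det_mulmx => /esym/eqP.
by apply: contraTneq => ->; rewrite mulr0 eq_sym oner_eq0.
Qed.

Lemma orient_basis l X : orient l X -> basis_of (vs_of_line (forget l)) X.
Proof. by have [Y bY ->] := orientP l; case. Qed.

Lemma orient_ex l : exists X, orient l X.
Proof.
have [Y bY ->] := orientP l; exists Y; split => //.
by rewrite (change_of_basis_id bY) det1.
Qed.

Lemma orientE l X : orient l X -> orient l = orientation_class (vs_of_line (forget l)) X.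
Proof.
move=> oX; have bX := orient_basis oX; move: oX.
have [Y bY ->] := orientP l => -[_ dX].
apply/seteqP; split => Z [bZ dZ]; split => //.
  by move: dZ; rewrite (change_of_basisM bY bX bZ) det_mulmx pmulr_lgt0.
by rewrite (change_of_basisM bY bX bZ) det_mulmx pmulr_lgt0.
Qed.

(* The side tests [orient_side B] separate the two orientations of a line
   that is not mapped to a smaller dimension by [B]. *)
Definition orient_side B l := exists2 X, orient l X & 0 < \det (B *m tuple_mx X).

Lemma orient_side_open B : open (orient_side B).
Proof.
apply/oline_openE => l; rewrite openE => g [Y /= [X lX <-] dX].
have H : \forall h \near g, 0 < \det (B *m (mx_of_GL h *m tuple_mx X)).
  have c : (fun h => \det (B *m (mx_of_GL h *m tuple_mx X))) @ g -->
      \det (B *m (mx_of_GL g *m tuple_mx X)).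
    have c1 := cvg_comp (@mx_of_GL R) (fun A => A *m tuple_mx X)
      (@mx_of_GL_continuous R g) (@mulmx_continuousl R _ _ _ (tuple_mx X) _).
    have c2 := cvg_comp _ (fun A => B *m A) c1 (@mulmx_continuousr R _ _ _ B _).
    exact: (det_cvg _ c2).
  apply: (c [set x | 0 < x]); apply: open_nbhs_nbhs; split; first exact: open_gt.
  by rewrite /= -tuple_mx_map.
apply: filterS H => h dh; exists (mx_map_tuple (mx_of_GL h) X); first by exists X.
by rewrite tuple_mx_map.
Qed.

Lemma orient_side_gt0 B l X : orient_side B l -> orient l X -> 0 < \det (B *m tuple_mx X).
Proof.
move=> [Y lY dY] lX; have bY := orient_basis lY; have bX := orient_basis lX.
rewrite (tuple_mx_change bY bX) mulmxA det_mulmx det_tr pmulr_rgt0 //.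
by move: lX; rewrite (orientE lY) => -[].
Qed.

(** Negating one row exchanges the tests for the two orientations of a line. *)
Definition flip_mx B : 'M[R]_(2, 4) := diag_mx (\row_i (if i == 0 then -1 else 1)) *m B.

Lemma det_flip B (A : 'M[R]_(4, 2)) : \det (flip_mx B *m A) = - \det (B *m A).
Proof.
by rewrite /flip_mx -mulmxA det_mulmx det_diag !big_ord_recl big_ord0 !mxE /= !mulr1 mulN1r.
Qed.

Lemma orient_side_flip B l : orient_side B l -> orient_side (flip_mx B) l -> False.
Proof.
move=> sl [X lX]; have := orient_side_gt0 sl lX.
by move=> a; rewrite det_flip oppr_gt0 ltNge (ltW a).
Qed.

Lemma orient_side_inj B l m : forget l = forget m ->
  orient_side B l -> orient_side B m -> l = m.
Proof.
move=> lm sl sm; apply: oline_eq => //.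
have [X lX] := orient_ex l; have [Y mY] := orient_ex m.
have bX := orient_basis lX; have bY := orient_basis mY.
have mX : orient m X.
  rewrite (orientE mY) -lm; rewrite -lm in bY; split => //.
  have := orient_side_gt0 sl lX; have := orient_side_gt0 sm mY.
  by rewrite (tuple_mx_change bY bX) mulmxA det_mulmx det_tr => /pmulr_rgt0 ->.
by rewrite (orientE lX) (orientE mX) lm.
Qed.

Lemma orient_side_total B l m : forget l = forget m -> orient_side B l ->
  orient_side B m \/ orient_side (flip_mx B) m.
Proof.
move=> lm sl; have [X lX] := orient_ex l; have [Y mY] := orient_ex m.
have bX := orient_basis lX; have bY := orient_basis mY.
rewrite -lm in bY; have := orient_side_gt0 sl lX.
have := det_change_neq0 bX bY; rewrite neq_lt => /orP[d0|d0] dX.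
  right; exists Y => //; rewrite det_flip (tuple_mx_change bX bY) mulmxA det_mulmx det_tr.
  by rewrite oppr_gt0 pmulr_rlt0.
by left; exists Y => //; rewrite (tuple_mx_change bX bY) mulmxA det_mulmx det_tr pmulr_rgt0.
Qed.

Lemma tuple_mx_left_inverse X : free X -> exists B, B *m tuple_mx X = 1%:M.
Proof.
move=> /free_completion[g <-]; rewrite tuple_mx_map.
exists ((tuple_mx (@std_tuple R))^T *m invmx (mx_of_GL g)).
rewrite mulmxA mulmxKV ?mx_of_GL_unit //.
apply/matrixP => i j; rewrite !mxE !big_ord_recl big_ord0 !mxE.
by case: i => -[|[|]] //= ?; case: j => -[|[|]] //= ?;
  rewrite !mxE /= ?(mulr0,mulr1,mul0r,addr0,add0r).
Qed.

Lemma orient_side_ex l : exists B, orient_side B l.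
Proof.
have [X lX] := orient_ex l.
have [B BX] := tuple_mx_left_inverse (basis_free (orient_basis lX)).
by exists B, X => //; rewrite BX det1.
Qed.

Lemma GL_oline_stab g l X (c : 'M[R]_2) : orient l X ->
  GL_line g (forget l) = forget l -> mx_of_GL g *m tuple_mx X = tuple_mx X *m c ->
  (0 < \det c) = `[< GL_oline g l = l >].
Proof.
move=> lX gl gX; have [B BX] := tuple_mx_left_inverse (basis_free (orient_basis lX)).
have sB : orient_side B l by exists X => //; rewrite BX det1.
have oX : orient (GL_oline g l) (mx_map_tuple (mx_of_GL g) X) by exists X.
apply/idP/asboolP => [c0|gl'].
  apply: orient_side_inj sB => //; exists (mx_map_tuple (mx_of_GL g) X) => //.
  by rewrite tuple_mx_map gX mulmxA BX mul1mx.
rewrite -gl' in sB; have := orient_side_gt0 sB oX.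
by rewrite tuple_mx_map gX mulmxA BX mul1mx.
Qed.

Lemma oline_two l m k : forget l = forget m -> forget m = forget k -> l <> m -> k <> m ->
  l = k.
Proof.
move=> lm mk nlm nkm; have [B sB] := orient_side_ex m.
have [/(orient_side_inj lm)/(_ sB)//|sl] := orient_side_total (esym lm) sB.
have [/(orient_side_inj (esym mk))/(_ sB)//|sk] := orient_side_total mk sB.
by apply: orient_side_inj sl sk; rewrite lm.
Qed.

End Orientations.

Section Spreads.
Variable R : realType.
Implicit Types (C : set (line R)) (D : set (oline R)) (g : GL4 R).
Local Notation V := 'cV[R]_4.

Lemma compact_spreadP C : compact_spread C <->
  [/\ compact C,
    forall L M (v : V), C L -> C M -> v != 0 -> v \in vs_of_line L ->
      v \in vs_of_line M -> L = M &
    forall v : V, v != 0 -> exists2 L, C L & v \in vs_of_line L].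
Proof.
have pt (v : V) : v != 0 -> \dim <[v]>%VS == 1%N by move=> v0; rewrite dim_vline v0.
split=> -[cC dC covC]; split => //.
- move=> L M v CL CM v0 vL vM; apply: contrapT => LM.
  apply: (dC _ _ CL CM LM (exist _ <[v]>%VS (pt v v0))).
  by rewrite /incident /= -!memvE.
- move=> v v0; have [L CL vL] := covC (exist _ <[v]>%VS (pt v v0)).
  by exists L => //; rewrite memvE.
- move=> L M CL CM LM [U dU] [/= UL UM]; apply: LM.
  rewrite /incident /vs_of_flat /= in UL UM.
  apply: (dC _ _ (vpick U)) => //; rewrite ?vpick0 -?dimv_eq0 ?(eqP dU) //.
  - by apply: (subvP UL); exact: memv_pick.
  - by apply: (subvP UM); exact: memv_pick.
- move=> [U dU]; have v0 : vpick U != 0 by rewrite vpick0 -dimv_eq0 (eqP dU).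
  have [L CL vL] := covC _ v0; exists L => //; rewrite /incident /vs_of_flat /=.
  have vU : (<[vpick U]> <= U)%VS by rewrite -memvE memv_pick.
  have UV : (U <= <[vpick U]>)%VS.
    by rewrite -(geq_leqif (dimv_leqif_sup vU)) (eqP dU) dim_vline v0.
  by rewrite (subv_trans UV) // -memvE.
Qed.

End Spreads.

Section SpreadAction.
Variable R : realType.
Implicit Types (C : set (line R)) (D : set (oline R)) (g : GL4 R).
Local Notation V := 'cV[R]_4.

Lemma GL_lineK g : cancel (GL_line g) (GL_line (invGL g)).
Proof. by move=> L; rewrite -GL_lineM mulVGL GL_line1. Qed.

Lemma GL_lineVK g : cancel (GL_line (invGL g)) (GL_line g).
Proof. by move=> L; rewrite -GL_lineM mulGLV GL_line1. Qed.

Lemma GL_olineK g : cancel (GL_oline g) (GL_oline (invGL g)).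
Proof. by move=> L; rewrite -GL_olineM mulVGL GL_oline1. Qed.

Lemma GL_olineVK g : cancel (GL_oline (invGL g)) (GL_oline g).
Proof. by move=> L; rewrite -GL_olineM mulGLV GL_oline1. Qed.

Lemma GL_lines_imageP g C L : (GL_line g @` C) L <-> C (GL_line (invGL g) L).
Proof.
split=> [[M CM <-]|CL]; first by rewrite GL_lineK.
by exists (GL_line (invGL g) L) => //; rewrite GL_lineVK.
Qed.

Lemma GL_olines_imageP g D l : (GL_oline g @` D) l <-> D (GL_oline (invGL g) l).
Proof.
split=> [[m Dm <-]|Dl]; first by rewrite GL_olineK.
by exists (GL_oline (invGL g) l) => //; rewrite GL_olineVK.
Qed.

Lemma GL_lines_imageM g h C :
  GL_line (mulGL g h) @` C = GL_line g @` (GL_line h @` C).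
Proof. by rewrite image_comp; apply: eq_imagel => L _ /=; rewrite GL_lineM. Qed.

Lemma GL_olines_imageM g h D :
  GL_oline (mulGL g h) @` D = GL_oline g @` (GL_oline h @` D).
Proof. by rewrite image_comp; apply: eq_imagel => L _ /=; rewrite GL_olineM. Qed.

Lemma GL_lines_image1 C : GL_line (@oneGL R) @` C = C.
Proof. by rewrite -[RHS]image_id; apply: eq_imagel => L _; rewrite GL_line1. Qed.

Lemma GL_olines_image1 D : GL_oline (@oneGL R) @` D = D.
Proof. by rewrite -[RHS]image_id; apply: eq_imagel => L _; rewrite GL_oline1. Qed.

Lemma mulmx_GL_eq0 g (v : V) : (mx_of_GL g *m v == 0) = (v == 0).
Proof.
apply/eqP/eqP => [gv|->]; last by rewrite mulmx0.
by rewrite -(mulKmx (mx_of_GL_unit g) v) gv mulmx0.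
Qed.

Lemma compact_spread_GL g C : compact_spread C -> compact_spread (GL_line g @` C).
Proof.
move=> /compact_spreadP[cC dC covC]; apply/compact_spreadP; split.
- by apply: continuous_compact => //; apply/continuous_subspaceT/GL_line_continuous.
- move=> _ _ v [L CL <-] [M CM <-] v0; rewrite !mem_mx_image => vL vM.
  congr GL_line; apply: (dC _ _ _ CL CM _ vL vM).
  by rewrite -(mulmx_GL_eq0 g) mulKVmx // mx_of_GL_unit.
- move=> v v0; have w0 : invmx (mx_of_GL g) *m v != 0.
    by rewrite -(mulmx_GL_eq0 g) mulKVmx // mx_of_GL_unit.
  by have [L CL vL] := covC _ w0; exists (GL_line g L); [exists L|rewrite mem_mx_image].
Qed.

Lemma homeomorphism_on_GL g C D : homeomorphism_on (@forget R) D C ->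
  homeomorphism_on (@forget R) (GL_oline g @` D) (GL_line g @` C).
Proof.
move=> [[fDC iD sC] _ [s [cs sK]]]; split.
- split.
  + by move=> _ [l Dl <-] /=; exists (forget l) => //; exact: fDC.
  + move=> _ _ /set_mem[l Dl <-] /set_mem[m Dm <-] /= lm; congr GL_oline.
    by apply: iD; rewrite ?inE //; exact: (can_inj (GL_lineK g)).
  + by move=> _ [L /sC[l Dl <-] <-]; exists (GL_oline g l) => //; exists l.
- by apply/continuous_subspaceT/forget_continuous.
- exists (GL_oline g \o s \o GL_line (invGL g)); split; last first.
    by move=> _ /set_mem[l Dl <-] /=; rewrite GL_lineK sK ?inE.
  apply/subspace_continuousP => _ [L CL <-].
  have e : GL_oline g (s (GL_line (invGL g) (GL_line g L))) = GL_oline g (s L).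
    by rewrite GL_lineK.
  suff step : s (GL_line (invGL g) M) @[M --> within (GL_line g @` C) (nbhs (GL_line g L))]
      --> s L.
    have := cvg_comp _ (GL_oline g) step (@GL_oline_continuous R g (s L)).
    by rewrite -e.
  move/subspace_continuousP : cs => /(_ L CL) cs U /= /cs sU.
  have W : nbhs (GL_line g L)
      (GL_line (invGL g) @^-1` [set x | C x -> (s @^-1` U) x]).
    have := @GL_line_continuous R (invGL g) (GL_line g L).
    by rewrite /continuous_at GL_lineK; apply; exact: sU.
  rewrite nbhs_simpl /within /=; apply: filterS W => M /= CM gM; apply: CM.
  by move/GL_lines_imageP : gM.
Qed.

Lemma oriented_spread_over_GL g C D : oriented_spread_over C D ->
  oriented_spread_over (GL_line g @` C) (GL_oline g @` D).
Proof.
move=> [D' [DD' DD0 hD hD']]; exists (GL_oline g @` D'); split.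
- rewrite -image_setU DD'; apply/seteqP; split => [_ [l Cl <-]|l /GL_lines_imageP Cl].
    by exists (forget l).
  by apply/GL_olines_imageP; exact: Cl.
- apply/seteqP; split => // _ [[l Dl <-] [m Dm /(can_inj (GL_olineK g)) ml]].
  by rewrite ml in Dm; have : (D `&` D') l by []; rewrite DD0.
- exact: homeomorphism_on_GL.
- exact: homeomorphism_on_GL.
Qed.

Lemma oriented_spread_over_compl C D D' : D `|` D' = @forget R @^-1` C ->
  D `&` D' = set0 -> homeomorphism_on (@forget R) D C ->
  homeomorphism_on (@forget R) D' C -> oriented_spread_over C D'.
Proof. by move=> DD' D0 hD hD'; exists D; split; rewrite 1?setUC 1?setIC. Qed.

Lemma oriented_spread_compact C D : compact C -> oriented_spread_over C D -> compact D.
Proof.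
move=> cC [_ [_ _ [[fDC iD sC] _ [s [cs sK]]] _]].
rewrite (_ : D = s @` C); first exact: continuous_compact.
apply/seteqP; split=> [l Dl|_ [L CL <-]].
  by exists (forget l); [exact: fDC|rewrite sK ?inE].
by have [l Dl <-] := sC _ CL; rewrite sK ?inE.
Qed.

Section OverSpread.
Variables (C : set (line R)) (D : set (oline R)).
Hypothesis CD : oriented_spread_over C D.

Lemma over_sub l : D l -> C (forget l).
Proof. by have [_ [_ _ [[fDC _ _] _ _] _]] := CD; exact: fDC. Qed.

Lemma over_lift L : C L -> exists2 l, D l & forget l = L.
Proof. by have [_ [_ _ [[_ _ sC] _ _] _]] := CD; exact: sC. Qed.

Lemma over_inj l m : D l -> D m -> forget l = forget m -> l = m.
Proof.
have [_ [_ _ [[_ iD _] _ _] _]] := CD.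
by move=> Dl Dm; apply: iD; rewrite inE.
Qed.

Lemma over_image : @forget R @` D = C.
Proof.
apply/seteqP; split => [_ [l Dl <-]|L /over_lift[l Dl <-]]; first exact: over_sub.
by exists l.
Qed.

(* The lift of a path of lines in [C] that starts in [D] stays in [D]: being in
   [D] and not being in [D] are both open conditions on the parameter. *)
Lemma over_path (h : R -> GL4 R) l : continuous h -> h 0 = @oneGL R ->
  (forall t, GL_line (h t) @` C = C) -> D l -> forall t, D (GL_oline (h t) l).
Proof.
have [_ [_ _ [_ _ [s [cs sK]]] _]] := CD.
move=> ch h0 hC Dl t.
have Ch u : C (GL_line (h u) (forget l)) by rewrite -(hC u); exists (forget l) => //; exact: over_sub.
have Ds L : C L -> D (s L) /\ forget (s L) = L.
  by move=> /over_lift[m Dm <-]; rewrite sK ?inE.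
(* [p] is the oriented line moved by the path, [q] the lift to [D] of the moved line. They start
   together, and the set [E] where they agree is open and closed. *)
pose p u := GL_oline (h u) l; pose q u := s (GL_line (h u) (forget l)).
have qD u : D (q u) by case: (Ds _ (Ch u)).
have fpq u : forget (p u) = forget (q u) by rewrite /q (Ds _ (Ch u)).2.
have cp : continuous p.
  move=> u; apply: (cvg_comp h (fun g => GL_oline g l) (ch u)).
  exact: GL_oline_orbit_continuous.
have cq : continuous q.
  move=> u; move/subspace_continuousP : cs => /(_ _ (Ch u)) cs U /= /cs sU.
  have : (GL_line (h v) (forget l) @[v --> nbhs u]) --> nbhs (GL_line (h u) (forget l)).
    apply: (cvg_comp h (fun g => GL_line g (forget l)) (ch u)).
    exact: (@GL_line_orbit_continuous R (forget l) (h u)).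
  move=> /(_ _ sU) W; rewrite nbhs_simpl /=.
  by apply: (@filterS _ (nbhs u) _ _ _ _ W) => v /=; apply; exact: Ch.
pose E := [set u | p u = q u].
have E0 : E 0 by apply: over_inj => //; rewrite /p h0 GL_oline1.
have near_side (f : R -> oline R) (cf : continuous f) B u : orient_side B (f u) ->
    nbhs u [set v | orient_side B (f v)].
  move=> sB; apply: cf; apply: open_nbhs_nbhs; split => //; exact: orient_side_open.
have oE : open E.
  rewrite openE => u Eu; have [B sB] := orient_side_ex (p u).
  have sq : orient_side B (q u) by rewrite -Eu.
  have H : nbhs u ([set v | orient_side B (p v)] `&` [set v | orient_side B (q v)]).
    exact: filterI (near_side _ cp _ _ sB) (near_side _ cq _ _ sq).
  by apply: filterS H => v [pv qv]; exact: orient_side_inj pv qv.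
have oNE : open (~` E).
  rewrite openE => u Eu; have [B sB] := orient_side_ex (p u).
  have [qB|qB] := orient_side_total (fpq u) sB.
    by case: Eu; exact: orient_side_inj sB qB.
  have H : nbhs u ([set v | orient_side B (p v)] `&`
      [set v | orient_side (flip_mx B) (q v)]).
    exact: filterI (near_side _ cp _ _ sB) (near_side _ cq _ _ qB).
  apply: filterS H => v [pv qv] /= Ev.
  apply: (@orient_side_flip R B (q v)) => //.
  by have : orient_side B (p v) by []; rewrite Ev.
suff ET : E = setT.
  by rewrite -[GL_oline _ _]/(p t); have -> : p t = q t by have : E t by rewrite ET.
have cT : connected [set: R] by apply/connected_intervalP.
apply: cT; first by exists 0.
  by exists E => //; rewrite setTI.
by exists E; [rewrite -openC|rewrite setTI].
Qed.

End OverSpread.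
End SpreadAction.

(** ** The rotation group SO(3) in homogeneous coordinates *)

Section Euclidean.
Variable R : realType.
Local Notation V := 'cV[R]_4.
Implicit Types (v w : V) (G : 'M[R]_4) (g h : GL4 R).

Definition i0 : 'I_4 := @Ordinal 4 0 isT.
Definition i1 : 'I_4 := @Ordinal 4 1 isT.
Definition i2 : 'I_4 := @Ordinal 4 2 isT.
Definition i3 : 'I_4 := @Ordinal 4 3 isT.

Lemma ord4P (P : 'I_4 -> Prop) : P i0 -> P i1 -> P i2 -> P i3 -> forall i, P i.
Proof.
move=> P0 P1 P2 P3 [[|[|[|[|//]]]] ?].
- by rewrite (_ : Ordinal _ = i0) //; exact: val_inj.
- by rewrite (_ : Ordinal _ = i1) //; exact: val_inj.
- by rewrite (_ : Ordinal _ = i2) //; exact: val_inj.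
- by rewrite (_ : Ordinal _ = i3) //; exact: val_inj.
Qed.

Lemma sum4 (F : 'I_4 -> R) : \sum_i F i = F i0 + F i1 + F i2 + F i3.
Proof.
rewrite !big_ord_recl big_ord0 addr0 !addrA.
by congr (F _ + F _ + F _ + F _); exact: val_inj.
Qed.

Lemma prod4 (F : 'I_4 -> R) : \prod_i F i = F i0 * F i1 * F i2 * F i3.
Proof.
rewrite !big_ord_recl big_ord0 mulr1 !mulrA.
by congr (F _ * F _ * F _ * F _); exact: val_inj.
Qed.

Lemma hvecE (x y z w : R) : [/\ hvec x y z w i0 0 = x, hvec x y z w i1 0 = y,
  hvec x y z w i2 0 = z & hvec x y z w i3 0 = w].
Proof. by rewrite !mxE. Qed.

Lemma hvec0 (x y z w : R) : hvec x y z w i0 0 = x. Proof. by case: (hvecE x y z w). Qed.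
Lemma hvec1 (x y z w : R) : hvec x y z w i1 0 = y. Proof. by case: (hvecE x y z w). Qed.
Lemma hvec2 (x y z w : R) : hvec x y z w i2 0 = z. Proof. by case: (hvecE x y z w). Qed.
Lemma hvec3 (x y z w : R) : hvec x y z w i3 0 = w. Proof. by case: (hvecE x y z w). Qed.
Definition hvecs := (hvec0, hvec1, hvec2, hvec3).

Lemma hvecK v : v = hvec (v i0 0) (v i1 0) (v i2 0) (v i3 0).
Proof. by apply/colP; apply: ord4P; rewrite mxE. Qed.

Lemma vec4P v w : v i0 0 = w i0 0 -> v i1 0 = w i1 0 -> v i2 0 = w i2 0 ->
  v i3 0 = w i3 0 -> v = w.
Proof. by move=> *; apply/colP; apply: ord4P. Qed.

Lemma hvecD (x y z w x' y' z' w' : R) :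
  hvec x y z w + hvec x' y' z' w' = hvec (x + x') (y + y') (z + z') (w + w') :> V.
Proof. by apply: vec4P; rewrite mxE !hvecs. Qed.

Lemma hvecZ (a x y z w : R) : a *: hvec x y z w = hvec (a * x) (a * y) (a * z) (a * w) :> V.
Proof. by apply: vec4P; rewrite mxE !hvecs. Qed.

Lemma hvec_0 : hvec 0 0 0 0 = 0 :> V.
Proof. by apply: vec4P; rewrite hvecs mxE. Qed.

Lemma hvec_neq0 (x y z w : R) : (hvec x y z w != 0 :> V) =
  [|| x != 0, y != 0, z != 0 | w != 0].
Proof.
rewrite -!negb_and; congr negb; apply/eqP/and4P => [/colP h|[]].
  by have := (h i0, h i1, h i2, h i3); rewrite !hvecs !mxE => -[[[-> ->] ->] ->].
by do 4 move/eqP ->; exact: hvec_0.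
Qed.

Definition mx4 (s : seq (seq R)) : 'M[R]_4 := \matrix_(i, j) (nth [::] s i)`_j.

Lemma mx4_hvec (a b c d : seq R) (x y z w : R) :
  let r (s : seq R) := s`_0 * x + s`_1 * y + s`_2 * z + s`_3 * w in
  mx4 [:: a; b; c; d] *m hvec x y z w = hvec (r a) (r b) (r c) (r d).
Proof. by apply: vec4P; rewrite mxE sum4 !mxE. Qed.

Definition dot v w : R := (v^T *m w) 0 0.

Lemma dotE v w : dot v w =
  v i0 0 * w i0 0 + v i1 0 * w i1 0 + v i2 0 * w i2 0 + v i3 0 * w i3 0.
Proof. by rewrite /dot mxE sum4 !mxE. Qed.

Lemma dot_orth G v w : G^T *m G = 1%:M -> dot (G *m v) (G *m w) = dot v w.
Proof. by move=> GG; rewrite /dot trmx_mul -mulmxA (mulmxA G^T) GG mul1mx. Qed.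

Lemma dot_tr G v w : dot (G^T *m v) w = dot v (G *m w).
Proof. by rewrite /dot trmx_mul trmxK mulmxA. Qed.

Definition e1 : V := hvec 1 0 0 0.
Definition e2 : V := hvec 0 1 0 0.
Definition e3 : V := hvec 0 0 1 0.
Definition e4 : V := hvec 0 0 0 1.

Lemma dotNl v w : dot (- v) w = - dot v w.
Proof. by rewrite !dotE !mxE; ring. Qed.

Lemma dot_e v : [/\ dot e1 v = v i0 0, dot e2 v = v i1 0, dot e3 v = v i2 0 &
  dot e4 v = v i3 0].
Proof. by rewrite !dotE !hvecs; split; ring. Qed.

(** The condition on [G^T] says that the last row is that of an affine map, so weights are
    preserved. For an orthogonal [G] it also makes the origin [e4] a fixed point. *)
Definition SO3e : set 'M[R]_4 := [set G | [/\ G^T *m G = 1%:M, G^T *m e4 = e4 & \det G = 1]].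
Definition so g := SO3e (mx_of_GL g).

Lemma SO3e_unit G : SO3e G -> G \in unitmx.
Proof. by move=> [_ _ dG]; rewrite unitmxE dG unitr1. Qed.

Lemma SO3e_inv G : SO3e G -> invmx G = G^T.
Proof.
move=> sG; have [GG _ _] := sG.
by rewrite -[RHS]mulmx1 -(mulmxV (SO3e_unit sG)) mulmxA GG mul1mx.
Qed.

Lemma SO3e_mul G H : SO3e G -> SO3e H -> SO3e (G *m H).
Proof.
move=> [GG G4 dG] [HH H4 dH]; split; last by rewrite det_mulmx dG dH mulr1.
  by rewrite trmx_mul -mulmxA (mulmxA G^T) GG mul1mx.
by rewrite trmx_mul -mulmxA G4.
Qed.

Lemma SO3e_tr G : SO3e G -> SO3e G^T.
Proof.
move=> sG; have [GG G4 dG] := sG; split; rewrite ?trmxK ?det_tr //.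
  exact: mulmx1C.
by rewrite -[in LHS]G4 mulmxA (mulmx1C GG) mul1mx.
Qed.

Lemma SO3e_1 : SO3e 1%:M.
Proof. by split; rewrite ?trmx1 ?mul1mx ?det1. Qed.

Lemma so_mul g h : so g -> so h -> so (mulGL g h).
Proof. exact: SO3e_mul. Qed.

Lemma so_inv g : so g -> so (invGL g).
Proof. by move=> sg; rewrite /so mkGLE SO3e_inv //; exact: SO3e_tr. Qed.

Lemma so_one : so (@oneGL R).
Proof. exact: SO3e_1. Qed.

Lemma so_dot g v w : so g -> dot (mx_of_GL g *m v) (mx_of_GL g *m w) = dot v w.
Proof. by move=> [GG _ _]; exact: dot_orth. Qed.

Lemma so_weight g v : so g -> (mx_of_GL g *m v) i3 0 = v i3 0.
Proof.
move=> [_ G4 _]; have [_ _ _ <-] := dot_e (mx_of_GL g *m v).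
by rewrite -dot_tr G4; have [_ _ _ ->] := dot_e v.
Qed.

Lemma so_e4 g : so g -> mx_of_GL g *m e4 = e4.
Proof. by move=> [GG G4 _]; rewrite -[in LHS]G4 mulmxA (mulmx1C GG) mul1mx. Qed.

(** The weight is left out: at weight 1 this is the squared distance from the origin. *)
Definition normsq v : R := v i0 0 ^+ 2 + v i1 0 ^+ 2 + v i2 0 ^+ 2.

Lemma so_normsq g v : so g -> normsq (mx_of_GL g *m v) = normsq v.
Proof.
move=> sg; have := so_dot v v sg; rewrite !dotE so_weight // /normsq => h.
rewrite !expr2; exact: (addIr _ h).
Qed.

Lemma SO3e_mx G : G^T *m G = 1%:M -> G^T *m e4 = e4 -> \det G = 1 ->
  exists2 g, so g & mx_of_GL g = G.
Proof.
move=> GG G4 dG; have uG : G \in unitmx by rewrite unitmxE dG unitr1.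
by exists (mkGL uG); rewrite /so mkGLE.
Qed.

Lemma det_orth n (G : 'M[R]_n) : G^T *m G = 1%:M -> \det G = 1 \/ \det G = -1.
Proof.
move=> /(congr1 determinant); rewrite det_mulmx det_tr det1 -expr2 => /eqP.
by rewrite sqrf_eq1 => /orP[] /eqP; [left|right].
Qed.

Lemma mx_eq_hvec (A B : 'M[R]_4) :
  (forall x y z w : R, A *m hvec x y z w = B *m hvec x y z w) -> A = B.
Proof.
move=> AB; apply/matrixP => i j.
have := AB (j == i0)%:R (j == i1)%:R (j == i2)%:R (j == i3)%:R.
rewrite (_ : hvec _ _ _ _ = delta_mx j 0); last first.
  by apply/colP; apply: ord4P; move: j; apply: ord4P; rewrite !mxE.
by rewrite -!colE => /colP /(_ i); rewrite !mxE.
Qed.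

Definition diag3 (s : R) : 'M[R]_4 :=
  mx4 [:: [:: 1; 0; 0; 0]; [:: 0; 1; 0; 0]; [:: 0; 0; s; 0]; [:: 0; 0; 0; 1]].

Lemma det_diag3 s : \det (diag3 s) = s.
Proof.
have -> : diag3 s = diag_mx (\row_i (if i == i2 then s else 1)).
  by apply/matrixP; apply: ord4P; apply: ord4P; rewrite !mxE.
by rewrite det_diag prod4 !mxE /=; ring.
Qed.

(** The third column is the cross product of [p] and [u] up to a sign [s]. The determinant is 1 or
    -1 by orthogonality, and [s] is chosen to make it 1. *)
Lemma so_frame (p u : V) : p i3 0 = 0 -> u i3 0 = 0 -> normsq p = 1 -> normsq u = 1 ->
  dot p u = 0 -> exists g, [/\ so g, mx_of_GL g *m e1 = p & mx_of_GL g *m e2 = u].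
Proof.
move=> p3 u3 pp uu pu.
set a := p i0 0; set b := p i1 0; set c := p i2 0.
set a' := u i0 0; set b' := u i1 0; set c' := u i2 0.
have pu0 : a * a' + b * b' + c * c' = 0.
  by move: pu; rewrite dotE p3 mul0r addr0.
rewrite /normsq -/a -/b -/c in pp; rewrite /normsq -/a' -/b' -/c' in uu.
pose M s := mx4 [:: [:: a; a'; s * (b * c' - c * b'); 0];
  [:: b; b'; s * (c * a' - a * c'); 0]; [:: c; c'; s * (a * b' - b * a'); 0];
  [:: 0; 0; 0; 1]].
(* Lagrange's identity for the cross product. *)
have cr : (b * c' - c * b') ^+ 2 + (c * a' - a * c') ^+ 2 + (a * b' - b * a') ^+ 2 = 1.
  have -> : (b * c' - c * b') ^+ 2 + (c * a' - a * c') ^+ 2 + (a * b' - b * a') ^+ 2 =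
    (a ^+ 2 + b ^+ 2 + c ^+ 2) * (a' ^+ 2 + b' ^+ 2 + c' ^+ 2) -
    (a * a' + b * b' + c * c') ^+ 2 by ring.
  by rewrite pp uu pu0; ring.
have MM s : s ^+ 2 = 1 -> (M s)^T *m M s = 1%:M.
  move=> ss; apply/matrixP; apply: ord4P; apply: ord4P;
    rewrite !mxE sum4 !mxE /= ?mulr0 ?mul0r ?addr0 ?add0r ?mulr1 //;
    first [by ring | by rewrite -[RHS]pp; ring | by rewrite -[RHS]uu; ring |
      by rewrite -[RHS]pu0; ring | by rewrite -[RHS]mul1r -{1}ss -[X in _ = _ * X]cr; ring].
have Ms s : M s = M 1 *m diag3 s.
  by apply/matrixP; apply: ord4P; apply: ord4P;
    rewrite !mxE sum4 !mxE /= ?mulr0 ?mul0r ?addr0 ?add0r ?mulr1 ?mul1r // mulrC.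
have [s ss ds] : exists2 s, s ^+ 2 = 1 & \det (M s) = 1.
  have [d1|d1] := det_orth (MM 1 (expr1n _ _)); first by exists 1; rewrite ?expr1n.
  by exists (-1); rewrite ?sqrrN ?expr1n // Ms det_mulmx det_diag3 d1 mulrNN mulr1.
have M4 : (M s)^T *m e4 = e4.
  by apply: vec4P; rewrite !mxE sum4 !mxE /=; ring.
have [g sg gM] := SO3e_mx (MM s ss) M4 ds.
exists g; rewrite gM /e1 /e2 !mx4_hvec /=; split => //.
  by rewrite [RHS]hvecK p3; congr hvec; rewrite -/a -/b -/c; ring.
by rewrite [RHS]hvecK u3; congr hvec; rewrite -/a' -/b' -/c'; ring.
Qed.

Lemma so_fix (k : 'I_4) g : so g ->
  (forall i, i != k -> mx_of_GL g *m delta_mx i 0 = delta_mx i 0 :> V) -> g = oneGL R.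
Proof.
move=> sg gi; have [GG _ dG] := sg; set G := mx_of_GL g in GG dG gi *.
have Gd i j : j != k -> G i j = (i == j)%:R.
  by move=> /gi /colP /(_ i); rewrite -colE !mxE eqxx andbT.
have Gk i : i != k -> G i k = 0.
  move=> ik; move/matrixP : (mulmx1C GG) => /(_ i i); rewrite !mxE eqxx (bigD1 i) //=.
  rewrite (bigD1 k) 1?eq_sym //= big1 => [|j /andP[ji jk]]; last first.
    by rewrite !mxE Gd // eq_sym (negbTE ji) mul0r.
  rewrite !mxE Gd // eqxx mul1r addr0 => h; apply/eqP.
  by rewrite -[_ == _]orbb -mulf_eq0; apply/eqP/(addrI 1); rewrite h addr0.
have GE : G = diag_mx (\row_i (if i == k then G k k else 1)).
  apply/matrixP => i j; rewrite !mxE; have [jk|jk] := eqVneq j k.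
    have [->|ij] := eqVneq i j; first by rewrite jk eqxx mulr1n.
    by rewrite jk Gk ?mulr0n // -jk.
  rewrite Gd //; have [->|ij] := eqVneq i j; first by rewrite (negbTE jk) mulr1n.
  by rewrite mulr0n.
apply: GL_inj; rewrite mkGLE -/G GE.
have -> : G k k = 1.
  move: dG; rewrite GE det_diag (bigD1 k) //= big1 => [|i ik].
    by rewrite mxE eqxx mulr1 !mxE eqxx mulr1n.
  by rewrite mxE (negbTE ik).
by apply/matrixP => i j; rewrite !mxE; case: ifP.
Qed.

Lemma e_delta : [/\ e1 = delta_mx i0 0, e2 = delta_mx i1 0, e3 = delta_mx i2 0 &
  e4 = delta_mx i3 0].
Proof. by split; apply/colP; apply: ord4P; rewrite !mxE. Qed.

Lemma so_fix12 g : so g -> mx_of_GL g *m e1 = e1 -> mx_of_GL g *m e2 = e2 -> g = oneGL R.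
Proof.
move=> sg g1 g2; have g4 := so_e4 sg; have [E1 E2 _ E4] := e_delta.
apply: (@so_fix i2) => //; rewrite E1 in g1; rewrite E2 in g2; rewrite E4 in g4.
exact: ord4P.
Qed.

Lemma so_fix13 g : so g -> mx_of_GL g *m e1 = e1 -> mx_of_GL g *m e3 = e3 -> g = oneGL R.
Proof.
move=> sg g1 g3; have g4 := so_e4 sg; have [E1 _ E3 E4] := e_delta.
apply: (@so_fix i1) => //; rewrite E1 in g1; rewrite E3 in g3; rewrite E4 in g4.
exact: ord4P.
Qed.

Definition Rz (u v : R) : 'M[R]_4 :=
  mx4 [:: [:: u; - v; 0; 0]; [:: v; u; 0; 0]; [:: 0; 0; 1; 0]; [:: 0; 0; 0; 1]].

Lemma Rz_hvec (u v x y z w : R) :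
  Rz u v *m hvec x y z w = hvec (u * x - v * y) (v * x + u * y) z w.
Proof. by rewrite mx4_hvec /=; congr hvec; ring. Qed.

Lemma RzM (u v u' v' : R) : Rz u v *m Rz u' v' = Rz (u * u' - v * v') (v * u' + u * v').
Proof.
by apply: mx_eq_hvec => x y z w; rewrite -mulmxA !Rz_hvec; congr hvec; ring.
Qed.

(** The cosine of half the angle is the square root [s] of [(1 + u) / 2]. The half-turn [u = -1] is
    separate because there [v / (2 * s)] would divide by 0. *)
Lemma half_angle (u v : R) : u ^+ 2 + v ^+ 2 = 1 ->
  exists u' v' : R, [/\ u' ^+ 2 + v' ^+ 2 = 1, u = u' * u' - v' * v' & v = v' * u' + u' * v'].
Proof.
move=> uv; have [u1|u1] := eqVneq u (-1).
  have v0 : v = 0.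
    apply/eqP; rewrite -sqrf_eq0; apply/eqP; move: uv; rewrite u1 sqrrN expr1n.
    by move=> h; apply: (addrI 1); rewrite h addr0.
  by exists 0, 1; rewrite u1 v0; split; ring.
have uB : -1 <= u.
  rewrite lerNl -[1](@ger0_norm R) //; apply: le_trans (ler_norm _) _.
  rewrite normrN -ler_sqr ?nnegrE // real_normK ?num_real // normr1 expr1n -uv lerDl.
  exact: sqr_ge0.
have u0 : 0 < (1 + u) / 2.
  by rewrite divr_gt0 // -ltrBlDl sub0r lt_neqAle eq_sym u1.
pose s := Num.sqrt ((1 + u) / 2).
have ss : s * s = (1 + u) / 2 by rewrite -expr2 sqr_sqrtr // ltW.
have s0 : s != 0 by rewrite gt_eqF // sqrtr_gt0.
have vv : v * v = (1 - u) * (2 * (s * s)).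
  rewrite ss; rewrite !expr2 in uv.
  by have -> : v * v = 1 - u * u by [rewrite -uv; ring]; field.
have q : (v / (2 * s)) * (v / (2 * s)) = (1 - u) / 2.
  by rewrite mulrACA vv; field.
exists s, (v / (2 * s)); split.
- by rewrite !expr2 ss q; field.
- by rewrite ss q; field.
- by field.
Qed.

Lemma Rz_SO3e (u v : R) : u ^+ 2 + v ^+ 2 = 1 -> SO3e (Rz u v).
Proof.
have orth a b : a ^+ 2 + b ^+ 2 = 1 -> (Rz a b)^T *m Rz a b = 1%:M.
  move=> ab; rewrite (_ : (Rz a b)^T = Rz a (- b)).
    rewrite RzM; have -> : a * a - - b * b = 1 by rewrite -[RHS]ab; ring.
    have -> : - b * a + a * b = 0 by ring.
    by apply: mx_eq_hvec => x y z w; rewrite Rz_hvec mul1mx; congr hvec; ring.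
  by apply/matrixP; apply: ord4P; apply: ord4P; rewrite !mxE /= ?opprK.
move=> uv; split; first exact: orth.
  by apply: vec4P; rewrite !mxE sum4 !mxE /=; ring.
(* A rotation is the square of an orthogonal matrix, so its determinant is 1. *)
have [u' [v' [uv' -> ->]]] := half_angle uv.
rewrite -RzM det_mulmx -expr2.
by have [->|->] := det_orth (orth _ _ uv'); rewrite ?sqrrN expr1n.
Qed.

Definition axial g := so g /\ mx_of_GL g *m e3 = e3.

Lemma axial_one : axial (oneGL R).
Proof. by split; [exact: so_one|rewrite mul1mx]. Qed.

Lemma axial_mul g h : axial g -> axial h -> axial (mulGL g h).
Proof. by move=> [sg g3] [sh h3]; split; [exact: so_mul|rewrite mkGLE -mulmxA h3]. Qed.

Lemma axial_inv g : axial g -> axial (invGL g).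
Proof.
move=> [sg g3]; split; first exact: so_inv.
by rewrite mkGLE -[in LHS]g3 mulKmx // mx_of_GL_unit.
Qed.

Lemma Rz_axial (u v : R) : u ^+ 2 + v ^+ 2 = 1 ->
  exists2 g, axial g & mx_of_GL g = Rz u v.
Proof.
move=> /Rz_SO3e sR; exists (mkGL (SO3e_unit sR)); rewrite ?mkGLE //; split => //.
by rewrite mkGLE Rz_hvec; congr hvec; ring.
Qed.

Lemma axialE g : axial g -> exists u v : R, u ^+ 2 + v ^+ 2 = 1 /\ mx_of_GL g = Rz u v.
Proof.
move=> [sg g3]; set p := mx_of_GL g *m e1.
have p3 : p i3 0 = 0 by rewrite so_weight // hvecs.
have p2 : p i2 0 = 0.
  by have [_ _ <- _] := dot_e p; rewrite -g3 so_dot // dotE !hvecs; ring.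
have pE : p = hvec (p i0 0) (p i1 0) 0 0 by rewrite [LHS]hvecK p2 p3.
have uv : p i0 0 ^+ 2 + p i1 0 ^+ 2 = 1.
  have := so_normsq e1 sg; rewrite /normsq -/p p2 !hvecs => h.
  by rewrite -[LHS]addr0 -[X in _ + X](expr0n _ 2) h; ring.
exists (p i0 0), (p i1 0); split => //.
have [r ra rE] := Rz_axial uv; rewrite -rE; congr mx_of_GL.
have H : mulGL (invGL r) g = oneGL R.
  apply: so_fix13; first by apply: so_mul => //; apply: so_inv; case: ra.
    rewrite mkGLE -mulmxA -/p pE.
    have -> : hvec (p i0 0) (p i1 0) 0 0 = mx_of_GL r *m e1.
      by rewrite rE Rz_hvec; congr hvec; ring.
    by rewrite mkGLE mulKmx // mx_of_GL_unit.
  by rewrite mkGLE -mulmxA g3; case: (axial_inv ra).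
by rewrite -[RHS]mulGL1 -H mulGLA mulGLV mul1GL.
Qed.

Lemma axial_ex (x y x' y' : R) : x ^+ 2 + y ^+ 2 = x' ^+ 2 + y' ^+ 2 ->
  exists2 g, axial g & forall z w : R, mx_of_GL g *m hvec x y z w = hvec x' y' z w.
Proof.
move=> xy; have [n0|n0] := eqVneq (x ^+ 2 + y ^+ 2) 0.
  have z2 (a b : R) : a ^+ 2 + b ^+ 2 = 0 -> a = 0 /\ b = 0.
    move=> /eqP; rewrite paddr_eq0 ?sqr_ge0 // !sqrf_eq0 => /andP[/eqP-> /eqP->].
    by [].
  have [-> ->] := z2 _ _ n0; rewrite n0 in xy; have [-> ->] := z2 _ _ (esym xy).
  by exists (oneGL R); [exact: axial_one|move=> z w; rewrite mul1mx].
pose n := x ^+ 2 + y ^+ 2.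
(* The quotient of the complex numbers [x' + i y'] and [x + i y]. *)
pose u := (x * x' + y * y') / n; pose v := (x * y' - y * x') / n.
have uv : u ^+ 2 + v ^+ 2 = 1.
  have -> : u ^+ 2 + v ^+ 2 = n * (x' ^+ 2 + y' ^+ 2) / (n * n).
    by rewrite /u /v /n; field.
  by rewrite -xy -/n divff // mulf_neq0.
have [g ga gE] := Rz_axial uv; exists g => // z w; rewrite gE Rz_hvec.
by congr hvec; rewrite /u /v /n; field.
Qed.

Lemma half_turn : exists g, [/\ so g, mx_of_GL g *m e1 = e1, mx_of_GL g *m e2 = - e2 &
  ~ axial g].
Proof.
have [|||||g [sg g1 g2]] := @so_frame e1 (- e2).
- by rewrite hvecs.
- by rewrite mxE hvecs oppr0.
- by rewrite /normsq !hvecs; ring.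
- by rewrite /normsq !mxE /=; ring.
- by rewrite dotE !mxE /=; ring.
exists g; split => // -[_ g3]; have g1' := so_fix13 sg g1 g3.
move: g2; rewrite g1' mul1mx => /colP /(_ i1); rewrite !mxE /= => h.
have : (1 : R) + 1 = 0 by rewrite {1}h addNr.
by apply/eqP; rewrite -[1 + 1]/(2%:R) pnatr_eq0.
Qed.

End Euclidean.

(** * Lines in coordinates: normal forms under SO(3) and reversal of orientation *)

Section LineVectors.
Variable R : realType.
Local Notation V := 'cV[R]_4.
Implicit Types (L M : line R) (a b c u v : V) (g : GL4 R).

Lemma line_dim L : \dim (vs_of_line L) = 2.
Proof. by case: L => U /= /eqP. Qed.

Lemma line_no_three L a b c :
  a \in vs_of_line L -> b \in vs_of_line L -> c \in vs_of_line L ->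
  (forall x y z, x *: a + y *: b + z *: c = 0 -> [/\ x = 0, y = 0 & z = 0]) -> False.
Proof.
move=> aL bL cL abc; have f : free [:: a; b; c].
  apply/(@freeP _ _ 3 [tuple a; b; c]) => k; rewrite !big_ord_recl big_ord0 addr0 addrA.
  move=> /abc[k0 k1 k2] [[|[|[|//]]] p].
  - by rewrite -[RHS]k0; congr k; exact: val_inj.
  - by rewrite -[RHS]k1; congr k; exact: val_inj.
  - by rewrite -[RHS]k2; congr k; exact: val_inj.
have : (<<[:: a; b; c]>> <= vs_of_line L)%VS.
  by apply/span_subvP => x; rewrite !inE => /or3P[] /eqP->.
by move/dimvS; rewrite line_dim; move: f; rewrite /free => /eqP ->.
Qed.

Lemma mem_span2 a b v : reflect (exists s t, v = s *: a + t *: b) (v \in <<[:: a; b]>>%VS).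
Proof.
rewrite span_cons span_seq1; apply: (iffP memv_addP).
  by move=> [_ /vlineP[s ->] [_ /vlineP[t ->] ->]]; exists s, t.
by move=> [s [t ->]]; exists (s *: a); rewrite ?memvZ ?memv_line //; exists (t *: b);
  rewrite ?memvZ ?memv_line.
Qed.

Lemma free2 a b : (forall s t, s *: a + t *: b = 0 -> s = 0 /\ t = 0) -> free [:: a; b].
Proof.
move=> ab; apply/(@freeP _ _ 2 [tuple a; b]) => k; rewrite !big_ord_recl big_ord0 addr0.
move=> /ab[k0 k1] [[|[|//]] p].
- by rewrite -[RHS]k0; congr k; exact: val_inj.
- by rewrite -[RHS]k1; congr k; exact: val_inj.
Qed.

Lemma line_span L a b : a \in vs_of_line L -> b \in vs_of_line L ->
  (forall s t, s *: a + t *: b = 0 -> s = 0 /\ t = 0) ->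
  vs_of_line L = <<[:: a; b]>>%VS.
Proof.
move=> aL bL /free2; rewrite /free => /eqP f; apply/esym/eqP; rewrite eqEdim line_dim.
by rewrite f andbT; apply/span_subvP => x; rewrite !inE => /orP[] /eqP->.
Qed.

Lemma mem_z_axis v : (v \in z_axis R) = (v i0 0 == 0) && (v i1 0 == 0).
Proof.
apply/mem_span2/andP => [[s [t ->]]|[/eqP v0 /eqP v1]].
  by rewrite !mxE /= !mulr0 addr0 eqxx.
exists (v i3 0), (v i2 0); rewrite [LHS]hvecK v0 v1 !hvecZ hvecD.
by congr hvec; ring.
Qed.

Lemma mem_xy_horizon v : (v \in xy_horizon R) = (v i2 0 == 0) && (v i3 0 == 0).
Proof.
apply/mem_span2/andP => [[s [t ->]]|[/eqP v0 /eqP v1]].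
  by rewrite !mxE /= !mulr0 addr0 eqxx.
exists (v i0 0), (v i1 0); rewrite [LHS]hvecK v0 v1 !hvecZ hvecD.
by congr hvec; ring.
Qed.

Lemma line_sub_span2 L a b : (forall v, v \in vs_of_line L -> v \in <<[:: a; b]>>%VS) ->
  vs_of_line L = <<[:: a; b]>>%VS.
Proof.
move=> LM; apply/eqP; rewrite eqEdim line_dim; apply/andP; split; first exact/subvP.
exact: dim_span.
Qed.

Definition hor v : R := v i0 0 ^+ 2 + v i1 0 ^+ 2.

Lemma normsq_hor v : normsq v = hor v + v i2 0 ^+ 2.
Proof. by []. Qed.

Lemma hor_ge0 v : 0 <= hor v.
Proof. by rewrite addr_ge0 ?sqr_ge0. Qed.

Lemma hor_eq0 v : (hor v == 0) = (v \in z_axis R).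
Proof. by rewrite mem_z_axis /hor paddr_eq0 ?sqr_ge0 // !sqrf_eq0. Qed.

Lemma axial_coords g v : axial g -> [/\ hor (mx_of_GL g *m v) = hor v,
  (mx_of_GL g *m v) i2 0 = v i2 0 & (mx_of_GL g *m v) i3 0 = v i3 0].
Proof.
move=> /axialE[x [y [xy ->]]]; rewrite [v in mulmx _ v]hvecK Rz_hvec /hor !hvecs.
split => //; rewrite -[RHS]mul1r -xy; ring.
Qed.

Lemma anisotropic_definite (A B D : R) :
  let q z w := A * z ^+ 2 + 2 * B * (z * w) + D * w ^+ 2 in
  (forall z w, (z != 0) || (w != 0) -> q z w != 0) ->
  (forall z w, (z != 0) || (w != 0) -> 0 < q z w) \/
  (forall z w, (z != 0) || (w != 0) -> q z w < 0).
Proof.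
move=> q q0; have A0 : A != 0.
  by have := q0 1 0; rewrite oner_eq0 /q => /(_ isT); apply: contra => /eqP ->; apply/eqP; ring.
have dlt : B ^+ 2 - A * D < 0.
  rewrite ltNge; apply/negP => d0; pose s := Num.sqrt (B ^+ 2 - A * D).
  have ss : s ^+ 2 = B ^+ 2 - A * D by rewrite sqr_sqrtr.
  have := q0 ((- B + s) / A) 1; rewrite oner_eq0 orbT => /(_ isT) /eqP; apply.
  have -> : q ((- B + s) / A) 1 = (s ^+ 2 - (B ^+ 2 - A * D)) / A by rewrite /q; field.
  by rewrite ss subrr mul0r.
have Aq z w : (z != 0) || (w != 0) -> 0 < A * q z w.
  move=> zw; have -> : A * q z w = (A * z + B * w) ^+ 2 + - (B ^+ 2 - A * D) * w ^+ 2.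
    by rewrite /q; ring.
  have [w0|w0] := eqVneq w 0.
    move: zw; rewrite w0 eqxx orbF => z0.
    by rewrite mulr0 addr0 expr0n mulr0 addr0 exprn_even_gt0 //= mulf_neq0.
  rewrite ltr_wpDl ?sqr_ge0 // mulr_gt0 ?oppr_gt0 //.
  by rewrite exprn_even_gt0.
move: A0; rewrite neq_lt => /orP[A0|A0]; [right|left] => z w /Aq.
  by rewrite nmulr_rgt0.
by rewrite pmulr_rgt0.
Qed.

Lemma normsq_eq0 v : v i3 0 = 0 -> normsq v = 0 -> v = 0.
Proof.
move=> v3 /eqP; rewrite normsq_hor paddr_eq0 ?hor_ge0 ?sqr_ge0 //.
rewrite hor_eq0 mem_z_axis sqrf_eq0 => /andP[/andP[/eqP v0 /eqP v1] /eqP v2].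
by rewrite [v]hvecK v0 v1 v2 v3 hvec_0.
Qed.

Lemma normsq_ge0 v : 0 <= normsq v.
Proof. by rewrite normsq_hor addr_ge0 ?hor_ge0 ?sqr_ge0. Qed.

Lemma normsqZ (s : R) v : normsq (s *: v) = s ^+ 2 * normsq v.
Proof. by rewrite /normsq !mxE; ring. Qed.

Lemma normalize v : v i3 0 = 0 -> v != 0 ->
  exists s, [/\ 0 < s, s ^+ 2 = normsq v & normsq (s^-1 *: v) = 1].
Proof.
move=> v3 v0; have n0 : normsq v != 0.
  by apply: contra_neq v0; exact: normsq_eq0.
have np : 0 < normsq v by rewrite lt_neqAle eq_sym n0 normsq_ge0.
exists (Num.sqrt (normsq v)); rewrite sqrtr_gt0 sqr_sqrtr ?ltW //; split => //.
by rewrite normsqZ exprVn sqr_sqrtr ?ltW // mulVf.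
Qed.

Lemma dotZl (s : R) v u : dot (s *: v) u = s * dot v u.
Proof. by rewrite !dotE !mxE; ring. Qed.

Lemma unit_perp u : u i3 0 = 0 -> normsq u = 1 ->
  exists p : V, [/\ p i3 0 = 0, normsq p = 1 & dot p u = 0].
Proof.
move=> u3 uu; have [h0|h0] := eqVneq (hor u) 0.
  exists (e1 R); split; rewrite ?hvecs //; first by rewrite /normsq !hvecs; ring.
  move/eqP : h0; rewrite hor_eq0 mem_z_axis => /andP[/eqP u0 /eqP u1].
  by rewrite dotE !hvecs u0; ring.
have p0 : hvec (- u i1 0) (u i0 0) 0 0 != 0 :> V.
  apply: contra_neq h0 => /colP p0; have := p0 i0; have := p0 i1.
  by rewrite !hvecs !mxE /hor => -> /eqP; rewrite oppr_eq0 => /eqP ->; ring.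
have [|s [s0 _ ns]] := normalize _ p0; first by rewrite hvecs.
exists (s^-1 *: hvec (- u i1 0) (u i0 0) 0 0); split=> //.
  by rewrite mxE hvecs mulr0.
by rewrite dotE !mxE /=; ring.
Qed.

Lemma line_basis_vectors L : exists a b, [/\ a \in vs_of_line L, b \in vs_of_line L &
  forall s t, s *: a + t *: b = 0 -> s = 0 /\ t = 0].
Proof.
have [X bX] := line_basis L; exists (tnth X ord0), (tnth X ord_max).
split; try by apply: (basis_mem bX); exact: mem_tnth.
move=> s t H; have /freeP f := basis_free bX.
have := f (fun i => if i == ord0 then s else t); rewrite !big_ord_recl big_ord0 addr0 /=.
rewrite !(tnth_nth 0) /= in H.
move=> /(_ H) k; by have := k ord0; have := k ord_max.
Qed.

Lemma line_at_infinity L : exists u (m : V), [/\ u \in vs_of_line L, m \in vs_of_line L,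
  u i3 0 = 0 & forall s t, s *: m + t *: u = 0 -> s = 0 /\ t = 0].
Proof.
have [a [b [aL bL ab]]] := line_basis_vectors L.
have [a3|a3] := eqVneq (a i3 0) 0.
  by exists a, b; split => // s t; rewrite addrC => /ab[].
exists (b i3 0 *: a - a i3 0 *: b), a; split => //.
- by apply: memvB; apply: memvZ.
- by rewrite !mxE; ring.
- move=> s t; rewrite scalerBr !scalerA addrA -scalerDl -scaleNr => /ab[H /eqP].
  rewrite oppr_eq0 mulf_eq0 (negbTE a3) orbF => /eqP t0; split => //.
  by move: H; rewrite t0 mul0r addr0.
Qed.

(** [u] is a point of the line at infinity, and removing from a second vector its component along
    [u] leaves a vector [n] whose spatial part is perpendicular to [u]. The two directions are
    rotated to [e2] and [e1]. If [c] is not 0, then [n / c] is the foot of the perpendicular from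
    the origin, at distance [d / c] up to sign; [c = 0] is the case of a line at infinity. *)
Lemma normal_form L : exists g (d c : R), [/\ so g, (d != 0) || (c != 0),
  hvec d 0 0 c \in vs_of_line (GL_line g L) & e2 R \in vs_of_line (GL_line g L)].
Proof.
have [u [m [uL mL u3 mu]]] := line_at_infinity L.
have u0 : u != 0.
  apply/eqP => u0; have := mu 0 1; rewrite scale0r scale1r add0r => /(_ u0)[_ /eqP].
  by rewrite oner_eq0.
have [s [s0 _ nu]] := normalize u3 u0.
set u' := s^-1 *: u in nu; have u'L : u' \in vs_of_line L by apply: memvZ.
have u'3 : u' i3 0 = 0 by rewrite mxE u3 mulr0.
pose t := dot m u'; pose n := m - t *: u'.
have nL : n \in vs_of_line L by apply: memvB => //; apply: memvZ.
have n0 : n != 0.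
  apply/eqP; rewrite /n /u' scalerA -scaleNr -[X in X + _]scale1r => /mu[/eqP].
  by rewrite oner_eq0.
pose p := hvec (n i0 0) (n i1 0) (n i2 0) 0 : V.
have pu : dot p u' = 0.
  have -> : dot p u' = dot m u' - t * normsq u'.
    by rewrite !dotE !hvecs /n /normsq !mxE u3; ring.
  by rewrite nu mulr1 subrr.
have [q [d [q3 qq qu pq]]]   : exists (q : V) (d : R), [/\ q i3 0 = 0, normsq q = 1, dot q u' = 0 &
    p = d *: q].
  have [p0|p0] := eqVneq p 0.
    have [q [q3 qq qu]] := unit_perp u'3 nu; exists q, 0; split => //.
    by rewrite scale0r.
  have [|d [d0 _ nd]] := normalize _ p0; first by rewrite hvecs.
  exists (d^-1 *: p), d; split => //; first by rewrite mxE hvecs mulr0.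
    by rewrite dotZl pu mulr0.
  by rewrite scalerA divff ?scale1r // gt_eqF.
have [g [sg g1 g2]] := so_frame q3 u'3 qq nu qu.
exists (invGL g), d, (n i3 0); have sg' := so_inv sg.
have nE : n = mx_of_GL g *m hvec d 0 0 (n i3 0).
  have -> : hvec d 0 0 (n i3 0) = d *: e1 R + n i3 0 *: e4 R.
    by rewrite !hvecZ hvecD; congr hvec; ring.
  rewrite mulmxDr -!scalemxAr g1 (so_e4 sg) -pq hvecZ hvecD [LHS]hvecK.
  by congr hvec; ring.
have memE v : (v \in vs_of_line (GL_line (invGL g) L)) = (mx_of_GL g *m v \in vs_of_line L).
  rewrite -[in RHS](GL_lineVK g L) [in RHS]mem_mx_image2 //.
split => //; last by rewrite memE g2.
  apply: contra_neqT n0; rewrite negb_or !negbK => /andP[/eqP d0 /eqP n3].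
  by rewrite nE d0 n3 hvec_0 mulmx0.
by rewrite memE -nE.
Qed.

(** [a * d - b * c] is the determinant of [g] on the line. The basis [m, u] may define the
    orientation opposite to [l]; but a map that fixes one orientation of an invariant line fixes the
    other, so the criterion is the same. *)
Lemma oline_stab2 (l : oline R) g (m u : V) (a b c d : R) :
  m \in vs_of_line (forget l) -> u \in vs_of_line (forget l) ->
  (forall s t, s *: m + t *: u = 0 -> s = 0 /\ t = 0) ->
  GL_line g (forget l) = forget l ->
  mx_of_GL g *m m = a *: m + b *: u -> mx_of_GL g *m u = c *: m + d *: u ->
  (0 < a * d - b * c) = `[< GL_oline g l = l >].
Proof.
move=> mL uL mu gl gm gu; pose X := [tuple m; u].
have bX : basis_of (vs_of_line (forget l)) X.
  by rewrite basisEfree (free2 mu) line_dim (line_span mL uL mu) subvv.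
pose l' := OLine (ex_intro2 _ _ X bX (erefl (orientation_class _ X))).
have l'X : orient l' X by split => //; rewrite (change_of_basis_id bX) det1.
pose A : 'M[R]_2 := \matrix_(i, j)
  if i == 0 then (if j == 0 then a else c) else (if j == 0 then b else d).
have gX : mx_of_GL g *m tuple_mx X = tuple_mx X *m A.
  rewrite -tuple_mx_map; apply/matrixP => i j.
  rewrite [LHS]mxE tnth_map (tnth_nth 0) [RHS]mxE big_ord_recl big_ord1.
  rewrite ![tuple_mx _ _ _]mxE !(tnth_nth 0).
  by case: j => -[|[|//]] p; rewrite /= ?gm ?gu !mxE /=; ring.
have dA : \det A = a * d - b * c.
  rewrite (expand_det_row _ 0) big_ord_recl big_ord1 /cofactor !det_mx11 !mxE /=.
  by rewrite !expr0 expr1 mul1r mulN1r mulrN [c * b]mulrC.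
have := GL_oline_stab l'X gl gX; rewrite dA => ->.
have [-> //|ll'] := pselect (l = l').
apply/asbool_equiv_eq; split => gl'; apply: contrapT => nl.
  apply: nl; apply: (oline_two (m := l')) => // h; apply: ll' => //.
  by apply: (can_inj (GL_olineK g)); rewrite h gl'.
apply: nl; apply: (oline_two (m := l)) => // h; apply: ll' => //.
by apply: (can_inj (GL_olineK g)); rewrite h gl'.
Qed.

(** In normal form the half-turn about the first axis fixes [hvec d 0 0 c] and negates [e2], so it
    has determinant -1 on the line. *)
Lemma reversal L : exists t, [/\ so t, GL_line t L = L &
  forall l : oline R, forget l = L -> GL_oline t l <> l].
Proof.
have [g [d [c [sg dc mL uL]]]] := normal_form L.
have [t [st t1 t2 _]] := half_turn R.
have mu (x y : R) : x *: hvec d 0 0 c + y *: e2 R = 0 -> x = 0 /\ y = 0.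
  rewrite !hvecZ hvecD => H; have H0 := congr1 (fun u : V => u i0 0) H.
  have H1 := congr1 (fun u : V => u i1 0) H; have H3 := congr1 (fun u : V => u i3 0) H.
  rewrite !hvecs !mxE ?mulr0 ?mulr1 ?addr0 ?add0r in H0 H1 H3; split => //; apply/eqP.
  move/eqP : H0; move/eqP : H3; rewrite !mulf_eq0.
  by case/orP: dc => /negbTE ->; rewrite orbF // => _.
have tm : mx_of_GL t *m hvec d 0 0 c = hvec d 0 0 c.
  have -> : hvec d 0 0 c = d *: e1 R + c *: e4 R.
    by rewrite !hvecZ hvecD; congr hvec; ring.
  by rewrite mulmxDr -!scalemxAr t1 so_e4.
have tL : GL_line t (GL_line g L) = GL_line g L.
  apply: line_eq; rewrite (line_span mL uL mu); apply: line_span => //.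
    by rewrite -tm mem_mx_image2.
  by rewrite -[e2 R]opprK -t2 memvN mem_mx_image2.
exists (mulGL (invGL g) (mulGL t g)); split.
- by apply: so_mul; [exact: so_inv|exact: so_mul].
- by rewrite !GL_lineM tL GL_lineK.
- move=> l lL; rewrite !GL_olineM => H.
  have {}H : GL_oline t (GL_oline g l) = GL_oline g l by rewrite -[in RHS]H GL_olineVK.
  have fl : forget (GL_oline g l) = GL_line g L by rewrite -lL.
  have := @oline_stab2 (GL_oline g l) t (hvec d 0 0 c) (e2 R) 1 0 0 (-1).
  rewrite fl tm t2 !scale1r !scale0r addr0 add0r scaleN1r => /(_ mL uL mu tL erefl erefl).
  rewrite H mulrN1 mulr0 subr0 ltr0N1; move/esym/asboolP; exact.
Qed.

End LineVectors.

(** ** Spreads invariant under the axial rotations *)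

Section AxialSpread.
Variables (R : realType) (C : set (line R)).
Local Notation V := 'cV[R]_4.
Implicit Types (L M : line R) (u v : V) (g h : GL4 R).

Hypothesis dC : forall L M v, C L -> C M -> v != 0 -> v \in vs_of_line L ->
  v \in vs_of_line M -> L = M.
Hypothesis covC : forall v, v != 0 -> exists2 L, C L & v \in vs_of_line L.
Hypothesis invC : forall g, axial g -> GL_line g @` C = C.

Lemma axial_mem g L : axial g -> C L -> C (GL_line g L).
Proof. by move=> ag CL; rewrite -(invC ag); exists L. Qed.

Lemma axial_fix_mem g L v : axial g -> C L -> v != 0 -> v \in vs_of_line L ->
  mx_of_GL g *m v \in vs_of_line L -> GL_line g L = L.
Proof.
move=> ag CL v0 vL gvL; apply: (dC (axial_mem ag CL) CL _ _ gvL).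
  by rewrite mulmx_GL_eq0.
by rewrite mem_mx_image2.
Qed.

Definition isZ L := vs_of_line L = z_axis R.
Definition isV L := vs_of_line L = xy_horizon R.
Definition generic L := [/\ C L, ~ isZ L & ~ isV L].

Lemma rot_pi : exists2 g, axial g &
  forall x y z w : R, mx_of_GL g *m hvec x y z w = hvec (- x) (- y) z w.
Proof.
have [|g ag gE] := @Rz_axial R (-1) 0; first by rewrite sqrrN expr1n expr0n addr0.
by exists g => // x y z w; rewrite gE Rz_hvec; congr hvec; ring.
Qed.

Lemma rot_half_pi : exists2 g, axial g &
  forall x y z w : R, mx_of_GL g *m hvec x y z w = hvec (- y) x z w.
Proof.
have [|g ag gE] := @Rz_axial R 0 1; first by rewrite expr1n expr0n add0r.
by exists g => // x y z w; rewrite gE Rz_hvec; congr hvec; ring.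
Qed.

(** Axial rotations fix [e3], hence also the line of [C] through it. If this line left the axis, it
    would contain, besides [e3], the horizontal part of one of its vectors and the quarter-turn
    image of that part: three independent vectors. *)
Lemma Z_ex : exists2 L, C L & isZ L.
Proof.
have e30 : hvec 0 0 1 0 != 0 :> V by rewrite hvec_neq0 oner_eq0 !orbT.
have [L CL eL] := covC e30; exists L => //; apply: line_sub_span2 => v vL.
rewrite -/(z_axis R) -hor_eq0; apply/negP => /negP hv.
have gL g : axial g -> GL_line g L = L.
  by move=> ag; apply: (axial_fix_mem ag CL e30 eL); case: ag => _ ->.
have pL : hvec (v i0 0) (v i1 0) 0 0 \in vs_of_line L.
  have [g ag gE] := rot_pi.
  have gvL : mx_of_GL g *m v \in vs_of_line L by rewrite -(gL g ag) mem_mx_image2.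
  have -> : hvec (v i0 0) (v i1 0) 0 0 = 2^-1 *: (v - mx_of_GL g *m v).
    rewrite {3 4}[v]hvecK gE -scaleN1r hvecZ hvecD hvecZ; congr hvec; by field.
  by apply: memvZ; apply: memvB.
have qL : hvec (- v i1 0) (v i0 0) 0 0 \in vs_of_line L.
  by have [g ag gE] := rot_half_pi; rewrite -gE -(gL g ag) mem_mx_image2.
apply: (line_no_three pL qL eL) => x y z; rewrite !hvecZ !hvecD => H.
have H0 := congr1 (fun u : V => u i0 0) H; have H1 := congr1 (fun u : V => u i1 0) H.
have H2 := congr1 (fun u : V => u i2 0) H; rewrite !hvecs !mxE in H0 H1 H2.
split; last by rewrite -[RHS]H2; ring.
  apply: (mulIf hv); rewrite mul0r.
  have -> : x * hor v = v i0 0 * (x * v i0 0 + y * - v i1 0 + z * 0) +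
    v i1 0 * (x * v i1 0 + y * v i0 0 + z * 0) by rewrite /hor; ring.
  by rewrite H0 H1; ring.
apply: (mulIf hv); rewrite mul0r.
have -> : y * hor v = - v i1 0 * (x * v i0 0 + y * - v i1 0 + z * 0) +
  v i0 0 * (x * v i1 0 + y * v i0 0 + z * 0) by rewrite /hor; ring.
by rewrite H0 H1; ring.
Qed.

Lemma Z_uniq L M : isZ L -> isZ M -> L = M.
Proof. by move=> LZ MZ; apply: line_eq; rewrite LZ MZ. Qed.

Lemma isZ_mem L : isZ L -> C L.
Proof. by move=> LZ; have [M CM MZ] := Z_ex; rewrite (Z_uniq LZ MZ). Qed.

Lemma meets_Z L v : C L -> v != 0 -> v \in vs_of_line L -> hor v = 0 -> isZ L.
Proof.
move=> CL v0 vL /eqP hv; have [M CM MZ] := Z_ex.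
by rewrite (dC CL CM v0 vL) // MZ -hor_eq0.
Qed.

(** The half-turn about the axis negates [e1], hence fixes the line of [C] through it. The mean of a
    vector of this line and its half-turn image lies both on the line and on the axis; unless it is
    0, the line would be the axis. *)
Lemma V_ex : exists2 L, C L & isV L.
Proof.
have e10 : hvec 1 0 0 0 != 0 :> V by rewrite hvec_neq0 oner_eq0.
have [L CL eL] := covC e10; exists L => //; apply: line_sub_span2 => v vL.
rewrite -/(xy_horizon R) mem_xy_horizon; apply/negP => /negP hv.
have gL : hvec 0 0 (v i2 0) (v i3 0) \in vs_of_line L.
  have [g ag gE] := rot_pi.
  have gvL : mx_of_GL g *m v \in vs_of_line L.
    rewrite -[in X in _ \in X](axial_fix_mem ag CL e10 eL) ?mem_mx_image2 //.
    rewrite gE (_ : hvec _ _ _ _ = - hvec 1 0 0 0) ?memvN //.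
    by rewrite -[RHS]scaleN1r hvecZ; congr hvec; ring.
  have -> : hvec 0 0 (v i2 0) (v i3 0) = 2^-1 *: (v + mx_of_GL g *m v).
    by rewrite {3 4}[v]hvecK gE hvecD hvecZ; congr hvec; by field.
  by apply: memvZ; apply: memvD.
have LZ : isZ L.
  apply: (meets_Z CL _ gL); last by rewrite /hor !hvecs; ring.
  by rewrite hvec_neq0 !eqxx /= -negb_and.
by move: eL; rewrite LZ mem_z_axis hvecs oner_eq0.
Qed.

Lemma V_uniq L M : isV L -> isV M -> L = M.
Proof. by move=> LZ MZ; apply: line_eq; rewrite LZ MZ. Qed.

Lemma meets_V L v : C L -> v != 0 -> v \in vs_of_line L -> v i2 0 = 0 -> v i3 0 = 0 ->
  isV L.
Proof.
move=> CL v0 vL v2 v3; have [M CM MZ] := V_ex.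
by rewrite (dC CL CM v0 vL) // MZ mem_xy_horizon v2 v3 eqxx.
Qed.

Lemma generic_hor L v : generic L -> v != 0 -> v \in vs_of_line L -> 0 < hor v.
Proof.
move=> [CL LZ _] v0 vL; rewrite lt_neqAle hor_ge0 andbT eq_sym.
by apply/eqP => h; apply: LZ; exact: meets_Z h.
Qed.

Lemma generic_ver L v : generic L -> v != 0 -> v \in vs_of_line L ->
  (v i2 0 != 0) || (v i3 0 != 0).
Proof.
move=> [CL _ LV] v0 vL; rewrite -negb_and; apply/negP => /andP[/eqP v2 /eqP v3].
by apply: LV; exact: meets_V v2 v3.
Qed.

Lemma generic_eq L u v : generic L -> u \in vs_of_line L -> v \in vs_of_line L ->
  u i2 0 = v i2 0 -> u i3 0 = v i3 0 -> u = v.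
Proof.
move=> gL uL vL e2 e3; apply/eqP; rewrite -subr_eq0; apply/negP => /negP uv0.
have := generic_ver gL uv0 (memvB uL vL).
by rewrite !mxE e2 e3 !subrr eqxx.
Qed.

(** A vector of [L] with [z = w = 0] lies on the horizon, which [L] misses; so the projection to
    [(z, w)] is injective on [L], and bijective by dimension. *)
Lemma generic_lift L (z w : R) : generic L ->
  exists v, [/\ v \in vs_of_line L, v i2 0 = z & v i3 0 = w].
Proof.
move=> gL; pose P := mx4 [:: [::]; [::]; [:: 0; 0; 1; 0]; [:: 0; 0; 0; 1]] : 'M[R]_4.
have PE (x y z' w' : R) : P *m hvec x y z' w' = hvec 0 0 z' w'.
  by rewrite mx4_hvec /=; congr hvec; rewrite ?nth_nil; ring.
pose f : 'End(V) := linfun (mulmx P).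
have fE v : f v = hvec 0 0 (v i2 0) (v i3 0) by rewrite lfunE /= [v in LHS]hvecK PE.
have fL : (f @: vs_of_line L = z_axis R)%VS.
  apply/eqP; rewrite eqEdim; apply/andP; split.
    by apply/subvP => _ /memv_imgP[v _ ->]; rewrite fE mem_z_axis !hvecs eqxx.
  rewrite limg_dim_eq ?line_dim; first exact: dim_span.
  apply/eqP; rewrite -subv0; apply/subvP => v; rewrite memv_cap memv_ker => /andP[vL].
  rewrite fE memv0 => /eqP H; apply/negP => /negP v0.
  have := generic_ver gL v0 vL; rewrite -negb_and => /negP; apply.
  have H2 := congr1 (fun u : V => u i2 0) H; have H3 := congr1 (fun u : V => u i3 0) H.
  by rewrite !hvecs !mxE in H2 H3; rewrite H2 H3 eqxx.
have : hvec 0 0 z w \in (f @: vs_of_line L)%VS by rewrite fL mem_z_axis !hvecs eqxx.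
move=> /memv_imgP[v vL H]; exists v; rewrite fE in H.
have H2 := congr1 (fun u : V => u i2 0) H; have H3 := congr1 (fun u : V => u i3 0) H.
by rewrite !hvecs in H2 H3.
Qed.

Lemma generic_form L : generic L -> exists A B D : R, forall v, v \in vs_of_line L ->
  hor v = A * v i2 0 ^+ 2 + 2 * B * (v i2 0 * v i3 0) + D * v i3 0 ^+ 2.
Proof.
move=> gL; have [a [aL a2 a3]] := generic_lift 1 0 gL.
have [b [bL b2 b3]] := generic_lift 0 1 gL.
exists (hor a), (a i0 0 * b i0 0 + a i1 0 * b i1 0), (hor b) => v vL.
have -> : v = v i2 0 *: a + v i3 0 *: b.
  apply: (generic_eq gL) => //; first by apply: memvD; apply: memvZ.
    by rewrite !mxE a2 b2; ring.
  by rewrite !mxE a3 b3; ring.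
by rewrite /hor !mxE a2 a3 b2 b3; ring.
Qed.

Lemma same_point L L' v v' : C L -> C L' -> v != 0 -> v \in vs_of_line L ->
  v' \in vs_of_line L' -> v i2 0 = v' i2 0 -> v i3 0 = v' i3 0 -> hor v = hor v' ->
  exists2 g, axial g & GL_line g L = L'.
Proof.
move=> CL CL' v0 vL vL' e2 e3 hv; have [g ag gE] := axial_ex hv.
have gv : mx_of_GL g *m v = v' by rewrite [v in LHS]hvecK gE [RHS]hvecK e2 e3.
exists g => //; apply: (dC (axial_mem ag CL) CL' _ _ vL').
  by rewrite -gv mulmx_GL_eq0.
by rewrite -gv mem_mx_image2.
Qed.

Definition below L L' := forall v v', v \in vs_of_line L -> v' \in vs_of_line L' ->
  v != 0 -> v i2 0 = v' i2 0 -> v i3 0 = v' i3 0 -> hor v < hor v'.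

(* Two lines of [C] with the same horizontal distance at some [(z, w)] are in
   the same axial orbit; otherwise the difference of their forms is anisotropic
   and therefore definite. *)
Lemma generic_compare L L' : generic L -> generic L' ->
  [\/ below L L', below L' L | exists2 g, axial g & GL_line g L = L'].
Proof.
move=> gL gL'; have [A [B [D fL]]] := generic_form gL.
have [A' [B' [D' fL']]] := generic_form gL'.
have CL : C L by case: gL.
have CL' : C L' by case: gL'.
have nz v : v \in vs_of_line L -> v != 0 -> (v i2 0 != 0) || (v i3 0 != 0).
  by move=> vL v0; exact: generic_ver vL.
have nz' v : v \in vs_of_line L' -> v != 0 -> (v i2 0 != 0) || (v i3 0 != 0).
  by move=> vL v0; exact: generic_ver vL.
have [orb|norb] := pselect (exists2 g, axial g & GL_line g L = L'); first by apply: Or33.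
pose q z w := (A' - A) * z ^+ 2 + 2 * (B' - B) * (z * w) + (D' - D) * w ^+ 2.
have qE v v' : v \in vs_of_line L -> v' \in vs_of_line L' ->
    v i2 0 = v' i2 0 -> v i3 0 = v' i3 0 -> q (v i2 0) (v i3 0) = hor v' - hor v.
  by move=> vL vL' e2 e3; rewrite (fL v) // (fL' v') // -e2 -e3 /q; ring.
have q0 z w : (z != 0) || (w != 0) -> q z w != 0.
  move=> zw; have [v [vL v2 v3]] := generic_lift z w gL.
  have [v' [vL' v2' v3']] := generic_lift z w gL'.
  rewrite -v2 -v3 (qE v v') ?v2 ?v3 // subr_eq0; apply/eqP => hv; apply: norb.
  apply: (same_point CL CL' _ vL vL') => //; rewrite ?v2 ?v3 //.
  apply: contraTneq zw => v0; rewrite -v2 -v3 v0 !mxE eqxx //.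
have [qp|qn] := anisotropic_definite q0.
  apply: Or31 => v v' vL vL' v0 e2 e3.
  by rewrite -subr_gt0 -qE //; apply: qp; exact: nz.
apply: Or32 => v' v vL' vL v0 e2 e3.
rewrite -subr_lt0 -qE //; apply: qn; rewrite -e2 -e3; exact: nz'.
Qed.

(** Compared with [below] the order is reversed: here it is [L'] that contains the points closer to
    the origin. *)
Definition affine_below L L' := forall v, v \in vs_of_line L -> v i3 0 = 1 ->
  exists2 v', v' \in vs_of_line L' & v' i3 0 = 1 /\ normsq v' < normsq v.

Lemma affine_neq0 v : v i3 0 = 1 -> v != 0.
Proof. by move=> v3; apply/eqP => v0; move/eqP: v3; rewrite v0 mxE eq_sym oner_eq0. Qed.

Lemma below_affine L L' : generic L -> below L L' -> affine_below L' L.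
Proof.
move=> gL LL' v' vL' v3; have [v [vL v2 v3']] := generic_lift (v' i2 0) 1 gL.
exists v => //; split => //; rewrite !normsq_hor v2 ltrD2r.
by apply: LL'; rewrite ?affine_neq0 ?v3.
Qed.

Lemma generic_foot L : generic L -> exists m, [/\ m \in vs_of_line L, m i3 0 = 1 &
  forall v, v \in vs_of_line L -> v i3 0 = 1 -> normsq m <= normsq v].
Proof.
move=> gL; have [A [B [D fL]]] := generic_form gL.
have A0 : 0 < A.
  have [a [aL a2 a3]] := generic_lift 1 0 gL.
  have a0 : a != 0 by apply/eqP => a0; move/eqP: a2; rewrite a0 mxE eq_sym oner_eq0.
  have := generic_hor gL a0 aL; rewrite fL // a2 a3.
  by rewrite !mulr0 expr0n !mulr0 !addr0 expr1n mulr1.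
have A1 : A + 1 != 0 by rewrite gt_eqF // addr_gt0.
(* The vertex of [(A + 1) z^2 + 2 B z + D], the squared distance from the origin at height [z]. *)
have [m [mL m2 m3]] := generic_lift (- B / (A + 1)) 1 gL.
exists m; split => // v vL v3; rewrite -subr_ge0 !normsq_hor !fL // m2 m3 v3.
set z := v i2 0; rewrite [leRHS](_ : _ = (A + 1) * (z + B / (A + 1)) ^+ 2); last by field.
by rewrite mulr_ge0 ?sqr_ge0 // ltW // addr_gt0.
Qed.

Lemma orbit_not_affine_below L L' g : generic L' -> so g -> GL_line g L = L' ->
  ~ affine_below L' L.
Proof.
move=> gL' sg gL LL'; have [m [mL' m3 mmin]] := generic_foot gL'.
have [v vL [v3 vm]] := LL' m mL' m3.
have := mmin (mx_of_GL g *m v); rewrite -gL mem_mx_image2 so_weight // so_normsq //.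
by move=> /(_ vL v3); rewrite leNgt vm.
Qed.

Lemma so_GL_line_inv g L L' : GL_line g L = L' -> GL_line (invGL g) L' = L.
Proof. by move=> <-; rewrite GL_lineK. Qed.

Lemma isZ_orbit L L' g : C L' -> so g -> isZ L -> GL_line g L = L' -> L = L'.
Proof.
move=> CL' sg LZ gL; have e4L : e4 R \in vs_of_line L by rewrite LZ mem_z_axis !hvecs eqxx.
apply: (dC (isZ_mem LZ) CL' _ e4L); first by rewrite hvec_neq0 oner_eq0 !orbT.
by rewrite -gL -(so_e4 sg) mem_mx_image2.
Qed.

Lemma isV_orbit L L' g : C L' -> so g -> isV L -> GL_line g L = L' -> L = L'.
Proof.
move=> CL' sg LV gL.
have w0 v : v \in vs_of_line L' -> v i3 0 = 0.
  rewrite -gL mem_mx_image LV mem_xy_horizon => /andP[_ /eqP h].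
  by rewrite -(so_weight v (so_inv sg)); exact: h.
apply: V_uniq => //; apply: contrapT => L'V.
have [L'Z|L'Z] := pselect (isZ L').
  have := w0 (e4 R); rewrite L'Z mem_z_axis !hvecs eqxx => /(_ isT) /eqP.
  by rewrite oner_eq0.
have genL' : generic L' by [].
have [v [vL' _ v3]] := generic_lift 0 1 genL'.
by move/eqP : (w0 v vL'); rewrite v3 oner_eq0.
Qed.

Lemma orbit_axial L L' g : C L -> C L' -> so g -> GL_line g L = L' ->
  exists2 h, axial h & GL_line h L = L'.
Proof.
move=> CL CL' sg gL.
have triv : L = L' -> exists2 h, axial h & GL_line h L = L'.
  by move=> <-; exists (oneGL R); [exact: axial_one|rewrite GL_line1].
have gL' := so_GL_line_inv gL; have sg' := so_inv sg.
have [LZ|LZ] := pselect (isZ L); first exact/triv/(isZ_orbit CL' sg LZ gL).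
have [LV|LV] := pselect (isV L); first exact/triv/(isV_orbit CL' sg LV gL).
have [L'Z|L'Z] := pselect (isZ L'); first exact/triv/esym/(isZ_orbit CL sg' L'Z gL').
have [L'V|L'V] := pselect (isV L'); first exact/triv/esym/(isV_orbit CL sg' L'V gL').
have genL : generic L by []; have genL' : generic L' by [].
have [LL'|L'L|//] := generic_compare genL genL'.
  by case: (orbit_not_affine_below genL' sg gL); exact: below_affine.
by case: (orbit_not_affine_below genL sg' gL'); exact: below_affine.
Qed.

Lemma generic_through v : 0 < hor v -> v i3 0 = 1 ->
  exists2 L, generic L & v \in vs_of_line L.
Proof.
move=> hv v3; have [L CL vL] := covC (affine_neq0 v3); exists L => //; split => // H.
  by move: vL; rewrite H -hor_eq0 gt_eqF.
by move: vL; rewrite H mem_xy_horizon v3 oner_eq0 andbF.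
Qed.

(** Unlike [below], this relation also holds within an axial orbit. It is thus total on the generic
    lines and can direct the filter in [distance_surjective]. *)
Definition weakly_below L L' := forall v v', v \in vs_of_line L -> v' \in vs_of_line L' ->
  v i2 0 = v' i2 0 -> v i3 0 = v' i3 0 -> hor v <= hor v'.

Lemma weakly_below_total L L' : generic L -> generic L' ->
  weakly_below L L' \/ weakly_below L' L.
Proof.
move=> gL gL'; have z0 v v' M : generic M -> v' \in vs_of_line M ->
    v i2 0 = v' i2 0 -> v i3 0 = v' i3 0 -> v = 0 -> v' = 0.
  move=> gM vM v2 v3 v0; apply: (generic_eq gM vM (mem0v _)).
    by rewrite -v2 v0.
  by rewrite -v3 v0.
have [LL'|L'L|[g ag gLL]] := generic_compare gL gL'.
- left => v v' vL vL' v2 v3; have [v0|v0] := eqVneq v 0; last exact/ltW/LL'.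
  by rewrite (z0 _ _ _ gL' vL' v2 v3 v0) v0.
- right => v v' vL vL' v2 v3; have [v0|v0] := eqVneq v 0; last exact/ltW/L'L.
  by rewrite (z0 _ _ _ gL vL' v2 v3 v0) v0.
- left => v v' vL vL' v2 v3; have [h e2 e3] := axial_coords v ag.
  rewrite -h (_ : v' = mx_of_GL g *m v) //; apply: (generic_eq gL') => //.
  + by rewrite -gLL mem_mx_image2.
  + by rewrite e2 v2.
  + by rewrite e3 v3.
Qed.

Lemma normsq_poly_near L d z : generic L ->
  (forall v, v \in vs_of_line L -> v i2 0 = z -> v i3 0 = 1 -> d < normsq v) ->
  \forall z' \near z, forall v, v \in vs_of_line L -> v i2 0 = z' -> v i3 0 = 1 -> d < normsq v.
Proof.
move=> gL dz; have [A [B [D fL]]] := generic_form gL.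
pose f (x : R) : R := (A + 1) * x ^+ 2 + 2 * B * x + D.
have fE v : v \in vs_of_line L -> v i3 0 = 1 -> normsq v = f (v i2 0).
  by move=> vL v3; rewrite normsq_hor fL // v3 /f; ring.
have cf : {for z, continuous f}.
  have c2 : x ^+ 2 @[x --> z] --> z ^+ 2 by exact: exprn_continuous.
  have c1 : x @[x --> z] --> z by exact: cvg_id.
  exact: (cvgD (cvgD (cvgM (cvg_cst _) c2) (cvgM (cvg_cst _) c1)) (cvg_cst _)).
have fz : d < f z.
  have [v [vL v2 v3]] := generic_lift z 1 gL; rewrite -v2 -fE //; exact: dz.
have : nbhs z (f @^-1` [set x | d < x]).
  by apply: cf; apply: open_nbhs_nbhs; split => //; exact: open_gt.
by apply: filterS => z' dz' v vL v2 v3; rewrite fE // v2.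
Qed.

(* If no line touched the ball of squared radius [d], then for each height [z]
   within the ball some line meeting its interior would pass outside of it at
   height [z].  The lines form a chain and the heights a compact interval, so
   one of these lines would avoid the ball altogether. *)
Lemma distance_surjective d : 0 < d -> exists L m, [/\ generic L, m \in vs_of_line L,
  m i3 0 = 1, normsq m = d & forall v, v \in vs_of_line L -> v i3 0 = 1 -> d <= normsq v].
Proof.
move=> d0; apply: contrapT => none.
pose A L := generic L /\ exists v, [/\ v \in vs_of_line L, v i3 0 = 1 & normsq v < d].
have touch L v : generic L -> v \in vs_of_line L -> v i3 0 = 1 -> normsq v = d -> A L.
  move=> gL vL v3 vd; split => //; apply: contrapT => nA; apply: none.
  exists L, v; split => // w wL w3; rewrite leNgt; apply/negP => wd.
  by apply: nA; exists w.
pose up L := [set L' | generic L' /\ weakly_below L L'].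
have A0 : A !=set0.
  pose v : V := hvec (Num.sqrt (d / 2)) 0 0 1.
  have vd : hor v = d / 2.
    by rewrite /hor !hvecs expr0n addr0 sqr_sqrtr // divr_ge0 // ltW.
  have [||L gL vL] := @generic_through v; first by rewrite vd divr_gt0.
    by rewrite hvecs.
  exists L; split => //; exists v; split; rewrite ?hvecs //.
  by rewrite normsq_hor vd hvecs expr0n addr0 ltr_pdivrMr // ltr_pMr // ltr1n.
have fF : Filter (filter_from A up).
  apply: filter_from_filter => // L L' AL AL'.
  have [gL _] := AL; have [gL' _] := AL'.
  have trans M M' N : generic M' -> weakly_below M M' -> weakly_below M' N -> weakly_below M N.
    move=> gM' MM' M'N v v' vM vN v2 v3.
    have [u [uM u2 u3]] := generic_lift (v i2 0) (v i3 0) gM'.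
    apply: (le_trans (MM' v u vM uM _ _)); rewrite ?u2 ?u3 //.
    by apply: M'N; rewrite ?u2 ?u3.
  have [LL'|L'L] := weakly_below_total gL gL'.
    by exists L' => // N [gN L'N]; split; split => //; exact: trans L'N.
  by exists L => // N [gN LN]; split; split => //; exact: trans LN.
pose P L (z : R) := forall v, v \in vs_of_line L -> v i2 0 = z -> v i3 0 = 1 -> d < normsq v.
have escape z : z ^+ 2 <= d -> exists2 L, A L & P L z.
  rewrite le_eqVlt => /orP[/eqP zd|zd].
    (* At a pole the horizontal section of the ball is a point of the axis, which generic lines
       avoid. *)
    have [L AL] := A0; exists L => // v vL v2 v3.
    rewrite normsq_hor v2 zd ltrDr; apply: (generic_hor _ _ vL); first by case: AL.
    exact: affine_neq0.
  (* The line through the point [v] of the sphere at height [z] enters the ball at some [u]. At the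
     height of [u] the ball has room for a point [w] farther from the axis; its line still enters
     the ball and lies above [L], hence passes outside at height [z]. *)
  pose v : V := hvec (Num.sqrt (d - z ^+ 2)) 0 z 1.
  have vd : hor v = d - z ^+ 2.
    by rewrite /hor !hvecs expr0n addr0 sqr_sqrtr // subr_ge0 ltW.
  have [||L gL vL] := @generic_through v; first by rewrite vd subr_gt0.
    by rewrite hvecs.
  have [||_ [u [uL u3 ud]]] := touch _ _ gL vL; first by rewrite hvecs.
    by rewrite normsq_hor vd hvecs subrK.
  pose s := (hor u + (d - u i2 0 ^+ 2)) / 2.
  have us : hor u < s by rewrite midf_lt // ltrBrDr.
  have sd : s < d - u i2 0 ^+ 2 by rewrite midf_lt // ltrBrDr.
  pose w : V := hvec (Num.sqrt s) 0 (u i2 0) 1.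
  have ws : hor w = s.
    by rewrite /hor !hvecs expr0n addr0 sqr_sqrtr // ltW // (le_lt_trans (hor_ge0 u)).
  have [||L' gL' wL'] := @generic_through w.
      by rewrite ws (le_lt_trans (hor_ge0 u)).
    by rewrite hvecs.
  exists L'; first by split => //; exists w; split; rewrite ?hvecs // normsq_hor ws hvecs -ltrBrDr.
  have LL' : below L L'.
    have cmp v' : v' \in vs_of_line L' -> v' i2 0 = u i2 0 -> v' i3 0 = 1 -> hor u < hor v'.
      move=> v'L' v'2 v'3; rewrite (_ : v' = w) ?ws //.
      by apply: (generic_eq gL') => //; rewrite ?hvecs.
    have [//|L'L|[g ag gLL']] := generic_compare gL gL'.
      have := L'L w u wL' uL; rewrite !hvecs u3 ws ltNge (ltW us).
      by move=> /(_ (affine_neq0 (hvec3 _ _ _ _)) erefl erefl).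
    have [h e2 e3] := axial_coords u ag.
    have := cmp (mx_of_GL g *m u); rewrite -gLL' mem_mx_image2 e2 e3 h ltxx.
    by move=> /(_ uL erefl u3).
  move=> v' v'L' v'2 v'3; rewrite normsq_hor v'2 -ltrBlDr -vd.
  by apply: LL'; rewrite ?affine_neq0 ?hvecs.
pose r := Num.sqrt d; have rr : r ^+ 2 = d by rewrite sqr_sqrtr // ltW.
have Kd z : `[- r, r]%classic z = (z ^+ 2 <= d).
  rewrite /= in_itv /= -ler_norml -rr -[in RHS](real_normK (num_real z)).
  by rewrite ler_sqr ?nnegrE ?normr_ge0 ?sqrtr_ge0.
(* Compactness of the heights yields one [L] in [A] such that all lines above it, itself included,
   avoid the ball. But [L] enters the ball. *)
have : filter_from A up [set L | `[- r, r]%classic `<=` P L].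
  apply: ((compact_near_coveringP _).1 (@segment_compact R (- r) r) _ _ P fF) => z Kz.
  rewrite Kd in Kz; have [L AL LP] := escape z Kz; have [gL _] := AL.
  exists ([set z' | P L z'], up L); first by split; [exact: normsq_poly_near|exists L].
  move=> [z' L'] [/= Lz' [gL' LL']] v vL' v2 v3.
  have [u [uL u2 u3]] := generic_lift z' 1 gL.
  apply: (lt_le_trans (Lz' u uL u2 u3)); rewrite !normsq_hor u2 v2 lerD2r.
  by apply: LL'; rewrite ?u2 ?u3.
move=> [L AL upL]; have [gL [v [vL v3 vd]]] := AL.
have LL : weakly_below L L.
  by move=> u u' uL uL' u2 u3; rewrite (generic_eq gL uL uL' u2 u3).
have zK : `[- r, r]%classic (v i2 0).
  by rewrite Kd ltW //; apply: le_lt_trans vd; rewrite normsq_hor lerDr hor_ge0.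
by have := upL L (conj gL LL) _ zK v vL erefl v3; rewrite ltNge (ltW vd).
Qed.

Lemma line_eq2 L M (a b : V) : a \in vs_of_line L -> b \in vs_of_line L ->
  a \in vs_of_line M -> b \in vs_of_line M ->
  (forall s t, s *: a + t *: b = 0 -> s = 0 /\ t = 0) -> L = M.
Proof. by move=> aL bL aM bM ab; apply: line_eq; rewrite (line_span aL bL ab) (line_span aM bM ab). Qed.

Lemma indep_e2 (d c : R) : (d != 0) || (c != 0) ->
  forall s t : R, s *: hvec d 0 0 c + t *: e2 R = 0 -> s = 0 /\ t = 0.
Proof.
move=> dc s t; rewrite !hvecZ hvecD => H; have H0 := congr1 (fun u : V => u i0 0) H.
have H1 := congr1 (fun u : V => u i1 0) H; have H3 := congr1 (fun u : V => u i3 0) H.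
rewrite !hvecs !mxE ?mulr0 ?mulr1 ?addr0 ?add0r in H0 H1 H3; split => //; apply/eqP.
move/eqP : H0; move/eqP : H3; rewrite !mulf_eq0.
by case/orP: dc => /negbTE ->; rewrite orbF // => _.
Qed.

Lemma e34_indep s t : s *: e4 R + t *: e3 R = 0 -> s = 0 /\ t = 0.
Proof.
rewrite !hvecZ hvecD => H; have H0 := congr1 (fun u : V => u i2 0) H.
have H1 := congr1 (fun u : V => u i3 0) H.
by rewrite !hvecs !mxE ?mulr0 ?mulr1 ?addr0 ?add0r in H0 H1.
Qed.

Lemma generic_normal_form L : generic L -> exists g d, [/\ so g, d != 0,
  hvec d 0 0 1 \in vs_of_line (GL_line g L) & e2 R \in vs_of_line (GL_line g L)].
Proof.
move=> gL; have [g [d [c [sg dc mL uL]]]] := normal_form L.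
have [v [vL _ v3]] := generic_lift 0 1 gL.
have gvL : mx_of_GL g *m v \in vs_of_line (GL_line g L) by rewrite mem_mx_image2.
have c0 : c != 0.
  apply/eqP => c0; move: gvL; rewrite (line_span mL uL (indep_e2 dc)).
  move=> /mem_span2[s [t H]]; have := congr1 (fun u : V => u i3 0) H.
  rewrite so_weight // v3 !mxE /= c0 !mulr0 addr0 => /eqP; by rewrite oner_eq0.
exists g, (d / c); split => //; last first.
  have -> : hvec (d / c) 0 0 1 = c^-1 *: hvec d 0 0 c.
    by rewrite hvecZ; congr hvec; field.
  exact: memvZ.
rewrite mulf_neq0 // ?invr_neq0 //; apply/eqP => d0.
have e4L : e4 R \in vs_of_line L.
  rewrite -(mem_mx_image2 g) so_e4 // (_ : e4 R = c^-1 *: hvec d 0 0 c); first exact: memvZ.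
  by rewrite hvecZ d0; congr hvec; field.
have e40 : e4 R != 0 by rewrite hvec_neq0 oner_eq0 !orbT.
have := generic_hor gL e40 e4L; rewrite /hor !hvecs expr0n addr0 ltxx //.
Qed.

(** Lines at infinity are moved to the horizon and lines through the origin to the axis. Any other
    line is compared with a generic line of [C] at the same distance; the parameters of their normal
    forms agree up to sign. *)
Lemma so_covers M : exists2 g, so g & C (GL_line g M).
Proof.
have [g [d [c [sg dc mM uM]]]] := normal_form M.
have [c0|c0] := eqVneq c 0.
  have d0 : d != 0 by move: dc; rewrite c0 eqxx orbF.
  have [L CL LV] := V_ex; exists g => //; suff <- : L = GL_line g M by [].
  apply: (line_eq2 _ _ mM uM (indep_e2 dc)); rewrite LV mem_xy_horizon !hvecs ?c0 ?eqxx //.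
pose m := hvec (d / c) 0 0 1 : V.
have {}mM : m \in vs_of_line (GL_line g M).
  have -> : m = c^-1 *: hvec d 0 0 c by rewrite hvecZ; congr hvec; field.
  exact: memvZ.
have [d0|d0] := eqVneq d 0.
  have [||||| k [sk k1 k2]] := @so_frame R (e2 R) (e3 R); rewrite ?hvecs //.
  - by rewrite /normsq !hvecs; ring.
  - by rewrite /normsq !hvecs; ring.
  - by rewrite dotE !hvecs; ring.
  have [L CL LZ] := Z_ex; exists (mulGL k g); first exact: so_mul.
  rewrite GL_lineM; suff <- : L = GL_line k (GL_line g M) by [].
  apply: (line_eq2 _ _ _ _ e34_indep); rewrite ?LZ ?mem_z_axis ?hvecs ?eqxx //.
    by rewrite -(so_e4 sk) mem_mx_image2; move: mM; rewrite /m d0 mul0r.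
  by rewrite -k2 mem_mx_image2.
have dc0 : 0 < (d / c) ^+ 2 by rewrite exprn_even_gt0 //= mulf_neq0 // invr_neq0.
have [L [n [gL nL n3 nd nmin]]] := distance_surjective dc0.
have [h [e [sh e0 mL uL]]] := generic_normal_form gL.
have ed : e ^+ 2 = (d / c) ^+ 2.
  apply/eqP; rewrite eq_le; apply/andP; split; last first.
    have := nmin (invmx (mx_of_GL h) *m hvec e 0 0 1).
    rewrite -mem_mx_image => /(_ mL); have sh' := so_inv sh.
    have -> : invmx (mx_of_GL h) = mx_of_GL (invGL h) by [].
    rewrite so_weight // so_normsq // hvecs => /(_ erefl).
    by rewrite /normsq !hvecs expr0n !addr0.
  rewrite -nd -(so_normsq n sh).
  have : mx_of_GL h *m n \in vs_of_line (GL_line h L) by rewrite mem_mx_image2.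
  have e1' : (e != 0) || ((1 : R) != 0) by rewrite e0.
  rewrite (line_span mL uL (indep_e2 e1')) => /mem_span2[s [t H]].
  have := congr1 (fun u : V => u i3 0) H; rewrite so_weight // n3 !mxE /= mulr1 mulr0 addr0.
  move=> s1; rewrite H -s1 scale1r hvecZ hvecD /normsq !hvecs.
  rewrite !mulr0 !addr0 mulr1 !add0r expr0n addr0 lerDl.
  exact: sqr_ge0.
have CL : C L by case: gL.
have dc1 (x : R) : (x != 0) || ((1 : R) != 0) by rewrite oner_eq0 orbT.
suff [r ar rL] : exists2 r, axial r & GL_line r (GL_line h L) = GL_line g M.
  exists (mulGL (invGL h) (mulGL (invGL r) g)).
    by apply: so_mul; [exact: so_inv|apply: so_mul => //; apply: so_inv; case: ar].
  by rewrite !GL_lineM -rL !GL_lineK.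
have /orP[/eqP ee|/eqP ee] : (e == d / c) || (e == - (d / c)) by rewrite -eqf_sqr ed.
  exists (oneGL R); first exact: axial_one.
  by rewrite GL_line1; apply: (line_eq2 mL uL _ uM (indep_e2 (dc1 _))); rewrite ee.
(* The half-turn about the [z]-axis changes the sign of the parameter. *)
have [r ar rE] := rot_pi; exists r => //.
apply: (line_eq2 _ _ mM uM (indep_e2 (dc1 _))).
  rewrite (_ : m = mx_of_GL r *m hvec e 0 0 1) ?mem_mx_image2 // rE ee.
  by congr hvec; ring.
rewrite (_ : e2 R = - (mx_of_GL r *m e2 R)) ?memvN ?mem_mx_image2 //.
by rewrite rE -[RHS]scaleN1r hvecZ; congr hvec; ring.
Qed.

(** On the axis, [g] multiplies [e3] by 1 or -1, and the orientation excludes -1. On the horizon it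
    acts as an orthogonal map of determinant 1, hence as an axial rotation. On a generic line it
    fixes the foot, and the orientation forces it to fix the direction too, so [g] is the
    identity. *)
Lemma oriented_stab_axial g (l : oline R) : so g -> C (forget l) -> GL_oline g l = l -> axial g.
Proof.
move=> sg CL gl; set L := forget l in CL *.
have gL : GL_line g L = L by rewrite /L -[in RHS]gl.
have st := @oline_stab2 R l g; rewrite gl in st.
have mem v : v \in vs_of_line L -> mx_of_GL g *m v \in vs_of_line L.
  by move=> vL; rewrite -[in X in _ \in X]gL mem_mx_image2.
have [LZ|LZ] := pselect (isZ L).
  have e4L : e4 R \in vs_of_line L by rewrite LZ mem_z_axis !hvecs eqxx.
  have e3L : e3 R \in vs_of_line L by rewrite LZ mem_z_axis !hvecs eqxx.
  have [b gb] : exists b, mx_of_GL g *m e3 R = b *: e3 R.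
    exists ((mx_of_GL g *m e3 R) i2 0); have := mem _ e3L; rewrite LZ mem_z_axis.
    move=> /andP[/eqP g0 /eqP g1]; rewrite hvecZ [LHS]hvecK g0 g1 so_weight // hvecs.
    by congr hvec; ring.
  have b1 : b ^+ 2 = 1.
    have := so_normsq (e3 R) sg; rewrite gb normsqZ /normsq !hvecs.
    by rewrite expr0n !add0r expr1n mulr1.
  have := st (e4 R) (e3 R) 1 0 0 b e4L e3L e34_indep gL.
  rewrite so_e4 // gb scale1r !scale0r addr0 add0r mul1r mul0r subr0.
  move=> /(_ erefl erefl) bp; split => //; rewrite gb.
  have {}bp : 0 < b by rewrite bp; apply/asboolP.
  move/eqP : b1; rewrite sqrf_eq1 => /orP[/eqP ->|/eqP bn]; first by rewrite scale1r.
  by move: bp; rewrite bn oppr_gt0 ltr10.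
have [LV|LV] := pselect (isV L).
  have e1L : e1 R \in vs_of_line L by rewrite LV mem_xy_horizon !hvecs eqxx.
  have e2L : e2 R \in vs_of_line L by rewrite LV mem_xy_horizon !hvecs eqxx.
  have img v : v \in vs_of_line L -> exists a b,
      mx_of_GL g *m v = a *: e1 R + b *: e2 R.
    move=> /mem; rewrite LV mem_xy_horizon => /andP[/eqP g2 /eqP g3].
    exists ((mx_of_GL g *m v) i0 0), ((mx_of_GL g *m v) i1 0).
    by rewrite [LHS]hvecK g2 g3 !hvecZ hvecD; congr hvec; ring.
  have [a [b gab]] := img _ e1L; have [c [d gcd]] := img _ e2L.
  have ind (s t : R) : s *: e1 R + t *: e2 R = 0 -> s = 0 /\ t = 0.
    by apply: indep_e2; rewrite oner_eq0.
  have := st _ _ _ _ _ _ e1L e2L ind gL gab gcd => det0.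
  have {}det0 : 0 < a * d - b * c by rewrite det0; apply/asboolP.
  have ab : a ^+ 2 + b ^+ 2 = 1.
    have := so_normsq (e1 R) sg; rewrite gab !hvecZ hvecD /normsq !hvecs => h.
    by apply: (etrans _ (etrans h _)); ring.
  have [r ar rE] := Rz_axial ab.
  have cd : c ^+ 2 + d ^+ 2 = 1.
    have := so_normsq (e2 R) sg; rewrite gcd !hvecZ hvecD /normsq !hvecs => h.
    by apply: (etrans _ (etrans h _)); ring.
  have acbd : a * c + b * d = 0.
    have := so_dot (e1 R) (e2 R) sg; rewrite gab gcd !hvecZ !hvecD !dotE !hvecs => h.
    by apply: (etrans _ (etrans h _)); ring.
  have dd : a * d - b * c = 1.
    have : (a * d - b * c) ^+ 2 = 1.
      have -> : (a * d - b * c) ^+ 2 =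
        (a ^+ 2 + b ^+ 2) * (c ^+ 2 + d ^+ 2) - (a * c + b * d) ^+ 2 by ring.
      by rewrite ab cd acbd; ring.
    move/eqP; rewrite sqrf_eq1 => /orP[/eqP //|/eqP dn].
    by move: det0; rewrite dn oppr_gt0 ltr10.
  have da : d = a.
    have -> : d = d * (a ^+ 2 + b ^+ 2) by rewrite ab mulr1.
    have -> : d * (a ^+ 2 + b ^+ 2) = a * (a * d - b * c) + b * (a * c + b * d) by ring.
    by rewrite dd acbd; ring.
  have cb : c = - b.
    have -> : c = c * (a ^+ 2 + b ^+ 2) by rewrite ab mulr1.
    have -> : c * (a ^+ 2 + b ^+ 2) = a * (a * c + b * d) - b * (a * d - b * c) by ring.
    by rewrite dd acbd; ring.
  suff -> : g = r by [].
  have H : mulGL (invGL r) g = oneGL R.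
    have sr : so r by case: ar.
    apply: so_fix12; first by apply: so_mul => //; exact: so_inv.
      rewrite mkGLE -mulmxA gab (_ : _ + _ = mx_of_GL r *m e1 R) ?mkGLE ?mulKmx ?mx_of_GL_unit //.
      by rewrite rE Rz_hvec !hvecZ hvecD; congr hvec; ring.
    rewrite mkGLE -mulmxA gcd (_ : _ + _ = mx_of_GL r *m e2 R) ?mkGLE ?mulKmx ?mx_of_GL_unit //.
    by rewrite rE Rz_hvec !hvecZ hvecD da cb; congr hvec; ring.
  by rewrite -[RHS]mulGL1 -H mulGLA mulGLV mul1GL.
have genL : generic L by [].
have [h [d [sh d0 mL uL]]] := generic_normal_form genL.
pose k := mulGL h (mulGL g (invGL h)).
have sk : so k by apply: so_mul => //; apply: so_mul => //; exact: so_inv.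
have kL : GL_line k (GL_line h L) = GL_line h L by rewrite /k !GL_lineM GL_lineK gL.
have kl : GL_oline k (GL_oline h l) = GL_oline h l by rewrite /k !GL_olineM GL_olineK gl.
have d1 : (d != 0) || ((1 : R) != 0) by rewrite d0.
have kmem v : v \in vs_of_line (GL_line h L) -> exists a b,
    mx_of_GL k *m v = a *: hvec d 0 0 1 + b *: e2 R.
  move=> vL; apply/mem_span2; rewrite -(line_span mL uL (indep_e2 d1)).
  by rewrite -kL mem_mx_image2.
have [a [b kab]] := kmem _ mL; have [a' [b' kab']] := kmem _ uL.
have a1 : a = 1.
  have := congr1 (fun v : V => v i3 0) kab; rewrite so_weight // !mxE /= mulr1 mulr0 addr0.
  by move->.
have a'0 : a' = 0.
  have := congr1 (fun v : V => v i3 0) kab'; rewrite so_weight // !mxE /= mulr1 mulr0 addr0.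
  by move->.
have b0 : b = 0.
  have := so_normsq (hvec d 0 0 1) sk; rewrite kab a1 scale1r !hvecZ hvecD /normsq !hvecs.
  rewrite !mulr0 !addr0 mulr1 add0r expr0n !addr0 => h0; apply/eqP; rewrite -sqrf_eq0.
  by apply/eqP/(addrI (d ^+ 2)); rewrite h0 addr0.
have b'1 : b' ^+ 2 = 1.
  have := so_normsq (e2 R) sk; rewrite kab' a'0 scale0r add0r normsqZ /normsq !hvecs.
  by rewrite expr0n !add0r expr1n addr0 mulr1.
have := oline_stab2 (l := GL_oline h l) mL uL (indep_e2 d1) kL kab kab'.
rewrite kl a1 b0 a'0 mul1r mul0r subr0 => b'p.
have {}b'p : 0 < b' by rewrite b'p; apply/asboolP.
have b'E : b' = 1.
  move/eqP : b'1; rewrite sqrf_eq1 => /orP[/eqP //|/eqP bn].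
  by move: b'p; rewrite bn oppr_gt0 ltr10.
have k1 : k = oneGL R.
  apply: so_fix12 => //; last by rewrite kab' a'0 b'E scale0r add0r scale1r.
  have -> : e1 R = d^-1 *: (hvec d 0 0 1 - e4 R).
    by rewrite -scaleN1r hvecZ hvecD hvecZ; congr hvec; field.
  rewrite -scalemxAr mulmxBr so_e4 // kab a1 b0 scale1r scale0r addr0 //.
suff -> : g = oneGL R by exact: axial_one.
have -> : g = mulGL (invGL h) (mulGL k h).
  by rewrite /k -!mulGLA mulVGL mulGL1 mulGLA mulVGL mul1GL.
by rewrite k1 mul1GL mulVGL.
Qed.

End AxialSpread.

(** * Linear collineations, and angles of rotation *)

Section Collineations.
Variable R : realType.
Implicit Types (g : GL4 R) (p : flat R 1).

Lemma mx_image_dim g (U : {vspace 'cV[R]_4}) :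
  \dim (mx_image (mx_of_GL g) U) = \dim U.
Proof. by rewrite /mx_image limg_dim_eq // (eqP (GL_lker0 g)) capv0. Qed.

Fact GL_point_subproof g p : \dim (mx_image (mx_of_GL g) (vs_of_flat p)) == 1%N.
Proof. by rewrite mx_image_dim; case: p. Qed.

Definition GL_point g p : flat R 1 :=
  exist (fun U : {vspace _} => \dim U == 1%N) _ (GL_point_subproof g p).

Lemma GL_pointK g : cancel (GL_point g) (GL_point (invGL g)).
Proof.
move=> p; apply/val_inj/vspaceP => v; rewrite /= -mx_imageM mulVGL.
by rewrite mem_mx_image invmx1 mul1mx.
Qed.

Lemma GL_pointVK g : cancel (GL_point (invGL g)) (GL_point g).
Proof.
move=> p; apply/val_inj/vspaceP => v; rewrite /= -mx_imageM mulGLV.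
by rewrite mem_mx_image invmx1 mul1mx.
Qed.

Lemma GL_collineation g : collineation (GL_point g) (GL_line g).
Proof.
split.
- by exists (GL_point (invGL g)); [exact: GL_pointK|exact: GL_pointVK].
- by exists (GL_line (invGL g)); [exact: GL_lineK|exact: GL_lineVK].
- move=> p L; rewrite /incident; split => [/subvP H|H]; last exact: limgS.
  by apply/subvP => v vp; have := H (mx_of_GL g *m v); rewrite !mem_mx_image2; apply.
Qed.

Lemma isomorphic_sets_GL g (C : set (line R)) : isomorphic_sets C (GL_line g @` C).
Proof. by exists (GL_point g), (GL_line g); split => //; exact: GL_collineation. Qed.

End Collineations.

Section RotationAngles.
Variable R : realType.

Lemma angle_ex (u v : R) : u ^+ 2 + v ^+ 2 = 1 -> exists t, u = cos t /\ v = sin t.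
Proof.
move=> uv; have v2 : v ^+ 2 = 1 - u ^+ 2 by rewrite -uv addrC addKr.
have u1 : -1 <= u <= 1.
  rewrite -ler_norml -(expr_le1 (n := 2)) // real_normK ?num_real // -uv lerDl.
  exact: sqr_ge0.
have s1 : sin (acos u) = `|v| by rewrite sin_acos // -v2 sqrtr_sqr.
have c1 : cos (acos u) = u by rewrite acosK.
have [v0|v0] := leP 0 v; first by exists (acos u); rewrite c1 s1 ger0_norm.
by exists (- acos u); rewrite cosN sinN c1 s1 ltr0_norm // opprK.
Qed.

Lemma rotzE (t : R) : rotz t = Rz (cos t) (sin t).
Proof.
have I0 : i0 = lshift 2 (@ord0 1) by exact: val_inj.
have I1 : i1 = lshift 2 (@ord_max 1) by exact: val_inj.
have I2 : i2 = rshift 2 (@ord0 1) by exact: val_inj.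
have I3 : i3 = rshift 2 (@ord_max 1) by exact: val_inj.
apply/matrixP; apply: ord4P; apply: ord4P; rewrite [RHS]mxE /= ?I0 ?I1 ?I2 ?I3 /rotz;
  rewrite ?(block_mxEul (rot2 t)) ?(block_mxEur (rot2 t)) ?(block_mxEdl (rot2 t))
  ?(block_mxEdr (rot2 t)) !mxE //.
Qed.

End RotationAngles.

(** * Open conditions on lines: non-incidence and the sense of screw *)

Section LineTopology.
Variable R : realType.
Local Notation V := 'cV[R]_4.
Implicit Types (g : GL4 R) (L M : line R) (v : V).

Lemma adj_cvg (T : Type) (F : set_system T) (FF : Filter F) n
    (f : T -> 'M[R]_n) (A : 'M[R]_n) :
  f t @[t --> F] --> A -> \adj (f t) @[t --> F] --> \adj A.
Proof.
move=> fA; apply: mx_cvg => i j; rewrite mxE; under eq_cvg do rewrite mxE.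
rewrite /cofactor; apply: cvgM; first exact: cvg_cst.
apply: det_cvg; apply: mx_cvg => k l; rewrite !mxE; under eq_cvg do rewrite !mxE.
by apply: (cvg_comp f (fun X : 'M[R]_n => X _ _) fA); exact: coord_continuous.
Qed.

(** Every line is the image of the horizon [LV] under some [h], and membership of [w] in it is the
    vanishing of two coordinates of [\adj h *m w]. The adjugate replaces the inverse because its
    entries are polynomials; openness of the orbit map transfers the condition from [h] to the
    line. *)
Lemma nonincident_near v L : v \notin vs_of_line L ->
  \forall v' \near v & L' \near L, v' \notin vs_of_line L'.
Proof.
pose L0 : line R := exist (fun U : {vspace _} => \dim U == 2) _ (introT eqP (line_dim L)).
have e10 : forall s t : R, s *: e1 R + t *: e2 R = 0 -> s = 0 /\ t = 0.
  by apply: indep_e2; rewrite oner_eq0.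
have dV : \dim (xy_horizon R) == 2 by have := free2 e10; rewrite /free.
pose LV : line R := exist (fun U : {vspace _} => \dim U == 2) _ dV.
have [g gL] := GL_line_transitive LV L.
have memE h w : (w \in vs_of_line (GL_line h LV)) =
    ((\adj (mx_of_GL h) *m w) i2 0 == 0) && ((\adj (mx_of_GL h) *m w) i3 0 == 0).
  have uh := mx_of_GL_unit h; rewrite mem_mx_image [X in _ \in X]/= mem_xy_horizon.
  rewrite /invmx uh -!scalemxAl !mxE !mulf_eq0 invr_eq0.
  by move: uh; rewrite unitmxE unitfE => /negbTE ->.
rewrite -{1}gL memE negb_and => vi.
have [i vi0 iE] : exists2 i, (\adj (mx_of_GL g) *m v) i 0 != 0 &
    forall h w, (\adj (mx_of_GL h) *m w) i 0 != 0 -> w \notin vs_of_line (GL_line h LV).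
  case/orP : vi => vi; [exists i2|exists i3] => // h w hw; rewrite memE negb_and hw ?orbT //.
pose f (p : V * GL4 R) : R := (\adj (mx_of_GL p.2) *m p.1) i 0.
have cf : {for (v, g), continuous f}.
  rewrite /continuous_at /f.
  have c1 : (\adj (mx_of_GL p.2) *m p.1) @[p --> (v, g)] --> \adj (mx_of_GL g) *m v.
    apply: mulmx_cvg; last exact: cvg_fst.
    apply: adj_cvg; apply: (cvg_comp snd (@mx_of_GL R)); first exact: cvg_snd.
    exact: mx_of_GL_continuous.
  apply: (cvg_comp _ (fun X : V => X i 0) c1); exact: coord_continuous.
have [[N M] /= [Nv Mg] NM] : nbhs (v, g) (f @^-1` [set x | x != 0]).
  apply: cf; apply: open_nbhs_nbhs; split => //; exact: open_neq.
exists (N, (fun h => GL_line h LV) @` M) => /=.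
  split => //; rewrite -gL; move: Mg; rewrite nbhsE => -[M' [oM' M'g] M'M].
  have nM' : nbhs (GL_line g LV) ((fun h => GL_line h LV) @` M').
    apply: open_nbhs_nbhs; split; last by exists g.
    exact: (orbit_map_open (@line_openE R) (@GL_lineM R) (@GL_line1 R) (@GL_line_transitive R)).
  by apply: filterS nM' => _ [h M'h <-]; exists h => //; exact: M'M.
by move=> [w _] /= [Nw [h Mh <-]]; apply: iE; exact: (NM (w, h)).
Qed.

(* The sign of [chi a b] over pairs spanning a line that meets neither the
   [z]-axis nor its horizon distinguishes right- from left-screwed lines. *)
Definition chi (a b : V) : R :=
  (a i0 0 * b i1 0 - a i1 0 * b i0 0) * (a i2 0 * b i3 0 - a i3 0 * b i2 0).

Definition screwed (s : R) L :=
  exists a b, [/\ a \in vs_of_line L, b \in vs_of_line L & 0 < s * chi a b].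

(** Both factors of [chi] are 2 by 2 minors, each multiplied by the determinant of the change of
    basis. *)
Lemma chi_change (a b : V) (x y z w : R) :
  chi (x *: a + y *: b) (z *: a + w *: b) = (x * w - y * z) ^+ 2 * chi a b.
Proof. by rewrite /chi !mxE; ring. Qed.

Lemma screwed_open s : open (screwed s).
Proof.
apply/line_openE => L; rewrite openE => g [a [b [aL bL ab]]].
pose f (h : GL4 R) := s * chi (mx_of_GL h *m (invmx (mx_of_GL g) *m a))
  (mx_of_GL h *m (invmx (mx_of_GL g) *m b)).
have cc v i : (mx_of_GL h *m v) i 0 @[h --> g] --> (mx_of_GL g *m v) i 0.
  have c1 := cvg_comp (@mx_of_GL R) (fun A => A *m v)
    (@mx_of_GL_continuous R g) (@mulmx_continuousl R _ _ _ v _).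
  apply: (cvg_comp _ (fun X : V => X i 0) c1); exact: coord_continuous.
have cf : f h @[h --> g] --> f g.
  have FF := nbhs_filter g.
  have cm v w i j k l := cvgB (cvgM (cc v i) (cc w j)) (cvgM (cc v k) (cc w l)).
  pose a' := invmx (mx_of_GL g) *m a; pose b' := invmx (mx_of_GL g) *m b.
  exact: (cvgM (cvg_cst s) (cvgM (cm _ _ _ a' b' i0 i1 i1 i0) (cm _ _ _ a' b' i2 i3 i3 i2))).
have fg : 0 < f g by rewrite /f !mulKVmx // mx_of_GL_unit.
have : nbhs g (f @^-1` [set x | 0 < x]).
  by apply: cf; apply: open_nbhs_nbhs; split => //; exact: open_gt.
apply: filterS => h fh; exists (mx_of_GL h *m (invmx (mx_of_GL g) *m a)).
exists (mx_of_GL h *m (invmx (mx_of_GL g) *m b)).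
by rewrite !mem_mx_image2 -!mem_mx_image.
Qed.

End LineTopology.

(** ** Spreads invariant under a half-turn *)

Section TurnInvariantSpread.
Variables (R : realType) (C : set (line R)).
Local Notation V := 'cV[R]_4.
Implicit Types (L M : line R) (v : V) (g : GL4 R).
Hypothesis spC : compact_spread C.
Hypothesis invC : forall g, axial g -> GL_line g @` C = C.

Let dC : forall L M v, C L -> C M -> v != 0 -> v \in vs_of_line L ->
  v \in vs_of_line M -> L = M.
Proof. by have [] := (compact_spreadP C).1 spC. Qed.

Let covC : forall v, v != 0 -> exists2 L, C L & v \in vs_of_line L.
Proof. by have [] := (compact_spreadP C).1 spC. Qed.

Lemma imageK_GL g : GL_line g @` C = C -> GL_line (invGL g) @` C = C.
Proof. by move=> gC; rewrite -{1}gC -GL_lines_imageM mulVGL GL_lines_image1. Qed.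

Lemma mulmx_GLVK g v : mx_of_GL g *m (mx_of_GL (invGL g) *m v) = v.
Proof. by rewrite mkGLE mulKVmx // mx_of_GL_unit. Qed.

Lemma so_Z g L : so g -> vs_of_line L = z_axis R -> GL_line g L = L ->
  mx_of_GL g *m e3 R = e3 R \/ mx_of_GL g *m e3 R = - e3 R.
Proof.
move=> sg LZ gL; have e3L : e3 R \in vs_of_line L by rewrite LZ mem_z_axis !hvecs eqxx.
have : mx_of_GL g *m e3 R \in vs_of_line L by rewrite -[in X in _ \in X]gL mem_mx_image2.
set x := mx_of_GL g *m e3 R; rewrite LZ mem_z_axis => /andP[/eqP x0 /eqP x1].
have x3 : x i3 0 = 0 by rewrite so_weight // hvecs.
have : x i2 0 ^+ 2 = 1.
  have := so_normsq (e3 R) sg; rewrite -/x /normsq x0 x1 !hvecs.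
  by rewrite expr0n !add0r expr1n.
move/eqP; rewrite sqrf_eq1 => /orP[/eqP x2|/eqP x2]; [left|right].
  by rewrite [x]hvecK x0 x1 x2 x3.
rewrite [x]hvecK x0 x1 x2 x3 -[RHS]scaleN1r hvecZ; congr hvec; ring.
Qed.

(** The axis is the line of [C] through the origin, so [w] preserves it and, not being axial,
    reverses it. The half-turn [t] about the first axis reverses it as well; thus [mulGL t w] is
    axial, and [t] preserves [C]. *)
Lemma turn_invariant w : so w -> GL_line w @` C = C -> ~ axial w ->
  exists t, [/\ so t, GL_line t @` C = C, ~ axial t &
    forall x y z u : R, mx_of_GL t *m hvec x y z u = hvec x (- y) (- z) u].
Proof.
move=> sw wC nw; have [LZ CLZ Z] := Z_ex dC covC invC.
have we3 : mx_of_GL w *m e3 R = - e3 R.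
  have CwL : C (GL_line w LZ) by rewrite -wC; exists LZ.
  have := isZ_orbit dC covC invC CwL sw Z erefl => /esym /(so_Z sw Z)[w3|//].
  by case: nw.
have [t [st t1 t2 nt]] := half_turn R.
have te3 : mx_of_GL t *m e3 R = - e3 R.
  set x := mx_of_GL t *m e3 R.
  have x0 : x i0 0 = 0.
    by have [<- _ _ _] := dot_e x; rewrite -t1 so_dot // dotE !hvecs; ring.
  have x1 : x i1 0 = 0.
    apply: oppr_inj; rewrite oppr0; have [_ <- _ _] := dot_e x.
    by rewrite -dotNl -t2 so_dot // dotE !hvecs; ring.
  have x3 : x i3 0 = 0 by rewrite so_weight // hvecs.
  have : x i2 0 ^+ 2 = 1.
    have := so_normsq (e3 R) st; rewrite -/x /normsq x0 x1 !hvecs.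
    by rewrite expr0n !add0r expr1n.
  move/eqP; rewrite sqrf_eq1 => /orP[/eqP x2|/eqP x2].
    by case: nt; split => //; rewrite -/x [x]hvecK x0 x1 x2 x3.
  rewrite [x]hvecK x0 x1 x2 x3 -[RHS]scaleN1r hvecZ; congr hvec; ring.
exists t; split => //.
  have atw : axial (mulGL t w).
    by split; [exact: so_mul|rewrite mkGLE -mulmxA we3 mulmxN te3 opprK].
  rewrite -[t]mulGL1 -(mulGLV w) mulGLA GL_lines_imageM imageK_GL //.
  exact: invC.
move=> x y z u; have -> : hvec x y z u = x *: e1 R + y *: e2 R + z *: e3 R + u *: e4 R.
  by rewrite !hvecZ !hvecD; congr hvec; ring.
rewrite !mulmxDr -!scalemxAr t1 t2 te3 (so_e4 st).
by apply: vec4P; rewrite !mxE /=; ring.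
Qed.

Variable t : GL4 R.
Hypothesis tC : GL_line t @` C = C.
Hypothesis tE : forall x y z u : R, mx_of_GL t *m hvec x y z u = hvec x (- y) (- z) u.

(** [t] fixes the point [(r, 0, 0)], hence the line [L] of [C] through it. The vector [u] of [L] at
    [z = 1], [w = 0] and the negative of its image under [t] have the same [(z, w)], so they
    coincide; this kills the radial component of [u] and is the reason why all reguli are centred at
    height 0. *)
Lemma meridian_line r : 0 < r -> exists L y, [/\ generic C L, hvec r 0 0 1 \in vs_of_line L,
  hvec 0 y 1 0 \in vs_of_line L & y != 0].
Proof.
move=> r0; have [||L gL vL] := generic_through covC (v := hvec r 0 0 1).
- by rewrite /hor !hvecs expr0n addr0 exprn_gt0.
- by rewrite hvecs.
have CL : C L by case: gL.
have v0 : hvec r 0 0 1 != 0 :> V by rewrite hvec_neq0 oner_eq0 !orbT.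
have tL : GL_line t L = L.
  apply: (dC _ CL v0 _ vL); first by rewrite -tC; exists L.
  by have := vL; rewrite -(mem_mx_image2 t) tE !oppr0.
have [u [uL u2 u3]] := generic_lift dC covC invC 1 0 gL.
have tuL : - (mx_of_GL t *m u) \in vs_of_line L.
  by rewrite memvN -[in X in _ \in X]tL mem_mx_image2.
have uE : u = hvec (u i0 0) (u i1 0) 1 0 by rewrite [LHS]hvecK u2 u3.
have tuE : - (mx_of_GL t *m u) = hvec (- u i0 0) (u i1 0) 1 0.
  by rewrite {1}uE tE -[LHS]scaleN1r hvecZ; congr hvec; ring.
have x0 : u i0 0 = 0.
  have : u = - (mx_of_GL t *m u).
    by apply: (generic_eq dC covC invC gL uL tuL); rewrite tuE !hvecs.
  rewrite tuE => /colP /(_ i0); rewrite hvecs => h; apply/eqP.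
  by rewrite -[_ == 0](mulrn_eq0 _ 2) mulr2n {1}h addNr.
have uE0 : hvec 0 (u i1 0) 1 0 = u by rewrite [RHS]uE x0.
exists L, (u i1 0); split => //; first by rewrite uE0.
have u0 : u != 0 by apply/eqP => u0; move/eqP: u2; rewrite u0 mxE eq_sym oner_eq0.
have := generic_hor dC covC invC gL u0 uL; rewrite /hor x0 expr0n add0r.
by apply: contraTneq => ->; rewrite expr0n ltxx.
Qed.

Lemma screwed_meridian s r y L : 0 < r -> hvec r 0 0 1 \in vs_of_line L ->
  hvec 0 y 1 0 \in vs_of_line L -> screwed s L <-> s * y < 0.
Proof.
move=> r0 vL uL; have chiE : chi (hvec r 0 0 1) (hvec 0 y 1 0) = - (r * y).
  by rewrite /chi !hvecs; ring.
split=> [[a [b [aL bL ab]]]|sy]; last first.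
  exists (hvec r 0 0 1), (hvec 0 y 1 0); split => //.
  rewrite chiE; have -> : s * - (r * y) = r * - (s * y) by ring.
  by rewrite mulr_gt0 // oppr_gt0.
have ind (p q : R) : p *: hvec r 0 0 1 + q *: hvec 0 y 1 0 = 0 -> p = 0 /\ q = 0.
  rewrite !hvecZ hvecD => H; have H2 := congr1 (fun u : V => u i2 0) H.
  have H3 := congr1 (fun u : V => u i3 0) H.
  by rewrite !hvecs !mxE ?mulr0 ?mulr1 ?addr0 ?add0r in H2 H3.
move: aL bL; rewrite (line_span vL uL ind) => /mem_span2[p [q aE]] /mem_span2[p' [q' bE]].
move: ab; rewrite aE bE chi_change chiE.
have -> : s * ((p * q' - q * p') ^+ 2 * - (r * y)) =
  ((p * q' - q * p') ^+ 2 * r) * - (s * y) by ring.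
have : 0 <= (p * q' - q * p') ^+ 2 * r by rewrite mulr_ge0 ?sqr_ge0 // ltW.
rewrite le_eqVlt => /orP[/eqP <-|h]; first by rewrite mul0r ltxx.
by rewrite pmulr_rgt0 // oppr_gt0.
Qed.

Let pos s := [set r : R | 0 < r /\
  exists L, [/\ C L, hvec r 0 0 1 \in vs_of_line L & screwed s L]].

Let ray_neq0 (r : R) : hvec r 0 0 1 != 0 :> V.
Proof. by rewrite hvec_neq0 oner_eq0 !orbT. Qed.

(** A line of [C] other than [L0] misses the point at radius [r0], and nearby lines miss nearby
    points; near [L0] the sign is an open condition. By compactness of [C], the line of [C] through
    the point at a radius close to [r0] has the sign of [L0]. *)
Let pos_open s : open (pos s).
Proof.
rewrite openE => r0 [r00 [L0 [CL0 vL0 sL0]]].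
have cC : compact C by case: ((compact_spreadP C).1 spC).
have H : \forall r \near r0, C `<=` [set L | hvec r 0 0 1 \in vs_of_line L -> screwed s L].
  apply: ((compact_near_coveringP C).1 cC R (nbhs r0)
    (fun r L => hvec r 0 0 1 \in vs_of_line L -> screwed s L) (nbhs_filter r0)).
  move=> L CL; have [vL|vL] := boolP (hvec r0 0 0 1 \in vs_of_line L).
    have LL0 : L = L0 by exact: dC vL vL0.
    exists (screwed s, setT); last by move=> [L' r] /= [].
    split; last exact: filterT.
    by apply: open_nbhs_nbhs; split; [exact: screwed_open|rewrite LL0].
  have [[N M] /= [Nv ML] NM] := nonincident_near vL.
  have ch : hvec r 0 0 1 @[r --> r0] --> (hvec r0 0 0 1 : V).
    apply: mx_cvg => i j; rewrite ord1; under eq_cvg do rewrite mxE; rewrite mxE.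
    by move: i; apply: ord4P => /=; [exact: cvg_id|exact: cvg_cst|exact: cvg_cst|exact: cvg_cst].
  exists (M, [set r | N (hvec r 0 0 1)]); first by split => //; exact: ch.
  move=> [L' r] /= [ML' Nr] vL'; have := NM (hvec r 0 0 1, L') (conj Nr ML').
  by rewrite /= vL'.
have rp : nbhs r0 [set r | 0 < r] by apply: open_nbhs_nbhs; split => //; exact: open_gt.
apply: filterS (filterI H rp) => r [Hr r_gt0]; split => //.
have [L CL vL] := covC (ray_neq0 r); exists L; split => //; exact: Hr.
Qed.

(* Both signs of the slope [y] are open conditions on the radius [r], which
   ranges over a connected set. *)
Lemma chirality : exists s : R, s ^+ 2 = 1 /\ forall r y L, 0 < r -> C L ->
  hvec r 0 0 1 \in vs_of_line L -> hvec 0 y 1 0 \in vs_of_line L -> 0 < s * y.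
Proof.
have dich (s r : R) : s != 0 -> 0 < r -> pos s r \/ pos (- s) r.
  move=> s0 r0; have [L [y [[CL _ _] vL uL y0]]] := meridian_line r0.
  have : s * y != 0 by rewrite mulf_neq0.
  rewrite neq_lt => /orP[sy|sy]; [left|right]; split => //; exists L; split => //.
    exact/(screwed_meridian _ r0 vL uL).
  by apply/(screwed_meridian _ r0 vL uL); rewrite mulNr oppr_lt0.
have excl (s r : R) : pos s r -> pos (- s) r -> False.
  move=> [r0 [L [CL vL sL]]] [_ [L' [CL' vL' sL']]].
  have LL' : L = L' by exact: dC vL vL'.
  have [M [y [[CM _ _] vM uM y0]]] := meridian_line r0.
  have LM : L = M by exact: dC vL vM.
  rewrite -LM in uM; rewrite -LL' in sL'.
  move/(screwed_meridian _ r0 vL uM) : sL; move/(screwed_meridian _ r0 vL uM) : sL'.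
  by rewrite mulNr oppr_lt0 => a b; have := lt_trans a b; rewrite ltxx.
have [s [s1 s0 ps]] : exists s : R, [/\ s ^+ 2 = 1, s != 0 & pos s 1].
  have [p|p] := dich 1 1 (oner_neq0 _) ltr01.
    by exists 1; rewrite expr1n oner_eq0.
  by exists (- 1); rewrite sqrrN expr1n oppr_eq0 oner_eq0.
have all_pos r : 0 < r -> pos s r.
  have cT : connected [set r : R | 0 < r].
    apply/connected_intervalP => x y /= x0 y0 z /andP[xz _]; exact: lt_le_trans xz.
  suff : pos s = [set r : R | 0 < r] by move=> ->.
  apply: cT; first by exists 1.
    exists (pos s); first exact: pos_open.
    apply/seteqP; split => [x px|x []//].
    by split => //; case: px.
  exists (~` pos (- s)); first by rewrite closedC; exact: pos_open.
  apply/seteqP; split => [x px|x [x0 npx]].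
    by split; [case: px|move=> npx; exact: excl px npx].
  by have [//|/npx] := dich _ _ s0 x0.
(* By [screwed_meridian], membership in [pos s] means [s * y < 0]. *)
exists (- s); split; first by rewrite sqrrN.
move=> r y L r0 CL vL uL; have [_ [L' [CL' vL' sL']]] := all_pos r r0.
rewrite (dC CL' CL (ray_neq0 r) vL' vL) in sL'.
by move/(screwed_meridian _ r0 vL uL) : sL'; rewrite mulNr oppr_gt0.
Qed.

(** For [s = -1] it interchanges left- and right-screwed lines, as is needed to make [a]
    positive. *)
Definition reflection_mx (s : R) : 'M[R]_4 :=
  mx4 [:: [:: 1; 0; 0; 0]; [:: 0; s; 0; 0]; [:: 0; 0; 1; 0]; [:: 0; 0; 0; 1]].

Lemma reflection_hvec s (x y z w : R) :
  reflection_mx s *m hvec x y z w = hvec x (s * y) z w.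
Proof. by rewrite mx4_hvec /=; congr hvec; ring. Qed.

Lemma reflection_unit s : s ^+ 2 = 1 -> reflection_mx s \in unitmx.
Proof.
move=> ss; apply: (@mulmx1_unit _ _ _ (reflection_mx s) _).1.
apply: mx_eq_hvec => x y z w.
by rewrite -mulmxA !reflection_hvec mul1mx mulrA -expr2 ss mul1r.
Qed.

(** The meridian line at radius [r] has direction [(0, y r, 1)]; reflected and multiplied by
    [s / y r] it becomes [(0, 1, a r)], the direction of a generator with [b = 0]. *)
Lemma standard_form : exists (g : GL4 R) (a : R -> R),
  (forall r, 0 < r -> 0 < a r) /\ GL_line g @` C = standard_lines a (fun=> 0).
Proof.
have [s [ss chir]] := chirality.
have s0 : s != 0 by apply/eqP => s0; move/eqP: ss; rewrite s0 expr0n eq_sym oner_eq0.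
have /choice[y yP] r : exists y : R, 0 < r -> exists L, [/\ generic C L,
    hvec r 0 0 1 \in vs_of_line L, hvec 0 y 1 0 \in vs_of_line L & y != 0].
  have [r0|r0] := pselect (0 < r); last by exists 0.
  by have [L [y H]] := meridian_line r0; exists y => _; exists L.
pose g := mkGL (reflection_unit ss); pose a r := s / y r.
have gE (x z' z w : R) : mx_of_GL g *m hvec x z' z w = hvec x (s * z') z w.
  exact: reflection_hvec.
exists g, a; split.
  move=> r r0; have [L [[CL _ _] vL uL y0]] := yP r r0.
  have -> : a r = (s * y r) / (y r) ^+ 2 by rewrite /a; field.
  by rewrite divr_gt0 ?exprn_even_gt0 //; exact: chir CL vL uL.
have merid r L : 0 < r -> C L -> hvec r 0 0 1 \in vs_of_line L ->
    mx_image (mx_of_GL g) (vs_of_line L) = generator r (a r) 0.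
  move=> r0 CL vL; have [L' [[CL' _ _] vL' uL' y0]] := yP r r0.
  rewrite (dC CL CL' (ray_neq0 r) vL vL') -[mx_image _ _]/(vs_of_line (GL_line g L')).
  apply: line_span.
  - have <- : mx_of_GL g *m hvec r 0 0 1 = hvec r 0 0 1 by rewrite gE mulr0.
    by rewrite mem_mx_image2.
  - have -> : hvec 0 1 (a r) 0 = a r *: (mx_of_GL g *m hvec 0 (y r) 1 0).
      rewrite gE hvecZ; congr hvec; rewrite ?mulr0 ?mulr1 //.
      by rewrite -[LHS]ss /a; field.
    by rewrite memvZ // mem_mx_image2.
  - move=> p q; rewrite !hvecZ hvecD => H; have H1 := congr1 (fun u : V => u i1 0) H.
    have H3 := congr1 (fun u : V => u i3 0) H.
    by rewrite !hvecs !mxE ?mulr0 ?mulr1 ?addr0 ?add0r in H1 H3.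
(* The reflection conjugates the rotation by an angle into that by [s] times the angle. *)
have conj (u v : R) : reflection_mx s *m Rz u v = Rz u (s * v) *m reflection_mx s.
  apply: mx_eq_hvec => x z' z w; rewrite -!mulmxA Rz_hvec !reflection_hvec Rz_hvec.
  rewrite -[X in hvec (_ - X) _ _ _]mul1r -ss; congr hvec; ring.
apply/seteqP; split => [_ [L CL <-]|L].
- have [LZ|LZ] := pselect (isZ L).
    left; left; apply: line_sub_span2 => v; rewrite mem_mx_image => vL.
    have {}vL : mx_of_GL (invGL g) *m v \in z_axis R by rewrite -LZ.
    have -> : v = mx_of_GL g *m (mx_of_GL (invGL g) *m v).
      by rewrite mulmx_GLVK.
    move: vL; set w := mx_of_GL (invGL g) *m v.
    rewrite -/(z_axis R) [w in X in _ -> X]hvecK gE !mem_z_axis !hvecs.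
    by move=> /andP[-> /eqP ->]; rewrite mulr0 eqxx.
  have [LV|LV] := pselect (isV L).
    left; right; apply: line_sub_span2 => v; rewrite mem_mx_image => vL.
    have {}vL : mx_of_GL (invGL g) *m v \in xy_horizon R by rewrite -LV.
    have -> : v = mx_of_GL g *m (mx_of_GL (invGL g) *m v).
      by rewrite mulmx_GLVK.
    move: vL; set w := mx_of_GL (invGL g) *m v.
    by rewrite -/(xy_horizon R) [w in X in _ -> X]hvecK gE !mem_xy_horizon !hvecs.
  have gL : generic C L by [].
  have [v [vL v2 v3]] := generic_lift dC covC invC 0 1 gL.
  have hv : 0 < hor v by apply: (generic_hor dC covC invC gL _ vL); exact: affine_neq0.
  pose r := Num.sqrt (hor v); have r0 : 0 < r by rewrite sqrtr_gt0.
  have [h ah hE] : exists2 h, axial h & forall z w : R,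
      mx_of_GL h *m hvec r 0 z w = hvec (v i0 0) (v i1 0) z w.
    by apply: axial_ex; rewrite expr0n addr0 sqr_sqrtr // ltW.
  pose M := GL_line (invGL h) L.
  have CM : C M by apply: (axial_mem invC) => //; exact: axial_inv.
  have vM : hvec r 0 0 1 \in vs_of_line M.
    by rewrite -(mem_mx_image2 h) -[mx_image _ _]/(vs_of_line (GL_line h M)) GL_lineVK hE
      -v2 -[X in hvec _ _ _ X]v3 -hvecK.
  right; exists r => //; have [u [w [uw hR]]] := axialE ah.
  have [t' [tu tw]] : exists t', u = cos t' /\ s * w = sin t'.
    by apply: angle_ex; rewrite exprMn ss mul1r.
  exists t'; rewrite rotzE -tu -tw -(merid r M r0 CM vM).
  have ss' : (s * w) ^+ 2 = w ^+ 2 by rewrite exprMn ss mul1r.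
  have [k _ kR] : exists2 k, axial k & mx_of_GL k = Rz u (s * w).
    by apply: Rz_axial; rewrite ss'.
  rewrite -[vs_of_line _]/(mx_image (mx_of_GL g) (vs_of_line L)) -(GL_lineVK h L) -/M.
  rewrite -[vs_of_line (GL_line h M)]/(mx_image (mx_of_GL h) (vs_of_line M)) -kR -!mx_imageM.
  by congr mx_image; rewrite !mkGLE hR kR conj.
case=> [[LZ|LV]|[r r0 [t' LE]]].
- have [M CM MZ] := Z_ex dC covC invC; exists M => //; apply: line_eq; rewrite LZ.
  apply: line_sub_span2 => v; rewrite mem_mx_image => vM; rewrite -/(z_axis R).
  have -> : v = mx_of_GL g *m (mx_of_GL (invGL g) *m v).
    by rewrite mulmx_GLVK.
  have {}vM : mx_of_GL (invGL g) *m v \in z_axis R by rewrite -MZ.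
  move: vM; set w := mx_of_GL (invGL g) *m v.
  rewrite [w in X in _ -> X]hvecK gE !mem_z_axis !hvecs.
  by move=> /andP[-> /eqP ->]; rewrite mulr0 eqxx.
- have [M CM MV] := V_ex dC covC invC; exists M => //; apply: line_eq; rewrite LV.
  apply: line_sub_span2 => v; rewrite mem_mx_image => vM; rewrite -/(xy_horizon R).
  have -> : v = mx_of_GL g *m (mx_of_GL (invGL g) *m v).
    by rewrite mulmx_GLVK.
  have {}vM : mx_of_GL (invGL g) *m v \in xy_horizon R by rewrite -MV.
  move: vM; set w := mx_of_GL (invGL g) *m v.
  by rewrite [w in X in _ -> X]hvecK gE !mem_xy_horizon !hvecs.
have [M CM vM] := covC (ray_neq0 r).
have tt : cos t' ^+ 2 + (s * sin t') ^+ 2 = 1 by rewrite exprMn ss mul1r cos2Dsin2.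
have [h ah hR] := Rz_axial tt.
have [k _ kR] := Rz_axial (cos2Dsin2 t').
exists (GL_line h M); first exact: axial_mem.
apply: line_eq; rewrite LE -(merid r M r0 CM vM) rotzE -kR.
rewrite -[LHS]/(mx_image (mx_of_GL g) (mx_image (mx_of_GL h) (vs_of_line M))) -!mx_imageM.
by congr mx_image; rewrite !mkGLE hR kR conj mulrA -expr2 ss mul1r.
Qed.

End TurnInvariantSpread.

(** * The embedding of O(2) in SO(3) *)

Section OrthogonalEmbedding.
Variable R : realType.
Implicit Types (A B : 'M[R]_2).

Lemma det2 A : \det A = A 0 0 * A 1 1 - A 0 1 * A 1 0.
Proof.
rewrite (expand_det_row _ 0) big_ord_recl big_ord1 /cofactor !det_mx11 !mxE /=.
rewrite !expr0 expr1 mul1r mulN1r mulrN.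
by congr (A _ _ * A _ _ - A _ _ * A _ _); exact: val_inj.
Qed.

Lemma mulmx2 A B i j : (A *m B) i j = A i 0 * B 0 j + A i 1 * B 1 j.
Proof.
rewrite mxE big_ord_recl big_ord1; congr (_ + A _ _ * B _ _); exact: val_inj.
Qed.

(** The third diagonal entry makes the determinant 1 for orthogonal [A]: a reflection of the plane
    is realized by the half-turn of space about its mirror line. *)
Definition emb A : 'M[R]_4 := mx4 [:: [:: A 0 0; A 0 1; 0; 0]; [:: A 1 0; A 1 1; 0; 0];
  [:: 0; 0; \det A; 0]; [:: 0; 0; 0; 1]].

Lemma emb_hvec A (x y z w : R) : emb A *m hvec x y z w =
  hvec (A 0 0 * x + A 0 1 * y) (A 1 0 * x + A 1 1 * y) (\det A * z) w.
Proof. by rewrite mx4_hvec /=; congr hvec; ring. Qed.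

Lemma embM A B : emb (A *m B) = emb A *m emb B.
Proof.
apply: mx_eq_hvec => x y z w; rewrite -mulmxA !emb_hvec det_mulmx !mulmx2.
by congr hvec; ring.
Qed.

Lemma emb1 : emb 1%:M = 1%:M.
Proof.
apply: mx_eq_hvec => x y z w; rewrite emb_hvec det1 !mxE /= mul1mx.
by congr hvec; ring.
Qed.

Lemma emb_tr A : emb A^T = (emb A)^T.
Proof.
by apply/matrixP; apply: ord4P; apply: ord4P; rewrite !mxE /= ?mxE // det_tr.
Qed.

Lemma emb_rotation A : A^T *m A = 1%:M -> \det A = 1 ->
  A 0 0 ^+ 2 + A 1 0 ^+ 2 = 1 /\ emb A = Rz (A 0 0) (A 1 0).
Proof.
move=> /matrixP AA dA; have := AA 0 0; have := AA 0 1.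
rewrite !mulmx2 !mxE /= => acbd ab; split; first by rewrite !expr2.
have dd := dA; rewrite det2 in dd.
have da : A 1 1 = A 0 0.
  have -> : A 1 1 = A 1 1 * (A 0 0 * A 0 0 + A 1 0 * A 1 0) by rewrite ab mulr1.
  have -> : A 1 1 * (A 0 0 * A 0 0 + A 1 0 * A 1 0) = A 0 0 * (A 0 0 * A 1 1 -
    A 0 1 * A 1 0) + A 1 0 * (A 0 0 * A 0 1 + A 1 0 * A 1 1) by ring.
  by rewrite dd acbd mulr0 addr0 mulr1.
have cb : A 0 1 = - A 1 0.
  have -> : A 0 1 = A 0 1 * (A 0 0 * A 0 0 + A 1 0 * A 1 0) by rewrite ab mulr1.
  have -> : A 0 1 * (A 0 0 * A 0 0 + A 1 0 * A 1 0) = A 0 0 * (A 0 0 * A 0 1 +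
    A 1 0 * A 1 1) - A 1 0 * (A 0 0 * A 1 1 - A 0 1 * A 1 0) by ring.
  by rewrite dd acbd mulr0 add0r mulr1.
apply: mx_eq_hvec => x y z w; rewrite emb_hvec Rz_hvec da cb dA mul1r mulNr.
by congr hvec; ring.
Qed.

Definition flip2 : 'M[R]_2 := diag_mx (\row_i (if i == 0 then 1 else -1)).

Lemma flip2_orth : flip2^T *m flip2 = 1%:M.
Proof.
rewrite tr_diag_mx mulmx_diag; apply/matrixP => i j; rewrite !mxE.
by case: (i == 0); rewrite ?mulrNN mulr1.
Qed.

Lemma det_flip2 : \det flip2 = -1.
Proof. by rewrite det_diag big_ord_recl big_ord1 !mxE /= mul1r. Qed.

Lemma emb_flip2_hvec (x y z w : R) : emb flip2 *m hvec x y z w = hvec x (- y) (- z) w.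
Proof. by rewrite emb_hvec det_flip2 !mxE /=; congr hvec; ring. Qed.

Lemma emb_flip_SO3e : SO3e (emb flip2).
Proof.
split; first by rewrite -emb_tr -embM flip2_orth emb1.
  by rewrite -emb_tr /flip2 tr_diag_mx -/flip2 emb_flip2_hvec; congr hvec; ring.
have -> : emb flip2 = diag_mx (\row_i (if (i == i0) || (i == i3) then 1 else -1)).
  by apply/matrixP; apply: ord4P; apply: ord4P; rewrite !mxE /= ?det_flip2 ?mxE.
by rewrite det_diag prod4 !mxE /=; ring.
Qed.

Lemma flip2K A : flip2 *m (flip2 *m A) = A.
Proof. by rewrite mulmxA -{1}[flip2]tr_diag_mx flip2_orth mul1mx. Qed.

Lemma flip_rotation A : A^T *m A = 1%:M -> \det A = -1 ->
  (flip2 *m A)^T *m (flip2 *m A) = 1%:M /\ \det (flip2 *m A) = 1.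
Proof.
move=> AA dA; rewrite trmx_mul -mulmxA (mulmxA flip2^T) flip2_orth mul1mx AA.
by rewrite det_mulmx dA det_flip2 mulrNN mulr1.
Qed.

Lemma emb_SO3e A : A^T *m A = 1%:M -> SO3e (emb A).
Proof.
move=> AA; have [dA|dA] := det_orth AA.
  by have [ab ->] := emb_rotation AA dA; exact: Rz_SO3e.
have [BB dB] := flip_rotation AA dA; have [ab E] := emb_rotation BB dB.
rewrite -(flip2K A) embM E; apply: SO3e_mul; first exact: emb_flip_SO3e.
exact: Rz_SO3e.
Qed.

Lemma emb_continuous : continuous emb.
Proof.
move=> A; have c i j : (B : 'M[R]_2) i j @[B --> A] --> A i j by exact: coord_continuous.
have d : \det B @[B --> A] --> \det A by exact: (@det_cvg R _ (nbhs A) _ _ id A cvg_id).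
apply: (@mx_cvg R _ _ (nbhs_filter A)) => i j; under eq_cvg do rewrite mxE; rewrite mxE.
by move: i; apply: ord4P; move: j; apply: ord4P => /=; first
  [exact: cvg_cst | exact: c | exact: d].
Qed.

Definition ulmx (G : 'M[R]_4) : 'M[R]_2 :=
  \matrix_(i < 2, j < 2) (G : 'M[R]_(2 + 2)) (lshift 2 i) (lshift 2 j).

Lemma embK A : ulmx (emb A) = A.
Proof.
by apply/matrixP => -[[|[|//]] p] -[[|[|//]] q]; rewrite !mxE /=; congr (A _ _); exact: val_inj.
Qed.

Lemma ulmx_continuous : continuous ulmx.
Proof.
move=> G; apply: (@mx_cvg R _ _ (nbhs_filter G)) => i j; under eq_cvg do rewrite mxE; rewrite mxE.
exact: coord_continuous.
Qed.

End OrthogonalEmbedding.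

(** ** The orbit of a spread *)

Section Orbit.
Variables (R : realType) (P : GL4 R) (Omega : set 'M[R]_4) (C : set (line R)).
Implicit Types (g h : GL4 R) (L : line R) (D : set (oline R)).
Let conj g := mulGL P (mulGL g (invGL P)).
Let unconj g := mulGL (invGL P) (mulGL g P).
Hypothesis OmegaE : forall g, Omega (mx_of_GL g) <-> so (conj g).
Hypothesis spC : compact_spread C.
Hypothesis invPC : forall g, axial g -> GL_line g @` (GL_line P @` C) = GL_line P @` C.

Let ax g := axial (conj g).

Let unconjK g : conj (unconj g) = g.
Proof. by rewrite /conj /unconj !mulGLA mulGLV mul1GL -mulGLA mulGLV mulGL1. Qed.

Let conjK g : unconj (conj g) = g.
Proof. by rewrite /conj /unconj !mulGLA mulVGL mul1GL -mulGLA mulVGL mulGL1. Qed.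

Let conjM g h : conj (mulGL g h) = mulGL (conj g) (conj h).
Proof. by rewrite /conj -!mulGLA (mulGLA (invGL P)) mulVGL mul1GL. Qed.

Let conj1 : conj (oneGL R) = oneGL R.
Proof. by rewrite /conj mul1GL mulGLV. Qed.

Lemma invGL_uniq g h : mulGL g h = oneGL R -> invGL g = h.
Proof. by move=> gh; rewrite -[LHS]mulGL1 -gh mulGLA mulVGL mul1GL. Qed.

Let conjV g : conj (invGL g) = invGL (conj g).
Proof. by symmetry; apply: invGL_uniq; rewrite -conjM mulGLV conj1. Qed.

Let conj_line g L : GL_line (conj g) (GL_line P L) = GL_line P (GL_line g L).
Proof. by rewrite /conj !GL_lineM GL_lineK. Qed.

Let conj_oline g l : GL_oline (conj g) (GL_oline P l) = GL_oline P (GL_oline g l).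
Proof. by rewrite /conj !GL_olineM GL_olineK. Qed.

Let conj_image g : GL_line (conj g) @` (GL_line P @` C) = GL_line P @` (GL_line g @` C).
Proof.
by rewrite -!GL_lines_imageM; congr (GL_line _ @` _); rewrite /conj -!mulGLA mulVGL mulGL1.
Qed.

Let GL_image_inj (X Y : set (line R)) : GL_line P @` X = GL_line P @` Y -> X = Y.
Proof.
by move=> XY; rewrite -[X]GL_lines_image1 -[Y]GL_lines_image1 -(mulVGL P)
  !GL_lines_imageM XY.
Qed.

Let Om g := Omega (mx_of_GL g).
Let OmM g h : Om g -> Om h -> Om (mulGL g h).
Proof. by move=> /OmegaE sg /OmegaE sh; apply/OmegaE; rewrite conjM; exact: so_mul. Qed.
Let OmV g : Om g -> Om (invGL g).
Proof. by move=> /OmegaE sg; apply/OmegaE; rewrite conjV; exact: so_inv. Qed.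
Let Om1 : Om (oneGL R).
Proof. by apply/OmegaE; rewrite conj1; exact: so_one. Qed.
Let axOm g : ax g -> Om g.
Proof. by move=> [sg _]; apply/OmegaE. Qed.
Let axM g h : ax g -> ax h -> ax (mulGL g h).
Proof. by rewrite /ax conjM; exact: axial_mul. Qed.
Let axV g : ax g -> ax (invGL g).
Proof. by rewrite /ax conjV; exact: axial_inv. Qed.

Let axC g : ax g -> GL_line g @` C = C.
Proof. by move=> ag; apply: GL_image_inj; rewrite -conj_image; exact: invPC. Qed.

Let spPC : compact_spread (GL_line P @` C).
Proof. exact: compact_spread_GL. Qed.
Let dC : forall L M v, (GL_line P @` C) L -> (GL_line P @` C) M -> v != 0 ->
  v \in vs_of_line L -> v \in vs_of_line M -> L = M.
Proof. by have [] := (compact_spreadP _).1 spPC. Qed.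
Let covC : forall v, v != 0 -> exists2 L, (GL_line P @` C) L & v \in vs_of_line L.
Proof. by have [] := (compact_spreadP _).1 spPC. Qed.

Let orbit_ax L L' g : C L -> C L' -> Om g -> GL_line g L = L' ->
  exists2 h, ax h & GL_line h L = L'.
Proof.
move=> CL CL' /OmegaE sg gL.
have [||||h ah hL] := @orbit_axial R _ dC covC invPC (GL_line P L) (GL_line P L') (conj g).
- by exists L.
- by exists L'.
- exact: sg.
- by rewrite conj_line gL.
exists (unconj h); first by rewrite /ax unconjK.
by apply: (can_inj (GL_lineK P)); rewrite -conj_line unconjK.
Qed.

Let Om_covers L : exists2 g, Om g & C (GL_line g L).
Proof.
have [g sg CgL] := so_covers dC covC invPC (GL_line P L).
exists (unconj g); first by apply/OmegaE; rewrite unconjK.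
by move/GL_lines_imageP : CgL; rewrite /unconj !GL_lineM.
Qed.

Let stab_ax g (l : oline R) : Om g -> C (forget l) -> GL_oline g l = l -> ax g.
Proof.
move=> /OmegaE sg Cl gl.
apply: (@oriented_stab_axial R _ dC covC invPC (conj g) (GL_oline P l)) => //.
  by exists (forget l).
by rewrite conj_oline gl.
Qed.

Let Om_reversal L : exists t, [/\ Om t, GL_line t L = L &
  forall l : oline R, forget l = L -> GL_oline t l <> l].
Proof.
have [t [st tL rt]] := reversal (GL_line P L).
exists (unconj t); split.
- by apply/OmegaE; rewrite unconjK.
- by apply: (can_inj (GL_lineK P)); rewrite -conj_line unconjK.
- move=> l lL lt; apply: (rt (GL_oline P l)); first by rewrite -lL.
  by rewrite -(unconjK t) conj_oline lt.
Qed.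

(** An axial element fixes [e3] and [e4], hence the orientation of the axis; so a reversal of the
    axis is not axial. This is the element that obstructs the unoriented orbit. *)
Let nonaxial_stab : exists L t, [/\ C L, Om t, GL_line t L = L & ~ ax t].
Proof.
have [_ [L CL <-] LZ] := Z_ex dC covC invPC; have [t [Ot tL rt]] := Om_reversal L.
exists L, t; split => // -[st t3].
have [X bX] := line_basis L.
pose l : oline R := OLine (ex_intro2 _ _ X bX (erefl (orientation_class _ X))).
apply: (rt l) => //; apply: (can_inj (GL_olineK P)); rewrite -conj_oline.
have e4L : e4 R \in vs_of_line (GL_line P L) by rewrite LZ mem_z_axis !hvecs eqxx.
have e3L : e3 R \in vs_of_line (GL_line P L) by rewrite LZ mem_z_axis !hvecs eqxx.
have tL' : GL_line (conj t) (GL_line P L) = GL_line P L by rewrite conj_line tL.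
have := @oline_stab2 R (GL_oline P l) (conj t) _ _ 1 0 0 1 e4L e3L (@e34_indep R) tL'.
rewrite so_e4 // t3 !scale1r !scale0r addr0 add0r => /(_ erefl erefl).
by rewrite mulr1 mulr0 subr0 ltr01 => /esym/asboolP.
Qed.

Section TurnInvariant.
Variable w : GL4 R.
Hypotheses (Ow : Om w) (wC : GL_line w @` C = C) (nw : ~ ax w).

Lemma turn_rotational : rotational O2 C.
Proof.
have wPC : GL_line (conj w) @` (GL_line P @` C) = GL_line P @` C by rewrite conj_image wC.
have [t [st tC nt tE]] := turn_invariant spPC invPC ((OmegaE w).1 Ow) wPC nw.
have [g [a [a0 gC]]] := standard_form spPC invPC tC tE.
split => //; exists a, (fun=> 0); split => //.
- by move=> _; exists 0.
- by rewrite -gC; exact: compact_spread_GL.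
- rewrite -gC -GL_lines_imageM.
  have := isomorphic_sets_GL (invGL (mulGL g P)) (GL_line (mulGL g P) @` C).
  by rewrite -GL_lines_imageM mulVGL GL_lines_image1.
Qed.

Let emb_conj (A : 'M[R]_2) := invmx (mx_of_GL P) *m emb A *m mx_of_GL P.

Let uP : mx_of_GL P \in unitmx. Proof. exact: mx_of_GL_unit. Qed.

Let emb_conjK A : mx_of_GL P *m emb_conj A *m invmx (mx_of_GL P) = emb A.
Proof. by rewrite /emb_conj !mulmxA mulmxV // mul1mx -mulmxA mulmxV // mulmx1. Qed.

Let emb_conjM A B : emb_conj (A *m B) = emb_conj A *m emb_conj B.
Proof. by rewrite /emb_conj embM !mulmxA mulmxK. Qed.

(** In the adapted coordinates, [C] is invariant under the axial rotations and under the half-turn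
    [t], which is [emb flip2]. Together they generate the image of O(2) under [emb]. *)
Lemma turn_admissible : admissible Omega O2 C.
Proof.
have wPC : GL_line (conj w) @` (GL_line P @` C) = GL_line P @` C by rewrite conj_image wC.
have [t [st tC nt tE]] := turn_invariant spPC invPC ((OmegaE w).1 Ow) wPC nw.
have tflip : mx_of_GL t = emb (@flip2 R).
  by apply: mx_eq_hvec => x y z u; rewrite tE emb_flip2_hvec.
have Hex (A : 'M[R]_2) : A^T *m A = 1%:M -> exists g, so (conj g) /\ mx_of_GL g = emb_conj A.
  move=> AA; have sA := emb_SO3e AA; exists (unconj (mkGL (SO3e_unit sA))).
  by rewrite unconjK /so !mkGLE; split => //; rewrite /emb_conj mulmxA.
pose f (G : 'M[R]_4) := ulmx (mx_of_GL P *m G *m invmx (mx_of_GL P)).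
exists (emb_conj @` @orthogonal_group R 2); split.
- move=> _ [A AA <-]; have [g [sg <-]] := Hex A AA.
  exact/OmegaE.
- split.
  + by move=> _ [A AA <-]; have [g [sg <-]] := Hex A AA; exact: mx_of_GL_unit.
  + exists 1%:M; first by rewrite /orthogonal_group /= trmx1 mul1mx.
    by rewrite /emb_conj emb1 mulmx1 mulVmx.
  + move=> _ _ [A AA <-] [B BB <-]; exists (A *m B); last exact: emb_conjM.
    by rewrite /orthogonal_group /= trmx_mul -mulmxA (mulmxA A^T) AA mul1mx.
  + move=> _ [A AA <-]; exists A^T.
      by rewrite /orthogonal_group /= trmxK; exact: mulmx1C.
    have [g [_ gA]] := Hex A AA; rewrite -gA.
    have uA := mx_of_GL_unit g.
    rewrite -[LHS]mulmx1 -(mulmxV uA) mulmxA {1}gA -emb_conjM AA /emb_conj emb1 mulmx1.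
    by rewrite mulVmx // mul1mx.
- exists f; split; last first.
    move=> _ _ [A AA <-] [B BB <-].
    by rewrite -emb_conjM /f !emb_conjK !embK.
  split.
  + split.
    * by move=> _ [A AA <-]; rewrite /f emb_conjK embK.
    * move=> _ _ /set_mem[A AA <-] /set_mem[B BB <-].
      by rewrite /f !emb_conjK !embK => ->.
    * by move=> A AA; exists (emb_conj A); [exists A|rewrite /f emb_conjK embK].
  + apply: continuous_subspaceT => G; apply: cvg_comp; last exact: ulmx_continuous.
    apply: (cvg_comp (fun G => mx_of_GL P *m G) (fun G => G *m invmx (mx_of_GL P))).
      exact: mulmx_continuousr.
    exact: mulmx_continuousl.
  + exists emb_conj; split; last by move=> _ /set_mem[A AA <-]; rewrite /f emb_conjK embK.
    apply: continuous_subspaceT => A; rewrite /emb_conj.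
    apply: (cvg_comp (fun A => invmx (mx_of_GL P) *m emb A) (fun G => G *m mx_of_GL P)).
      apply: (cvg_comp (@emb R) (fun G => invmx (mx_of_GL P) *m G)).
        exact: emb_continuous.
      exact: mulmx_continuousr.
    exact: mulmx_continuousl.
- move=> g [A AA gA].
  have cg : mx_of_GL (conj g) = emb A by rewrite /conj !mkGLE -gA mulmxA emb_conjK.
  apply: GL_image_inj; rewrite -conj_image.
  have rot k (B : 'M[R]_2) : B^T *m B = 1%:M -> \det B = 1 -> mx_of_GL k = emb B -> axial k.
    move=> BB dB kB; have [ab E] := emb_rotation BB dB.
    have [r ar rE] := Rz_axial ab; rewrite (_ : k = r) //.
    by apply: GL_inj; rewrite kB E rE.
  have [dA|dA] := det_orth AA; first exact/invPC/(rot _ A).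
  have [BB dB] := flip_rotation AA dA.
  have at' : axial (mulGL t (conj g)).
    by apply: (rot _ _ BB dB); rewrite mkGLE tflip cg embM.
  rewrite -[conj g]mul1GL -(mulVGL t) -mulGLA GL_lines_imageM invPC //.
  by rewrite imageK_GL.
Qed.

End TurnInvariant.

Section OrientedOrbit.
Variable D : set (oline R).
Hypothesis CD : oriented_spread_over C D.

(** The rotations by a real angle form a path through the identity and [g] that preserves [C], so
    [over_path] applies. *)
Let ax_sub g l : ax g -> D l -> D (GL_oline g l).
Proof.
move=> ag Dl; have [u [v [uv gE]]] := axialE ag.
have [t [ut vt]] := angle_ex uv.
have cs2 (s : R) : cos s ^+ 2 + sin s ^+ 2 = 1 by exact: cos2Dsin2.
pose h s := unconj (mkGL (SO3e_unit (Rz_SO3e (cs2 s)))).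
have -> : g = h t.
  by rewrite -[g]conjK; congr unconj; apply: GL_inj; rewrite gE mkGLE -ut -vt.
apply: (over_path CD) => //.
- move=> s; apply: cvg_GL; rewrite /h /unconj.
  have cR : Rz (cos x) (sin x) @[x --> s] --> Rz (cos s) (sin s).
    have cc := @continuous_cos R s; have cS := @continuous_sin R s.
    have cN : - sin x @[x --> s] --> - sin s by exact: cvgN.
    apply: mx_cvg => i j; under eq_cvg do rewrite mxE; rewrite mxE.
    by move: i; apply: ord4P; move: j; apply: ord4P => /=; first
      [exact: cvg_cst | exact: cc | exact: cS | exact: cN].
  have c1 := cvg_comp _ (fun G => G *m mx_of_GL P) cR (@mulmx_continuousl R _ _ _ _ _).
  have c2 := cvg_comp _ (fun G => invmx (mx_of_GL P) *m G) c1 (@mulmx_continuousr R _ _ _ _ _).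
  exact: c2.
- rewrite /h; apply: GL_inj; rewrite !mkGLE cos0 sin0.
  have -> : Rz 1 0 = 1%:M :> 'M[R]_4.
    by apply: mx_eq_hvec => x y z w; rewrite Rz_hvec mul1mx; congr hvec; ring.
  by rewrite mul1mx mulVmx // mx_of_GL_unit.
- move=> s; apply: axC; rewrite /ax unconjK; split.
    by rewrite /so mkGLE; exact: Rz_SO3e.
  by rewrite mkGLE Rz_hvec; congr hvec; ring.
Qed.

Let ax_image g : ax g -> GL_oline g @` D = D.
Proof.
move=> ag; apply/seteqP; split => [_ [l Dl <-]|l Dl]; first exact: ax_sub.
by apply/GL_olines_imageP; apply: ax_sub => //; exact: axV.
Qed.

Lemma orbit_oriented_parallelism : compact [set g | Om g] ->
  oriented_topological_parallelism (orbit_olines Omega D).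
Proof.
move=> cOm; have cC : compact C by case: ((compact_spreadP C).1 spC).
split.
- move=> _ [g Og <-]; exists (GL_line g @` C); first exact: compact_spread_GL.
  exact: oriented_spread_over_GL.
- move=> _ _ [g Og <-] [g' Og' <-] [_ [[l Dl <-] [l' Dl' ll']]].
  (* If two images of [D] share an oriented line, then [w] maps some [l] in [D] into [D]. An axial
     [h] does the same to the underlying line, hence to [l], since [D] has only one lift of each
     line. So [w] differs from [h] by an element that fixes [l], which is axial. *)
  pose w := mulGL (invGL g') g.
  have Ow : Om w by apply: OmM => //; exact: OmV.
  have wl : GL_oline w l = l' by rewrite /w GL_olineM -ll' GL_olineK.
  have Cl := over_sub CD Dl; have Cl' := over_sub CD Dl'.
  have [|h ah hl] := orbit_ax Cl Cl' Ow; first by rewrite -wl.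
  have hl' : GL_oline h l = l' by apply: (over_inj CD) => //; exact: ax_sub.
  have ahw : ax (mulGL (invGL h) w).
    apply: (stab_ax _ Cl); first by apply: OmM => //; exact/OmV/axOm.
    by rewrite GL_olineM wl -hl' GL_olineK.
  have aw : ax w.
    by rewrite -[w]mul1GL -(mulGLV h) -mulGLA; exact: axM.
  rewrite -[in RHS](ax_image aw) -GL_olines_imageM /w mulGLA mulGLV mul1GL //.
- apply/seteqP; split => // l _.
  have [g Og Cgl] := Om_covers (forget l).
  have [m Dm ml] := over_lift CD Cgl.
  have [gl|gl] := pselect (GL_oline g l = m).
    exists (GL_oline (invGL g) @` D); first by exists (invGL g) => //; exact: OmV.
    by exists m => //; rewrite -gl GL_olineK.
  (* The underlying line is moved into [C], but with the orientation that is not in [D]; a reversal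
     of that line corrects this. *)
  have [t [Ot tL rt]] := Om_reversal (forget m).
  have tm : GL_oline t m = GL_oline g l.
    apply: (@oline_two _ _ m); rewrite ?ml ?tL //; last exact: rt.
    by rewrite /= ml -ml tL.
  exists (GL_oline (mulGL (invGL g) t) @` D).
    by exists (mulGL (invGL g) t) => //; apply: OmM => //; exact: OmV.
  by exists m => //; rewrite GL_olineM tm GL_olineK.
- exact: (hypercompact_olines cOm (oriented_spread_compact cC CD)).
Qed.

(** A family of the form [oriented_cover Pi] contains with [D] the second lift [D'] of [C]. So some
    [w] in [Omega] maps [D] to [D']; it preserves [C], but is not axial since axial elements
    preserve [D]. *)
Lemma orbit_not_cover : ~ rotational O2 C \/ ~ admissible Omega O2 C ->
  ~ exists P, topological_parallelism P /\ orbit_olines Omega D = oriented_cover P.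
Proof.
move=> H [Pi [[_ _ _ _] E]].
have DE : orbit_olines Omega D D.
  by exists (oneGL R); [exact: Om1|exact: GL_olines_image1].
have [C1 PC1 C1D] : oriented_cover Pi D by rewrite -E.
have C1C : C1 = C by rewrite -(over_image C1D) (over_image CD).
have [D' [DD' DD0 hD hD']] := CD.
have CD' := oriented_spread_over_compl DD' DD0 hD hD'.
have : orbit_olines Omega D D' by rewrite E; exists C => //; rewrite -C1C.
move=> [w Ow wD].
have wC : GL_line w @` C = C.
  rewrite -{1}(over_image CD) -[RHS](over_image CD') -wD !image_comp.
  by apply: eq_imagel.
have nw : ~ ax w.
  move=> aw; have [L [t [CL _ _ _]]] := nonaxial_stab.
  have [l Dl _] := over_lift CD CL.
  have : (D `&` D') l by split => //; rewrite -wD ax_image.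
  by rewrite DD0.
by case: H; apply; [exact: turn_rotational wC nw|exact: turn_admissible wC nw].
Qed.

End OrientedOrbit.

(** The element [t] of [nonaxial_stab] fixes a line of [C], so in a parallelism it would preserve
    [C]; not being axial, it would then provide both O(2)-properties. *)
Lemma orbit_not_parallelism : ~ rotational O2 C \/ ~ admissible Omega O2 C ->
  ~ topological_parallelism (orbit_lines Omega C).
Proof.
move=> H [_ tP _ _]; have [L [t [CL Ot tL nt]]] := nonaxial_stab.
have tC : GL_line t @` C = C.
  apply: tP; first by exists t.
    by exists (oneGL R); [exact: Om1|exact: GL_lines_image1].
  by exists L; split => //; exists L.
by case: H; apply; [exact: turn_rotational tC nt|exact: turn_admissible tC nt].
Qed.

(** It suffices that an [x] in [Omega] fixing a line [L] of [C] preserves [C]. If [x] fixes the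
    orientation of [L], it is axial. Otherwise [s], corrected by an axial [k], gives a [y] that
    preserves [C] and reverses [L] as well; then [x] differs from [y] by an axial element. *)
Lemma orbit_parallelism s : Om s -> GL_line s @` C = C -> ~ ax s ->
  compact [set g | Om g] -> topological_parallelism (orbit_lines Omega C).
Proof.
move=> Os sC ns cOm; have cC : compact C by case: ((compact_spreadP C).1 spC).
split.
- by move=> _ [g Og <-]; exact: compact_spread_GL.
- move=> _ _ [g Og <-] [g' Og' <-] [_ [[L CL <-] [L' CL' LL']]].
  pose w := mulGL (invGL g') g.
  have Ow : Om w by apply: OmM => //; exact: OmV.
  have wL : GL_line w L = L' by rewrite /w GL_lineM -LL' GL_lineK.
  suff wC : GL_line w @` C = C.
    by rewrite -[in RHS]wC -GL_lines_imageM /w mulGLA mulGLV mul1GL.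
  have [h ah hL] := orbit_ax CL CL' Ow wL.
  pose x := mulGL (invGL h) w.
  have Ox : Om x by apply: OmM => //; exact/OmV/axOm.
  have xL : GL_line x L = L by rewrite /x GL_lineM wL -hL GL_lineK.
  suff xC : GL_line x @` C = C.
    by rewrite -[w]mul1GL -(mulGLV h) -mulGLA GL_lines_imageM -/x xC axC.
  have [X bX] := line_basis L.
  pose l : oline R := OLine (ex_intro2 _ _ X bX (erefl (orientation_class _ X))).
  have [xl|xl] := pselect (GL_oline x l = l); first exact/axC/(stab_ax Ox _ xl).
  have CsL : C (GL_line s L) by rewrite -sC; exists L.
  have [k ak kL] := orbit_ax CL CsL Os erefl.
  pose y := mulGL (invGL k) s.
  have Oy : Om y by apply: OmM => //; exact/OmV/axOm.
  have yL : GL_line y L = L by rewrite /y GL_lineM -kL GL_lineK.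
  have yC : GL_line y @` C = C by rewrite /y GL_lines_imageM sC axC //; exact: axV.
  have yl : GL_oline y l <> l.
    move=> yl; apply: ns; have ay : ax y by exact: stab_ax yl.
    by rewrite -[s]mul1GL -(mulGLV k) -mulGLA; exact: axM.
  have xy : GL_oline y l = GL_oline x l by apply: (@oline_two _ _ l).
  have az : ax (mulGL (invGL y) x).
    apply: (@stab_ax _ l) => //; first by apply: OmM => //; exact: OmV.
    by rewrite GL_olineM -xy GL_olineK.
  by rewrite -[x]mul1GL -(mulGLV y) -mulGLA GL_lines_imageM axC.
- apply/seteqP; split => // L _; have [g Og CgL] := Om_covers L.
  exists (GL_line (invGL g) @` C); first by exists (invGL g) => //; exact: OmV.
  by exists (GL_line g L) => //; rewrite GL_lineK.
- exact: hypercompact_lines.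
Qed.

End Orbit.

(** ** Compact matrix groups *)

Section CompactMatrices.
Variable R : realType.

Lemma cvg_affine (T : Type) (F : set_system T) (FF : Filter F) (f : T -> R) (a b c : R) :
  f t @[t --> F] --> a -> (b * (f t - c)) @[t --> F] --> b * (a - c).
Proof. by move=> fa; apply: cvgM; [exact: cvg_cst|apply: cvgB => //; exact: cvg_cst]. Qed.

Lemma box_compact m n (b : R) : compact [set A : 'M[R]_(m, n) | forall i j, `|A i j| <= b].
Proof.
have c := @rV_compact R (m * n) (fun=> `[- b, b]%classic) (fun=> @segment_compact R (- b) b).
have cv : continuous (@vec_mx R m n).
  move=> v; apply: (@mx_cvg R _ _ (nbhs_filter v)) => i j.
  under eq_cvg do rewrite mxE; rewrite mxE; exact: coord_continuous.
have := continuous_compact (continuous_subspaceT cv) c.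
congr compact; apply/seteqP; split => [_ [v vb <-] i j|A Ab].
  by rewrite mxE; have := vb (mxvec_index i j); rewrite /= in_itv /= ler_norml.
exists (mxvec A); last exact: mxvecK.
move=> i; case/mxvec_indexP: i => i j /=.
by rewrite mxvecE in_itv /= -ler_norml.
Qed.

Lemma closed_le_family (T : topologicalType) (I : Type) (phi : I -> T -> R) :
  (forall i, continuous (phi i)) -> closed [set x | forall i, phi i x <= 0].
Proof.
move=> cphi; rewrite (_ : mkset _ = \bigcap_i (phi i @^-1` [set x | x <= 0])).
  apply: closed_bigI => i _; apply: closed_comp; last exact: closed_le.
  by move=> x _; exact: cphi.
by apply/seteqP; split => x H => [i _|i]; exact: H.
Qed.

Lemma compact_le m n (b : R) (I : Type) (phi : I -> 'M[R]_(m, n) -> R) :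
  (forall i, continuous (phi i)) ->
  (forall A, (forall i, phi i A <= 0) -> forall i j, `|A i j| <= b) ->
  compact [set A | forall i, phi i A <= 0].
Proof.
move=> cphi bd; apply: (subclosed_compact _ (@box_compact m n b) bd).
exact: closed_le_family.
Qed.

Lemma orth_entry n (A : 'M[R]_n) i j : A^T *m A = 1%:M -> `|A i j| <= 1.
Proof.
move=> /matrixP /(_ j j); rewrite !mxE eqxx (bigD1 i) //= !mxE => h.
rewrite -(expr_le1 (n := 2)) // real_normK ?num_real // expr2 -[leRHS]/(true%:R) -h lerDl.
by apply: sumr_ge0 => k _; rewrite mxE -expr2 sqr_ge0.
Qed.

Lemma special_orthogonal_compact n : compact (@special_orthogonal_group R n).
Proof.
(* Each equation becomes two inequalities, the boolean giving the sign; [None] stands for the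
   determinant. *)
pose phi (s : bool * option ('I_n * 'I_n)) (A : 'M[R]_n) : R :=
  (-1) ^+ s.1 * (if s.2 is Some ij then (A^T *m A) ij.1 ij.2 - (1%:M : 'M[R]_n) ij.1 ij.2 else \det A - 1).
have phiP A : (forall s, phi s A <= 0) <-> special_orthogonal_group A.
  split=> [H|[AA dA] [b [[i j]|]]]; last 2 first.
  - by rewrite /phi /= AA subrr mulr0.
  - by rewrite /phi /= dA subrr mulr0.
  have E x : phi (true, x) A <= 0 -> phi (false, x) A <= 0 -> phi (false, x) A = 0.
    rewrite /phi /= expr0 mul1r expr1 mulN1r oppr_le0 => a b.
    by apply/eqP; rewrite eq_le a b.
  split.
    apply/matrixP => i j; apply/eqP; rewrite -subr_eq0.
    by have := E (Some (i, j)) (H _) (H _); rewrite /phi /= expr0 mul1r => ->.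
  have := E None (H _) (H _); rewrite /phi /= expr0 mul1r => /eqP.
  by rewrite subr_eq0 => /eqP.
rewrite (_ : @special_orthogonal_group R n = [set A | forall s, phi s A <= 0]); last first.
  by apply/seteqP; split => A /phiP.
apply: (@compact_le _ _ 1) => [[b x]|A /phiP[AA _] i j]; last exact: orth_entry.
have FF := nbhs_filter; move=> A; rewrite /phi /=.
have cT : (B : 'M[R]_n)^T @[B --> A] --> A^T.
  apply: (@mx_cvg R _ _ (nbhs_filter A)) => k l; under eq_cvg do rewrite mxE; rewrite mxE.
  exact: coord_continuous.
have c1 : (B : 'M[R]_n)^T *m B @[B --> A] --> A^T *m A.
  exact: (@mulmx_cvg R _ (nbhs A) _ _ _ _ (fun B => B^T) id _ _ cT cvg_id).
case: x => [[i j]|] /=; last first.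
  have c2 : \det B @[B --> A] --> \det A by exact: (@det_cvg R _ (nbhs A) _ _ id A cvg_id).
  exact: cvg_affine c2.
have c2 := cvg_comp _ (fun X : 'M[R]_n => X i j) c1 (@coord_continuous R _ _ i j _).
exact: (@cvg_affine _ _ (nbhs_filter A) _ _ ((-1) ^+ b) ((1%:M : 'M[R]_n) i j) c2).
Qed.

Lemma iso_compact m n (G : set 'M[R]_m) (H : set 'M[R]_n) :
  topological_group_iso G H -> compact H -> compact G.
Proof.
move=> [f [[[fGH iG sG] _ [k [ck kK]]] _]] cH.
rewrite (_ : G = k @` H); first exact: continuous_compact.
apply/seteqP; split=> [A GA|_ [B HB <-]].
  by exists (f A); [exact: fGH|rewrite kK ?inE].
by have [A GA <-] := sG _ HB; rewrite kK ?inE.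
Qed.

Lemma compact_GL (Omega : set 'M[R]_4) : Omega `<=` [set A | A \in unitmx] ->
  compact Omega -> compact [set g : GL4 R | Omega (mx_of_GL g)].
Proof.
move=> Ou cO.
(* The value [oneGL] outside the unit group is a default; only the values on [Omega] matter. *)
pose k (A : 'M[R]_4) : GL4 R := if pselect (A \in unitmx) is left uA then mkGL uA else oneGL R.
have kE A : Omega A -> mx_of_GL (k A) = A.
  by move=> OA; rewrite /k; case: pselect => // /(_ (Ou _ OA)).
rewrite (_ : mkset _ = k @` Omega); last first.
  apply/seteqP; split=> [g Og|_ [A OA <-]]; last by rewrite /mkset kE.
  by exists (mx_of_GL g) => //; apply: GL_inj; exact: kE.
apply: continuous_compact => //; apply/subspace_continuousP => A OA.
suff kA : mx_of_GL (k B) @[B --> within Omega (nbhs A)] --> mx_of_GL (k A).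
  exact: cvg_GL kA.
rewrite kE // => U nU; rewrite nbhs_simpl /within /=.
by apply: filterS nU => B UB OB; change (U (mx_of_GL (k B))); rewrite kE.
Qed.

Lemma compact_entries_bounded m n (A : set 'M[R]_(m, n)) : compact A ->
  exists2 c : R, 0 < c & forall G i j, A G -> `|G i j| <= c.
Proof.
move=> cA; have [M [Mr MA]] := compact_bounded cA.
exists (`|M| + 1); first by rewrite ltr_pwDr.
move=> G i j AG; have := MA (`|M| + 1) _ G AG.
rewrite (le_lt_trans (ler_norm M)) ?ltrDl // => /(_ isT).
apply: le_trans; rewrite [leRHS]/Num.norm /= mx_normrE.
by apply/bigmax_geP; right; exists (i, j).
Qed.

End CompactMatrices.

(** * An invariant positive definite form and its Cholesky factor *)

Section InvariantForm.
Variable R : realType.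

(** The Frobenius norm is squared here, so that the parallelogram law [fnorm_midpoint] holds. *)
Definition fnorm m n (A : 'M[R]_(m, n)) : R := \sum_i \sum_j A i j ^+ 2.

Lemma fnorm_ge0 m n (A : 'M[R]_(m, n)) : 0 <= fnorm A.
Proof. by apply: sumr_ge0 => i _; apply: sumr_ge0 => j _; exact: sqr_ge0. Qed.

Lemma fnorm_entry m n (A : 'M[R]_(m, n)) i j : A i j ^+ 2 <= fnorm A.
Proof.
rewrite /fnorm (bigD1 i) //= (bigD1 j) //= -addrA lerDl addr_ge0 //.
  by apply: sumr_ge0 => k _; exact: sqr_ge0.
by apply: sumr_ge0 => k _; apply: sumr_ge0 => l _; exact: sqr_ge0.
Qed.

Lemma fnorm_eq0 m n (A : 'M[R]_(m, n)) : fnorm A <= 0 -> A = 0.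
Proof.
move=> A0; apply/matrixP => i j; rewrite mxE; apply/eqP; rewrite -sqrf_eq0 eq_le sqr_ge0 andbT.
exact: le_trans (fnorm_entry A i j) A0.
Qed.

Lemma fnorm_tr m n (A : 'M[R]_(m, n)) : fnorm A^T = fnorm A.
Proof.
rewrite /fnorm exchange_big /=; apply: eq_bigr => i _; apply: eq_bigr => j _.
by rewrite mxE.
Qed.

Lemma fnorm_midpoint m n (A B : 'M[R]_(m, n)) :
  fnorm (2^-1 *: (A + B)) = (fnorm A + fnorm B) / 2 - fnorm (A - B) / 4.
Proof.
rewrite /fnorm -big_split /= !mulr_suml -sumrN -big_split /=; apply: eq_bigr => i _.
rewrite -big_split /= !mulr_suml -sumrN -big_split /=; apply: eq_bigr => j _.
by rewrite !mxE; field.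
Qed.

Lemma fnorm_mull (c : R) m n p (A : 'M[R]_(m, n)) (B : 'M[R]_(n, p)) :
  0 <= c -> (forall i j, `|A i j| <= c) ->
  fnorm (A *m B) <= (m%:R * p%:R * (n%:R * c) ^+ 2) * fnorm B.
Proof.
move=> c0 Ac; pose b := Num.sqrt (fnorm B); have b0 : 0 <= b by exact: sqrtr_ge0.
have bb : b ^+ 2 = fnorm B by rewrite sqr_sqrtr // fnorm_ge0.
have Bb i j : `|B i j| <= b.
  by rewrite -ler_sqr ?nnegrE // bb real_normK ?num_real // fnorm_entry.
have e i j : (A *m B) i j ^+ 2 <= (n%:R * c) ^+ 2 * fnorm B.
  rewrite -bb -exprMn -(real_normK (num_real _)) ler_sqr ?nnegrE //; last first.
    by rewrite !mulr_ge0.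
  rewrite mxE; apply: (le_trans (ler_norm_sum _ _ _)).
  apply: (@le_trans _ _ (\sum_(k < n) (c * b))).
    by apply: ler_sum => k _; rewrite normrM ler_pM.
  by rewrite sumr_const card_ord -[leLHS]mulr_natl mulrA.
apply: (@le_trans _ _ (\sum_(i < m) \sum_(j < p) ((n%:R * c) ^+ 2 * fnorm B))).
  by apply: ler_sum => i _; apply: ler_sum => j _; exact: e.
rewrite !sumr_const !card_ord -mulrnA -[leLHS]mulr_natl natrM [p%:R * _]mulrC.
by rewrite !mulrA.
Qed.

Lemma fnorm_cvg (T : Type) (F : set_system T) (FF : Filter F) m n
    (f : T -> 'M[R]_(m, n)) (A : 'M[R]_(m, n)) :
  f t @[t --> F] --> A -> fnorm (f t) @[t --> F] --> fnorm A.
Proof.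
move=> fA; have fij i j : f t i j @[t --> F] --> A i j.
  by apply: (cvg_comp f (fun X : 'M[R]_(m, n) => X i j) fA); exact: coord_continuous.
rewrite /fnorm; apply: cvg_big; first exact: add_continuous.
move=> i _; apply: cvg_big; first exact: add_continuous.
by move=> j _; rewrite expr2; under eq_cvg do rewrite expr2; exact: cvgM.
Qed.

Variables (n : nat) (Om : set 'M[R]_n) (c : R).
Hypothesis OmU : Om `<=` [set G | G \in unitmx].
Hypothesis Om1 : Om 1%:M.
Hypothesis OmM : forall G H, Om G -> Om H -> Om (G *m H).
Hypothesis OmV : forall G, Om G -> Om (invmx G).
Hypothesis c0 : 0 < c.
Hypothesis Omc : forall G i j, Om G -> `|G i j| <= c.

Let act (G S : 'M[R]_n) := G^T *m S *m G.

Let actM G H S : act G (act H S) = act (H *m G) S.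
Proof. by rewrite /act trmx_mul !mulmxA. Qed.

Let q (S : 'M[R]_n) (x : 'cV[R]_n) : R := (x^T *m S *m x) 0 0.

Let q_act G S x : q (act G S) x = q S (G *m x).
Proof. by rewrite /q /act trmx_mul !mulmxA. Qed.

Let bound_act : exists2 K : R, 0 < K & forall G S, Om G -> fnorm (act G S) <= K * fnorm S.
Proof.
pose k : R := n%:R * n%:R * (n%:R * c) ^+ 2.
have k0 : 0 <= k by apply: mulr_ge0; [apply: mulr_ge0|exact: sqr_ge0]; exact: ler0n.
(* The summand 1 keeps the constant positive also for [n = 0]. *)
exists (k * k + 1); first by rewrite ltr_wpDl // mulr_ge0.
move=> G S OG; rewrite mulrDl mul1r -[leLHS]addr0 lerD ?fnorm_ge0 //.
rewrite /act -fnorm_tr trmx_mul.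
have Gt i j : `|G^T i j| <= c by rewrite mxE; exact: Omc.
apply: (le_trans (fnorm_mull _ (ltW c0) Gt)).
rewrite -/k -mulrA ler_wpM2l // fnorm_tr.
exact: (fnorm_mull _ (ltW c0) Gt).
Qed.

Let bound_vec : exists2 k : R, 0 < k & forall G x, Om G -> k * fnorm x <= fnorm (G *m x : 'cV[R]_n).
Proof.
pose k : R := n%:R * 1%:R * (n%:R * c) ^+ 2.
have k0 : 0 <= k by apply: mulr_ge0; [apply: mulr_ge0|exact: sqr_ge0]; exact: ler0n.
have k1 : 0 < k + 1 by rewrite ltr_wpDl.
exists (k + 1)^-1; first by rewrite invr_gt0.
move=> G x OG; rewrite ler_pdivrMl //.
have := fnorm_mull (G *m x) (ltW c0) (fun i j => Omc i j (OmV OG)).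
rewrite mulKmx; last exact: OmU.
by move=> /le_trans; apply; rewrite -/k mulrDl lerDl mul1r fnorm_ge0.
Qed.

(* A minimizer of [S |-> sup_G fnorm (act G S)] is invariant: otherwise the
   midpoint of two of its images would do better, by the parallelogram law.  The
   constraint [k] keeps the minimizer positive definite. *)
Lemma invariant_form : exists S : 'M[R]_n, [/\ S^T = S,
  forall x, x != 0 -> 0 < q S x & forall G, Om G -> act G S = S].
Proof.
have [K K0 bK] := bound_act; have [k k0 bk] := bound_vec.
(* The lower bound is imposed on all images of [S] at once, so that [SS] is invariant under [Om] and
   closed under midpoints; the identity satisfies it by the choice of [k]. *)
pose SS : set 'M[R]_n := [set S | S^T = S /\ forall G x, Om G -> k * fnorm x <= q (act G S) x].
pose lev (r : R) := [set S | SS S /\ forall G, Om G -> fnorm (act G S) <= r].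
have q1 x : q 1%:M x = fnorm x.
  rewrite /q mulmx1 mxE /fnorm; apply: eq_bigr => i _.
  by rewrite big_ord1 mxE expr2.
have S1 : SS 1%:M.
  by split; [rewrite trmx1|move=> G x OG; rewrite q_act q1; exact: bk].
have SSact G S : Om G -> SS S -> SS (act G S).
  move=> OG [St Sq]; split; first by rewrite /act !trmx_mul St trmxK mulmxA.
  by move=> H x OH; rewrite actM; apply: Sq; exact: OmM.
have qmid S T x : q (2^-1 *: (S + T)) x = (q S x + q T x) / 2.
  by rewrite /q -scalemxAr -scalemxAl mulmxDr mulmxDl !mxE mulrC.
have actmid G S T : act G (2^-1 *: (S + T)) = 2^-1 *: (act G S + act G T).
  by rewrite /act -scalemxAr -scalemxAl mulmxDr mulmxDl.
have SSmid S T : SS S -> SS T -> SS (2^-1 *: (S + T)).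
  move=> [St Sq] [Tt Tq]; split; first by rewrite linearZ /= linearD /= St Tt.
  move=> G x OG; rewrite actmid qmid ler_pdivlMr // mulr_natr mulr2n.
  by apply: lerD; [exact: Sq|exact: Tq].
pose levels := [set r : R | lev r !=set0].
have hl : has_inf levels.
  split; first by exists (K * fnorm (1%:M : 'M[R]_n)), 1%:M; split => // G; exact: bK.
  by exists 0 => r [S [_ Sr]]; apply: le_trans (Sr _ Om1); exact: fnorm_ge0.
pose m := inf levels.
have clev r : compact (lev r).
  (* The conditions defining [lev r] as inequalities: symmetry, lower bounds, norm bounds. Matrices
     outside [Om] get the void condition [0 <= 0]. *)
  pose phi (i : 'I_n * 'I_n + (('M[R]_n * 'cV[R]_n) + 'M[R]_n)) (S : 'M[R]_n) : R :=
    match i with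
    | inl ij => S ij.1 ij.2 - S ij.2 ij.1
    | inr (inl Gx) => if pselect (Om Gx.1) then (-1) * (q (act Gx.1 S) Gx.2 - k * fnorm Gx.2) else 0
    | inr (inr G) => if pselect (Om G) then 1 * (fnorm (act G S) - r) else 0
    end.
  rewrite (_ : lev r = [set S | forall i, phi i S <= 0]).
    apply: (@compact_le R n n (Num.sqrt `|r|)).
      have cact G (A : 'M[R]_n) : act G S @[S --> A] --> act G A.
        apply: (cvg_comp (fun S => G^T *m S) (fun S => S *m G)).
          exact: mulmx_continuousr.
        exact: mulmx_continuousl.
      move=> [[i j]|[[G x]|G]] A; rewrite /phi /=.
      - exact: (cvgB (@coord_continuous R _ _ i j A) (@coord_continuous R _ _ j i A)).
      - case: pselect => [OG /=|nG /=]; last exact: (@cvg_cst R 0 _ _ (nbhs_filter A)).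
        have c1 := cvg_comp _ (fun S => x^T *m S) (cact G A) (@mulmx_continuousr R _ _ _ _ _).
        have c2 := cvg_comp _ (fun S => S *m x) c1 (@mulmx_continuousl R _ _ _ _ _).
        have c3 := cvg_comp _ (fun X : 'M[R]_1 => X 0 0) c2 (@coord_continuous R _ _ _ _ _).
        exact: (@cvg_affine _ _ _ (nbhs_filter A) _ _ (-1) _ c3).
      - case: pselect => [OG /=|nG /=]; last exact: (@cvg_cst R 0 _ _ (nbhs_filter A)).
        have c1 := fnorm_cvg (nbhs_filter A) (cact G A).
        exact: (@cvg_affine _ _ _ (nbhs_filter A) _ _ 1 _ c1).
    move=> S H i j; have := H (inr (inr 1%:M)); rewrite /phi; case: pselect => [_ /=|//].
    rewrite mul1r subr_le0 /act trmx1 mul1mx mulmx1 => Sr.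
    rewrite -ler_sqr ?nnegrE ?sqrtr_ge0 // sqr_sqrtr ?normr_ge0 // real_normK ?num_real //.
    by rewrite (le_trans (fnorm_entry S i j)) // (le_trans Sr) // ler_norm.
  apply/seteqP; split => [S [[St Sq] Sr] [[i j]|[[G x]|G]]|S H].
  - by rewrite /phi /= -{1}St mxE subrr.
  - by rewrite /phi /=; case: pselect => [OG /=|//]; rewrite mulN1r oppr_le0 subr_ge0; exact: Sq.
  - by rewrite /phi /=; case: pselect => [OG /=|//]; rewrite mul1r subr_le0; exact: Sr.
  split; [split|].
  - apply/matrixP => i j; rewrite mxE; apply/eqP; rewrite eq_le.
    have := H (inl (i, j)); have := H (inl (j, i)); rewrite /phi /= !subr_le0.
    by move=> -> ->.
  - move=> G x OG; have := H (inr (inl (G, x))); rewrite /phi /=; case: pselect => [_ /=|//].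
    by rewrite mulN1r oppr_le0 subr_ge0.
  - move=> G OG; have := H (inr (inr G)); rewrite /phi /=; case: pselect => [_ /=|//].
    by rewrite mul1r subr_le0.
have [T levT] : exists T, forall e, 0 < e -> lev (m + e) T.
  pose F := filter_from [set e : R | 0 < e] (fun e => lev (m + e)).
  have mono e e' : e <= e' -> lev (m + e) `<=` lev (m + e').
    by move=> ee S [SS' Sr]; split => // G OG; apply: le_trans (Sr G OG) _; rewrite lerD2l.
  have FF : ProperFilter F.
    apply: filter_from_proper.
      apply: filter_from_filter; first by exists 1 => /=.
      move=> e e' /= e0 e'0; exists (Order.min e e'); first by rewrite /= lt_min e0.
      by move=> S eS; split; apply: mono eS; rewrite ge_min lexx ?orbT.
    move=> e /= e0; have [r [S [SS' Sr]] re] := inf_adherent e0 hl.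
    by exists S; split => // G OG; apply: (le_trans (Sr G OG)); exact: ltW.
  have [|T [_ Tc]] := clev (m + 1) F FF; first by exists 1 => /=.
  exists T => e e0; have cl : closed (lev (m + e)).
    by apply: compact_closed (clev _); exact: norm_hausdorff.
  apply: cl => B nB; have : F (lev (m + e)) by exists e.
  by move=> FL; exact: Tc.
have [SST _] := levT 1 ltr01.
have Tm G : Om G -> fnorm (act G T) <= m.
  move=> OG; apply/ler_addgt0Pr => e e0; have [_] := levT e e0; exact.
exists T; split; first by case: SST.
  move=> x x0; have [_ /(_ 1%:M x Om1)] := SST.
  rewrite /act trmx1 mul1mx mulmx1; apply: lt_le_trans; rewrite mulr_gt0 //.
  rewrite lt_neqAle fnorm_ge0 andbT eq_sym; apply: contra_neq x0 => x0.
  by apply: fnorm_eq0; rewrite x0.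
move=> H OH; apply/eqP; rewrite -subr_eq0; apply/eqP/fnorm_eq0; rewrite leNgt.
apply/negP => d0; set d := fnorm _ in d0.
pose U := 2^-1 *: (act H T + T).
(* By the parallelogram law the midpoint gains a quarter of the squared distance between the two
   images, which is at least [d / K] by [bK] for the inverse of [G]. *)
have : levels (m - d / (4 * K)).
  exists U; split; first by apply: SSmid => //; exact: SSact.
  move=> G OG; rewrite actmid fnorm_midpoint; apply: lerB.
    rewrite ler_pdivrMr // mulr_natr mulr2n lerD ?Tm // actM; apply: Tm; exact: OmM.
  rewrite invfM mulrA mulrAC ler_pM2r ?invr_gt0 // ler_pdivrMr // mulrC.
  have -> : act G (act H T) - act G T = act G (act H T - T).
    by rewrite /act mulmxBr mulmxBl.
  have := bK (invmx G) (act G (act H T - T)) (OmV OG).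
  by rewrite actM mulmxV ?OmU // /act trmx1 mul1mx mulmx1.
move=> /(ge_inf hl.2); rewrite -/m leNgt ltrBlDr ltrDl divr_gt0 // mulr_gt0 //.
Qed.

End InvariantForm.

(** Induction by Schur complements. The triangular shape matters as much as the factorization: such
    a [P] maps the plane at infinity to itself, so the change of coordinates stays affine. *)
Lemma cholesky (R : realType) n (S : 'M[R]_n) : S^T = S ->
  (forall x : 'cV[R]_n, x != 0 -> 0 < (x^T *m S *m x) 0 0) ->
  exists P : 'M[R]_n, [/\ P \in unitmx, S = P^T *m P &
    forall i j : 'I_n, (j < i)%N -> P i j = 0].
Proof.
elim: n S => [|n IH] S St Sp.
  exists 1%:M; split; [exact: unitmx1|by rewrite [S]flatmx0 [RHS]flatmx0|by case].
change ('M[R]_(1 + n)) in S.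
change (exists P : 'M[R]_(1 + n), [/\ P \in unitmx, S = P^T *m P &
  forall i j : 'I_(1 + n), (j < i)%N -> P i j = 0]).
pose a := (ulsubmx S) 0 0; pose b := ursubmx S.
pose D := drsubmx S.
have bt : dlsubmx S = b^T by rewrite /b trmx_ursub St.
have SE : S = block_mx a%:M b b^T D by rewrite -bt -mx11_scalar submxK.
have Sx (u : 'cV[R]_1) (y : 'cV[R]_n) : (col_mx u y)^T *m S *m col_mx u y =
    u^T *m (a%:M *m u + b *m y) + y^T *m (b^T *m u + D *m y).
  by rewrite SE -mulmxA mul_block_col tr_col_mx mul_row_col.
have a0 : 0 < a.
  have := Sp (col_mx (1%:M : 'M[R]_1) (0 : 'cV[R]_n)); rewrite Sx !mulmx0 !mulmx1 addr0 trmx0 mul0mx addr0.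
  rewrite trmx1 mul1mx mxE mulr1n; apply.
  apply/eqP => /(congr1 (@usubmx R 1 n 1)); rewrite col_mxKu => /matrixP /(_ 0 0).
  by rewrite !mxE => /eqP; rewrite oner_eq0.
pose r := Num.sqrt a; have r0 : 0 < r by rewrite sqrtr_gt0.
have rr : r * r = a by rewrite -expr2 sqr_sqrtr // ltW.
pose D' := D - a^-1 *: (b^T *m b).
have [||P' [uP' DP' tP']] := IH D'.
- by rewrite /D' linearB linearZ /= trmx_mul trmxK; congr (_ - _); rewrite /D trmx_drsub St.
(* This [u] minimizes the form for given [y]; the minimum is the value of the Schur complement [D']
   at [y]. *)
- move=> y y0; pose u := - (a^-1 *: (b *m y)).
  have := Sp (col_mx u y); rewrite Sx.
  have -> : a%:M *m u + b *m y = 0.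
    by rewrite mul_scalar_mx /u scalerN scalerA divff ?scale1r ?addNr // gt_eqF.
  rewrite mulmx0 add0r; have -> : b^T *m u + D *m y = D' *m y.
    by rewrite /D' /u mulmxBl mulmxN -scalemxAr -scalemxAl mulmxA addrC.
  rewrite mulmxA; apply; apply: contra_neq y0 => /(congr1 (@dsubmx R 1 n 1)).
  by rewrite col_mxKd => ->; apply/colP => i; rewrite !mxE.
pose P : 'M[R]_(1 + n) := block_mx r%:M (r^-1 *: b) 0 P'; exists P; split.
- by rewrite unitmxE /P (@det_ublock R 1 n) det_scalar1 unitrM -unitmxE uP' andbT unitfE gt_eqF.
- rewrite /P tr_block_mx mulmx_block tr_scalar_mx trmx0 !mulmx0 !mul0mx !addr0.
  rewrite SE; congr block_mx.
  + by rewrite -scalar_mxM rr.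
  + by rewrite mul_scalar_mx scalerA divff ?scale1r // gt_eqF.
  + by rewrite mul_mx_scalar linearZ /= scalerA divff ?scale1r // gt_eqF.
  + rewrite -DP' -scalemxAr [(_ *: b)^T]linearZ /= -scalemxAl scalerA -invfM rr /D'.
    by rewrite addrC subrK.
- move=> i j; case: (split_ordP i) => i' ->; case: (split_ordP j) => j' -> ji.
  + by move: ji; rewrite /= !ord1.
  + by move: ji; rewrite /= ord1.
  + by rewrite /P block_mxEdl mxE.
  + by rewrite /P block_mxEdr; apply: tP'; move: ji; rewrite /= ltn_add2l.
Qed.

(** ** Coordinates adapted to Omega *)

Section RotationGroups.
Variable R : realType.
Local Notation V := 'cV[R]_4.
Implicit Types (G : 'M[R]_4) (X : 'M[R]_3) (g h : GL4 R).

Definition up3 X : 'M[R]_4 := (block_mx X 0 0 1%:M : 'M[R]_(3 + 1)).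

Lemma up3M X Y : up3 (X *m Y) = up3 X *m up3 Y.
Proof.
rewrite /up3 -[RHS]/((_ : 'M[R]_(3 + 1)) *m (_ : 'M[R]_(3 + 1))) mulmx_block.
by rewrite !mulmx0 !mul0mx mulmx1 !addr0 add0r.
Qed.

Lemma up3_inj : injective up3.
Proof. by move=> X Y /(congr1 (@ulsubmx R 3 1 3 1)); rewrite !block_mxKul. Qed.

Lemma up3_tr X : (up3 X)^T = up3 X^T.
Proof. by rewrite /up3 (@tr_block_mx R 3 1 3 1) !trmx0 trmx1. Qed.

Lemma up3_1 : up3 1%:M = 1%:M.
Proof. by rewrite /up3 -scalar_mx_block. Qed.

Lemma e4_row G : (forall j, G i3 j = (j == i3)%:R) -> G^T *m e4 R = e4 R.
Proof.
move=> G3; apply/colP => j; rewrite mxE sum4 !mxE /= !mulr0 !add0r mulr1 G3.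
by move: j; apply: ord4P.
Qed.

Lemma up3_SO3e X : special_orthogonal_group X -> SO3e (up3 X).
Proof.
move=> [XX dX]; split.
- by rewrite up3_tr -up3M XX up3_1.
- apply: e4_row => j; have -> : i3 = rshift 3 (@ord0 0) by exact: val_inj.
  rewrite /up3; case: (split_ordP (j : 'I_(3 + 1))) => k ->.
    by rewrite (block_mxEdl X 0 0 1%:M) mxE; case: eqP => // /(congr1 val) /=;
      case: k => k /= lk e; move: lk; rewrite e.
  by rewrite (block_mxEdr X 0 0 1%:M) !mxE !ord1 !eqxx.
- by rewrite /up3 (@det_ublock R 3 1) det1 mulr1.
Qed.

Lemma SO3e_up3 G : SO3e G -> exists2 X, special_orthogonal_group X & G = up3 X.
Proof.
move=> sG; have [GG G4 dG] := sG.
have [g sg gG] := SO3e_mx GG G4 dG.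
have Ge4 : G *m e4 R = e4 R by rewrite -gG so_e4.
have G4' j := congr1 (fun v : V => v j 0) G4.
have Ge4' j := congr1 (fun v : V => v j 0) Ge4.
have I3 : rshift 3 (0 : 'I_1) = i3 by exact: val_inj.
have ur : ursubmx (G : 'M[R]_(3 + 1)) = 0.
  apply/matrixP => i j; rewrite !mxE ord1 I3.
  have := Ge4' (lshift 1 i); rewrite !mxE sum4 !mxE /= !mulr0 !add0r mulr1 => ->.
  by case: i => -[|[|[|//]]].
have dl : dlsubmx (G : 'M[R]_(3 + 1)) = 0.
  apply/matrixP => i j; rewrite !mxE ord1 I3.
  have := G4' (lshift 1 j); rewrite !mxE sum4 !mxE /= !mulr0 !add0r mulr1 => ->.
  by case: j => -[|[|[|//]]].
have dr : drsubmx (G : 'M[R]_(3 + 1)) = 1%:M.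
  apply/matrixP => i j; rewrite !mxE !ord1 I3.
  by have := G4' i3; rewrite !mxE sum4 !mxE /= !mulr0 !add0r mulr1 => ->.
have GE : G = up3 (ulsubmx (G : 'M[R]_(3 + 1))).
  by rewrite -[LHS](@submxK R 3 1 3 1) ur dl dr.
exists (ulsubmx (G : 'M[R]_(3 + 1))) => //; split.
  by apply: up3_inj; rewrite up3M -up3_tr -GE GG up3_1.
by move: dG; rewrite {1}GE /up3 (@det_ublock R 3 1) det1 mulr1.
Qed.

(* Euler: 1 is an eigenvalue, because [det (X - 1) = - det (X - 1)]. *)
Lemma SO3e_axis G : SO3e G -> exists e : V, [/\ e i3 0 = 0, normsq e = 1 & G *m e = e].
Proof.
move=> sG; have [X [XX dX] GX] := SO3e_up3 sG.
have XX' : X^T *m (X - 1%:M) = (-1) *: (X - 1%:M)^T.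
  by rewrite scaleN1r mulmxBr XX mulmx1 linearB /= trmx1 opprB.
have d0 : \det (X - 1%:M) = 0.
  have := congr1 determinant XX'; rewrite det_mulmx det_tr dX mul1r detZ det_tr.
  rewrite -signr_odd /= expr1 mulN1r => h; apply/eqP.
  by rewrite -[_ == 0](mulrn_eq0 _ 2) mulr2n {1}h addNr.
have /det0P[v v0 vX] : \det (X - 1%:M)^T == 0 by rewrite det_tr d0.
have Xv : X *m v^T = v^T.
  move/(congr1 trmx) : vX; rewrite trmx_mul trmxK trmx0 mulmxBl mul1mx => /eqP.
  by rewrite subr_eq0 => /eqP.
pose w : V := (col_mx v^T 0 : 'cV[R]_(3 + 1)).
have w3 : w i3 0 = 0.
  have -> : i3 = rshift 3 (@ord0 0) by exact: val_inj.
  by rewrite /w (@col_mxEd R 3 1) mxE.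
have w0 : w != 0.
  apply: contra_neq v0 => /(congr1 (@usubmx R 3 1 1)); rewrite col_mxKu => h.
  by apply: trmx_inj; rewrite h trmx0; apply/colP => i; rewrite !mxE.
have Gw : G *m w = w.
  rewrite GX /up3 /w -[LHS]/((_ : 'M[R]_(3 + 1)) *m (_ : 'cV[R]_(3 + 1))) mul_block_col.
  by rewrite Xv !mul0mx mulmx0 addr0 add0r.
have [s [s0 _ ns]] := normalize w3 w0; exists (s^-1 *: w); split => //.
  by rewrite mxE w3 mulr0.
by rewrite -scalemxAr Gw.
Qed.

Lemma axial_square g : axial g -> exists2 h, axial h & g = mulGL h h.
Proof.
move=> /axialE[u [v [uv gE]]]; have [u' [v' [uv' uE vE]]] := half_angle uv.
have [h ah hE] := Rz_axial uv'; exists h => //.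
by apply: GL_inj; rewrite gE mkGLE hE RzM uE vE.
Qed.

(** Euler angles: [g] is the product of an axial rotation [a], a tilt [Q] about the first axis that
    brings [e3] to the height of its image under [g], and a further axial rotation. Each factor is a
    square by bisecting its angle. *)
Lemma so_squares g : so g -> exists a b c, [/\ so a, so b, so c &
  g = mulGL (mulGL a a) (mulGL (mulGL b b) (mulGL c c))].
Proof.
move=> sg; set p := mx_of_GL g *m e3 R.
have p3 : p i3 0 = 0 by rewrite so_weight // hvecs.
have pn : hor p + p i2 0 ^+ 2 = 1.
  rewrite -normsq_hor so_normsq // /normsq !hvecs; ring.
pose s := Num.sqrt (hor p); have ss : s ^+ 2 = hor p by rewrite sqr_sqrtr // hor_ge0.
have [a aa aE] : exists2 a, axial a & forall z w : R,
    mx_of_GL a *m hvec 0 s z w = hvec (p i0 0) (p i1 0) z w.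
  by apply: axial_ex; rewrite ss expr0n add0r.
have [|||||k [sk k1 k2]] := @so_frame R (e2 R) (e3 R); rewrite ?hvecs //.
- by rewrite /normsq !hvecs; ring.
- by rewrite /normsq !hvecs; ring.
- by rewrite dotE !hvecs; ring.
have [b ab bE] : exists2 b, axial b & mx_of_GL b = Rz (p i2 0) (- s).
  by apply: Rz_axial; rewrite sqrrN ss addrC.
have [b' ab' bb'] := axial_square ab; have [a' aa' aa''] := axial_square aa.
pose Q := mulGL k (mulGL b (invGL k)).
have kV : mx_of_GL (invGL k) *m e3 R = e2 R.
  by rewrite mkGLE -k2 mulKmx // mx_of_GL_unit.
have Q3 : mx_of_GL Q *m e3 R = hvec 0 s (p i2 0) 0.
  rewrite 2!mkGLE -!mulmxA kV bE Rz_hvec.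
  have -> : hvec (p i2 0 * 0 - - s * 1) (- s * 0 + p i2 0 * 1) 0 0 =
    s *: e1 R + p i2 0 *: e2 R by rewrite !hvecZ hvecD; congr hvec; ring.
  by rewrite mulmxDr -!scalemxAr k1 k2 !hvecZ hvecD; congr hvec; ring.
have sQ : so Q.
  by apply: so_mul => //; apply: so_mul; [case: ab|exact: so_inv].
have aQ3 : mx_of_GL (mulGL a Q) *m e3 R = p.
  by rewrite mkGLE -mulmxA Q3 aE [RHS]hvecK p3.
have sa : so a by case: aa.
have ac : axial (mulGL (invGL (mulGL a Q)) g).
  split; first by apply: so_mul => //; apply: so_inv; exact: so_mul.
  by rewrite mkGLE -mulmxA -/p -aQ3 mkGLE mulKmx // mx_of_GL_unit.
have [c' ac' cc'] := axial_square ac.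
exists a', (mulGL k (mulGL b' (invGL k))), c'; split.
- by case: aa'.
- by apply: so_mul => //; apply: so_mul; [case: ab'|exact: so_inv].
- by case: ac'.
rewrite -cc' -aa''; have -> : mulGL (mulGL k (mulGL b' (invGL k)))
    (mulGL k (mulGL b' (invGL k))) = Q.
  by rewrite /Q bb' -!mulGLA (mulGLA (invGL k)) mulVGL mul1GL.
by rewrite mulGLA mulGLA mulGLV mul1GL.
Qed.

(* A subgroup of SO(3) containing all rotations about the [z]-axis is a union of
   their double cosets, which are described by the cosine [c] of the angle by
   which the axis is tilted; conjugates of rotations provide all tilts with
   cosine in [[2 c ^ 2 - 1, 1]]. *)
Lemma so_generated (K : set (GL4 R)) : K `<=` @so R ->
  (forall g h, K g -> K h -> K (mulGL g h)) -> (forall g, K g -> K (invGL g)) ->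
  @axial R `<=` K ->
  (exists g, [/\ K g, mx_of_GL g *m e3 R <> e3 R & mx_of_GL g *m e3 R <> - e3 R]) ->
  @so R `<=` K.
Proof.
move=> Kso KM KV Kax [g0 [Kg0 g0p g0n]].
pose I := [set x : R | exists2 g, K g & (mx_of_GL g *m e3 R) i2 0 = x].
have nrm g : so g -> hor (mx_of_GL g *m e3 R) + (mx_of_GL g *m e3 R) i2 0 ^+ 2 = 1.
  by move=> sg; rewrite -normsq_hor so_normsq // /normsq !hvecs; ring.
have wt g : so g -> (mx_of_GL g *m e3 R) i3 0 = 0 by move=> sg; rewrite so_weight // hvecs.
have double c : I c -> c ^+ 2 < 1 -> forall c', 2 * c ^+ 2 - 1 <= c' <= 1 -> I c'.
  move=> [k Kk kc] c1 c' /andP[cl cu]; have sk := Kso _ Kk.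
  have d0 : 0 < 1 - c ^+ 2 by rewrite subr_gt0.
  (* A rotation with cosine [u] about the tilted axis takes [e3] to height [u (1 - c^2) + c^2],
     which is to be [c']. *)
  pose u := (c' - c ^+ 2) / (1 - c ^+ 2).
  have u1 : u ^+ 2 <= 1.
    rewrite -[leLHS]real_normK ?num_real // expr_le1 // ler_norml.
    rewrite /u ler_pdivlMr // ler_pdivrMr //; apply/andP; split; lra.
  have uv : u ^+ 2 + Num.sqrt (1 - u ^+ 2) ^+ 2 = 1.
    by rewrite sqr_sqrtr ?subr_ge0 // addrC subrK.
  have [r ar rE] := Rz_axial uv.
  exists (mulGL k (mulGL r (invGL k))).
    by apply: (KM) => //; apply: (KM); [exact: Kax|exact: KV].
  pose q := mx_of_GL (invGL k) *m e3 R.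
  have q2 : q i2 0 = c.
    have [_ _ <- _] := dot_e q; rewrite -(so_dot _ _ sk) /q mulmx_GLVK.
    by rewrite dotE !hvecs kc; ring.
  have sk' := so_inv sk; have q3 := wt _ sk'; have qn := nrm _ sk'.
  rewrite -/q q2 in qn q3.
  rewrite 2!mkGLE -!mulmxA -/q.
  have [_ _ <- _] := dot_e (mx_of_GL k *m (mx_of_GL r *m q)).
  have -> : e3 R = mx_of_GL k *m q by rewrite mulmx_GLVK.
  rewrite so_dot // [q in mulmx _ q]hvecK rE Rz_hvec dotE !hvecs q2 q3.
  have -> : q i0 0 * (u * q i0 0 - Num.sqrt (1 - u ^+ 2) * q i1 0) +
      q i1 0 * (Num.sqrt (1 - u ^+ 2) * q i0 0 + u * q i1 0) + c * c + 0 * 0 =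
      u * (hor q + c ^+ 2) - u * c ^+ 2 + c ^+ 2 by rewrite /hor; ring.
  by rewrite qn /u; field; rewrite gt_eqF.
(* Passing from [c] to [2 c^2 - 1] at least doubles [1 - c] while [c] is nonnegative. Once [c <= 0],
   the cosine 0 is available, and [double 0] gives all of [[-1, 1]]. *)
have all_from n : forall c, (forall c', c <= c' <= 1 -> I c') -> c < 1 ->
    1 <= 2 ^+ n * (1 - c) -> forall c', -1 <= c' <= 1 -> I c'.
  elim: n => [|n IH] c Ic c1 nc c' c'1.
    have c0 : c <= 0 by move: nc; rewrite expr0 mul1r; lra.
    apply: (double 0); [by apply: Ic; rewrite c0 ler01|by rewrite expr0n ltr01|].
    by rewrite expr0n mulr0 sub0r.
  have [c0|c0] := leP c 0.
    apply: (double 0); [by apply: Ic; rewrite c0 ler01|by rewrite expr0n ltr01|].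
    by rewrite expr0n mulr0 sub0r.
  have cc : c ^+ 2 < 1 by rewrite expr_lt1 // ltW.
  apply: (IH (2 * c ^+ 2 - 1)) => //.
  - by apply: (double) => //; apply: Ic; rewrite lexx ltW.
  - by lra.
  - apply: (le_trans nc); rewrite exprS.
    have -> : 2 * 2 ^+ n * (1 - c) = 2 ^+ n * (2 * (1 - c)) by ring.
    by rewrite ler_wpM2l ?exprn_ge0 // expr2; nra.
have g0c : (mx_of_GL g0 *m e3 R) i2 0 ^+ 2 < 1.
  have sg0 := Kso _ Kg0; set p := mx_of_GL g0 *m e3 R in g0p g0n *.
  rewrite -(nrm _ sg0) -/p ltrDr lt_neqAle hor_ge0 andbT eq_sym.
  apply/eqP => h0; have h1 := nrm _ sg0; rewrite -/p h0 add0r in h1.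
  move/eqP : h0; rewrite hor_eq0 mem_z_axis => /andP[/eqP p0 /eqP p1].
  have p3 : p i3 0 = 0 by exact: wt.
  move/eqP : h1; rewrite sqrf_eq1 => /orP[/eqP p2|/eqP p2].
    by apply: g0p; rewrite [p]hvecK p0 p1 p2 p3.
  by apply: g0n; rewrite [p]hvecK p0 p1 p2 p3 -[RHS]scaleN1r hvecZ; congr hvec; ring.
set c0 := (mx_of_GL g0 *m e3 R) i2 0 in g0c.
have Iall c' : -1 <= c' <= 1 -> I c'.
  have d0 : 0 < 1 - (2 * c0 ^+ 2 - 1) by lra.
  have [n nc] : exists n : nat, 1 <= 2 ^+ n * (1 - (2 * c0 ^+ 2 - 1)).
    set d := 1 - _ in d0 *; exists (Num.bound (1 / d)).
    have /ltW := @upper_nthrootP R (1 / d) _ (leqnn _).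
    by rewrite ler_pdivrMr.
  apply: (all_from n (2 * c0 ^+ 2 - 1)) => //; last by lra.
  by apply: (double) => //; exists g0.
move=> g sg; have [|k Kk kg] := Iall ((mx_of_GL g *m e3 R) i2 0).
  rewrite -ler_norml -(expr_le1 (n := 2)) // real_normK ?num_real // -(nrm _ sg) lerDr.
  exact: hor_ge0.
have sk := Kso _ Kk.
have hh : hor (mx_of_GL k *m e3 R) = hor (mx_of_GL g *m e3 R).
  by apply: (addIr ((mx_of_GL g *m e3 R) i2 0 ^+ 2)); rewrite nrm // -kg nrm.
have [a aa aE] := axial_ex hh; have sa : so a by case: aa.
have akg : mx_of_GL (mulGL a k) *m e3 R = mx_of_GL g *m e3 R.
  rewrite mkGLE -mulmxA [X in _ *m X]hvecK aE kg wt //.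
  by rewrite [RHS]hvecK wt.
have acg : axial (mulGL (invGL (mulGL a k)) g).
  split; first by apply: so_mul => //; apply: so_inv; exact: so_mul.
  by rewrite mkGLE -mulmxA -akg mkGLE mulKmx // mx_of_GL_unit.
rewrite -[g]mul1GL -(mulGLV (mulGL a k)) -mulGLA; apply: (KM); last exact: Kax.
by apply: (KM) => //; exact: Kax.
Qed.

End RotationGroups.

(** * One-parameter groups of rotations, and orthogonal coordinates *)

Section Normalisation.
Variable R : realType.
Implicit Types (g h : GL4 R).

(** [E t] commutes with [E t0], whose only invariant direction is the axis because its square is not
    1. So [E t] maps [e3] to itself or its negative; as [E t] is the square of [E (t / 2)], the
    latter is excluded. Conversely, the cosine of [E] takes all values between [u0] and 1 on
    [[0, t0]], and doubling the parameter reaches the other angles. *)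
Lemma circle_surjective (E : R -> GL4 R) (t0 : R) :
  (forall t, so (E t)) -> (forall s t, E (s + t) = mulGL (E s) (E t)) ->
  continuous (fun t => mx_of_GL (E t)) -> 0 < t0 -> axial (E t0) ->
  E (t0 + t0) <> oneGL R ->
  (forall t, axial (E t)) /\ (forall a, axial a -> exists t, E t = a).
Proof.
move=> soE ED cE t00 at0 Et0; have [u0 [v0 [uv0 E0E]]] := axialE at0.
have E0 : E 0 = oneGL R.
  have := congr1 (mulGL (invGL (E 0))) (ED 0 0).
  by rewrite addr0 mulGLA mulVGL mul1GL => <-.
have v00 : v0 != 0.
  apply/eqP => v00; apply: Et0; apply: GL_inj; rewrite ED !mkGLE E0E RzM v00.
  have u1 : u0 * u0 = 1 by rewrite -uv0 v00; ring.
  apply: mx_eq_hvec => x y z w; rewrite Rz_hvec mul1mx mulr0 subr0 u1.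
  by congr hvec; ring.
have pm t : mx_of_GL (E t) *m e3 R = e3 R \/ mx_of_GL (E t) *m e3 R = - e3 R.
  set p := mx_of_GL (E t) *m e3 R.
  have p3 : p i3 0 = 0 by rewrite so_weight // hvecs.
  have pn : hor p + p i2 0 ^+ 2 = 1.
    by rewrite -normsq_hor so_normsq // /normsq !hvecs; ring.
  have fixp : Rz u0 v0 *m p = p.
    rewrite -E0E /p mulmxA.
    have -> : mx_of_GL (E t0) *m mx_of_GL (E t) = mx_of_GL (E (t0 + t)) by rewrite ED.
    by rewrite addrC ED mkGLE -mulmxA; case: at0 => _ ->.
  rewrite [p in mulmx _ p]hvecK Rz_hvec in fixp.
  have f0 := congr1 (fun v : 'cV[R]_4 => v i0 0) fixp.
  have f1 := congr1 (fun v : 'cV[R]_4 => v i1 0) fixp.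
  rewrite !hvecs in f0 f1.
  have k0 : (u0 - 1) ^+ 2 + v0 ^+ 2 != 0.
    by rewrite gt_eqF // ltr_wpDl ?sqr_ge0 // exprn_even_gt0.
  have p0 : p i0 0 = 0.
    apply: (mulfI k0); rewrite mulr0.
    have -> : ((u0 - 1) ^+ 2 + v0 ^+ 2) * p i0 0 =
      (u0 - 1) * ((u0 * p i0 0 - v0 * p i1 0) - p i0 0) +
      v0 * ((v0 * p i0 0 + u0 * p i1 0) - p i1 0) by ring.
    by rewrite f0 f1 !subrr !mulr0 addr0.
  have p1 : p i1 0 = 0.
    apply: (mulfI k0); rewrite mulr0.
    have -> : ((u0 - 1) ^+ 2 + v0 ^+ 2) * p i1 0 =
      (u0 - 1) * ((v0 * p i0 0 + u0 * p i1 0) - p i1 0) -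
      v0 * ((u0 * p i0 0 - v0 * p i1 0) - p i0 0) by ring.
    by rewrite f0 f1 !subrr !mulr0 subr0.
  move/eqP : pn; rewrite /hor p0 p1 expr0n !add0r sqrf_eq1 => /orP[/eqP p2|/eqP p2].
    by left; rewrite [p]hvecK p0 p1 p2 p3.
  by right; rewrite [p]hvecK p0 p1 p2 p3 -[RHS]scaleN1r hvecZ; congr hvec; ring.
have aE t : axial (E t).
  split => //; have -> : t = t / 2 + t / 2 by field.
  rewrite ED mkGLE -mulmxA; have [h|h] := pm (t / 2); first by rewrite !h.
  by rewrite h mulmxN h opprK.
split => // a aa.
pose c t := mx_of_GL (E t) i0 i0.
have cc : continuous c.
  move=> t; apply: (cvg_comp _ (fun X : 'M[R]_4 => X i0 i0) (cE t)); exact: coord_continuous.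
have Rz00 (u v : R) : Rz u v i0 i0 = u by rewrite mxE.
have ct0 : c t0 = u0 by rewrite /c E0E Rz00.
have c0 : c 0 = 1 by rewrite /c E0 mkGLE mxE.
have u01 : u0 < 1.
  rewrite (le_lt_trans (ler_norm _)) // -(expr_lt1 (n := 2)) // real_normK ?num_real //.
  by rewrite -uv0 ltrDl exprn_even_gt0.
have base u v : u ^+ 2 + v ^+ 2 = 1 -> u0 <= u -> exists t, mx_of_GL (E t) = Rz u v.
  move=> uv uu0; have u1 : u <= 1.
    rewrite (le_trans (ler_norm _)) // -(expr_le1 (n := 2)) // real_normK ?num_real //.
    by rewrite -uv lerDl sqr_ge0.
  have [||s _ cs] := @IVT R c 0 t0 u (ltW t00).
  - exact: continuous_subspaceT.
  - by rewrite c0 ct0 min_r ?(ltW u01) // max_l ?(ltW u01) // uu0 u1.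
  have [u' [v' [uv' EE]]] := axialE (aE s).
  have uu' : u' = u by rewrite -cs /c EE Rz00.
  rewrite uu' in uv' EE.
  have /eqP : v' ^+ 2 = v ^+ 2 by apply: (addrI (u ^+ 2)); rewrite uv uv'.
  rewrite eqf_sqr => /orP[/eqP vv|/eqP vv]; first by exists s; rewrite EE vv.
  (* The cosine determines the rotation up to inversion; the inverse is the value at [- s]. *)
  exists (- s); have H : mulGL (E (- s)) (E s) = oneGL R by rewrite -ED addNr.
  have [|r ar rE] := @Rz_axial R u v; first by [].
  rewrite -rE; congr mx_of_GL; rewrite -[r]mul1GL -H -mulGLA -[LHS]mulGL1; congr mulGL.
  apply: GL_inj; rewrite mkGLE [in RHS]mkGLE EE rE RzM vv.
  apply: mx_eq_hvec => x y z w; rewrite Rz_hvec mul1mx mulNr opprK -!expr2 uv.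
  by congr hvec; ring.
have all_ n : forall u v, u ^+ 2 + v ^+ 2 = 1 -> 1 - u <= 2 ^+ n * (1 - u0) ->
    exists t, mx_of_GL (E t) = Rz u v.
  elim: n => [|n IH] u v uv un.
    by apply: base => //; move: un; rewrite expr0 mul1r; lra.
  (* With a nonnegative half-angle cosine [u'], [1 - u = 2 (1 - u'^2)] is at least [2 (1 - u')]. *)
  have [u' [v' [u'0 uv' uE vE]]] : exists u' v', [/\ 0 <= u', u' ^+ 2 + v' ^+ 2 = 1,
      u = u' * u' - v' * v' & v = v' * u' + u' * v'].
    have [u' [v' [uv' uE vE]]] := half_angle uv; have [u'0|u'0] := leP 0 u'.
      by exists u', v'.
    exists (- u'), (- v'); rewrite !sqrrN !mulrNN; split => //.
    by rewrite oppr_ge0 ltW.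
  have [|t tE] := IH u' v' uv'.
    have u'1 : u' <= 1.
      rewrite (le_trans (ler_norm _)) // -(expr_le1 (n := 2)) // real_normK ?num_real //.
      by rewrite -uv' lerDl sqr_ge0.
    have uu : 1 - u = 2 * (1 - u' ^+ 2).
      have -> : u = 2 * u' ^+ 2 - (u' ^+ 2 + v' ^+ 2) by rewrite uE; ring.
      by rewrite uv'; ring.
    move: un; rewrite uu (exprS 2 n) -mulrA ler_pM2l // => un; apply: le_trans un.
    by rewrite expr2; nra.
  by exists (t + t); rewrite ED mkGLE tE RzM uE vE.
have [u' [v' [uv' aR]]] := axialE aa.
have d0 : 0 < 1 - u0 by rewrite subr_gt0.
have [|t tE] := all_ (Num.bound (2 / (1 - u0))) u' v' uv'.
  have /ltW := @upper_nthrootP R (2 / (1 - u0)) _ (leqnn _).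
  rewrite ler_pdivrMr //; apply: le_trans.
  have : - u' <= 1.
    rewrite (le_trans (ler_norm _)) // normrN -(expr_le1 (n := 2)) // real_normK ?num_real //.
    by rewrite -uv' lerDl sqr_ge0.
  by lra.
by exists t; apply: GL_inj; rewrite tE aR.
Qed.

Lemma AGL3_e4 (G : 'M[R]_4) : AGL3 G -> G^T *m e4 R = e4 R.
Proof.
move=> [A [t [_ GE]]]; apply: e4_row => j.
have -> : i3 = rshift 3 (@ord0 0) by exact: val_inj.
rewrite GE; case: (split_ordP (j : 'I_(3 + 1))) => k ->.
  by rewrite (block_mxEdl A t 0 1%:M) mxE; case: eqP => // /(congr1 val) /=;
    case: k => k /= lk e; move: lk; rewrite e.
by rewrite (block_mxEdr A t 0 1%:M) !mxE !ord1 !eqxx.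
Qed.

(** The Cholesky factor of an invariant form makes [Omega] orthogonal. As it is triangular, the
    covector of the plane at infinity is an eigenvector of [P^T], so the conjugates of affine maps
    keep their last row. *)
Lemma orthogonal_coordinates (Omega : set 'M[R]_4) : matrix_group Omega ->
  Omega `<=` @AGL3 R -> compact Omega ->
  exists P : GL4 R, forall G, Omega G ->
    let G' := mx_of_GL P *m G *m invmx (mx_of_GL P) in
    G'^T *m G' = 1%:M /\ G'^T *m e4 R = e4 R.
Proof.
move=> [OU O1 OM OV] OA cO; have [c c0 Oc] := compact_entries_bounded cO.
have [S [St Sp SO]] := invariant_form OU O1 OM OV c0 (fun G i j OG => Oc G i j OG).
have [P [uP SP tP]] := cholesky St Sp.
exists (mkGL uP) => G OG; rewrite mkGLE; split.
  have -> : (P *m G *m invmx P)^T *m (P *m G *m invmx P) =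
      (invmx P)^T *m (G^T *m (P^T *m P) *m G) *m invmx P.
    by rewrite !trmx_mul !mulmxA.
  rewrite -SP SO // SP -!mulmxA mulmxV // mulmx1 -trmx_mul mulmxV // trmx1 //.
have Pe4 : P^T *m e4 R = P i3 i3 *: e4 R.
  apply/colP => j; rewrite mxE sum4 !mxE /= !mulr0 !add0r mulr1.
  move: j; apply: ord4P; last exact: esym (mulr1 _).
  - by rewrite tP //; exact: esym (mulr0 _).
  - by rewrite tP //; exact: esym (mulr0 _).
  - by rewrite tP //; exact: esym (mulr0 _).
rewrite !trmx_mul -!mulmxA Pe4 -scalemxAr AGL3_e4; last exact: OA.
rewrite -Pe4 mulmxA -trmx_mul mulmxV // trmx1 mul1mx //.
Qed.

End Normalisation.

(** * From the abstract isomorphism to SO(3) in coordinates *)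

Section CoordinatesForOmega.
Variable R : realType.
Implicit Types (g h : GL4 R).

Lemma iso_inverse m n (G : set 'M[R]_m) (H : set 'M[R]_n) : topological_group_iso G H ->
  (forall A B, G A -> G B -> G (A *m B)) ->
  exists k : 'M[R]_n -> 'M[R]_m, [/\ {within H, continuous k},
    forall B, H B -> G (k B), forall A, G A -> exists2 B, H B & k B = A,
    forall B C, H B -> H C -> k B = k C -> B = C &
    forall B C, H B -> H C -> H (B *m C) -> k (B *m C) = k B *m k C].
Proof.
move=> [f [[[fGH fi fs] _ [k [ck kK]]] fM]] GM; exists k.
have kf A : G A -> k (f A) = A by move=> GA; rewrite kK ?inE.
have Gk B : H B -> G (k B) by move=> /fs[A GA <-]; rewrite kf.
have fk B : H B -> f (k B) = B by move=> /fs[A GA <-]; rewrite kf.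
split => //.
- by move=> A GA; exists (f A); [exact: fGH|exact: kf].
- by move=> B C HB HC BC; rewrite -(fk B HB) BC fk.
- move=> B C HB HC HBC; apply: fi; rewrite ?inE; [exact: Gk|by apply: GM; exact: Gk|].
  by rewrite fM ?fk //; exact: Gk.
Qed.

Lemma special_orthogonalM n (A B : 'M[R]_n) : special_orthogonal_group A ->
  special_orthogonal_group B -> special_orthogonal_group (A *m B).
Proof.
move=> [AA dA] [BB dB]; split; last by rewrite det_mulmx dA dB mulr1.
by rewrite /orthogonal_group /= trmx_mul -mulmxA (mulmxA A^T) AA mul1mx.
Qed.

Section IsomorphicToSO3.
Variable Omega : set 'M[R]_4.
Hypothesis OM : forall A B, Omega A -> Omega B -> Omega (A *m B).
Hypothesis iso : topological_group_iso Omega (@special_orthogonal_group R 3).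

Lemma iso_squares G : Omega G -> exists A B C, [/\ Omega A, Omega B, Omega C &
  G = A *m A *m (B *m B *m (C *m C))].
Proof.
have [k [_ Gk ks ki kM]] := iso_inverse iso OM.
have kMs B C : special_orthogonal_group B -> special_orthogonal_group C ->
    k (B *m C) = k B *m k C.
  by move=> HB HC; apply: kM => //; exact: special_orthogonalM.
move=> /ks[X sX <-]; have sX' := up3_SO3e sX.
have [a [b [c [sa sb sc gE]]]] := @so_squares R (mkGL (SO3e_unit sX')) sX'.
have [A SA aA] := SO3e_up3 sa; have [B SB bB] := SO3e_up3 sb.
have [C SC cC] := SO3e_up3 sc.
have XE : X = A *m A *m (B *m B *m (C *m C)).
  apply: up3_inj; rewrite !up3M -aA -bB -cC.
  exact: (congr1 (@mx_of_GL R) gE).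
have sAA := special_orthogonalM SA SA; have sBB := special_orthogonalM SB SB.
have sCC := special_orthogonalM SC SC; have sBC := special_orthogonalM sBB sCC.
exists (k A), (k B), (k C); split; try exact: Gk.
by rewrite {1}XE !kMs.
Qed.

Lemma iso_noncommutative : exists A B, [/\ Omega A, Omega B & A *m B <> B *m A].
Proof.
have [k [_ Gk ks ki kM]] := iso_inverse iso OM.
have [t [st t1 t2 _]] := half_turn R.
have [|r [sr _] rE] := @Rz_axial R 0 1; first by rewrite expr0n expr1n add0r.
have [A SA tA] := SO3e_up3 st; have [B SB rB] := SO3e_up3 sr.
have sAB := special_orthogonalM SA SB; have sBA := special_orthogonalM SB SA.
exists (k A), (k B); split; [exact: Gk|exact: Gk|].
rewrite -kM // -kM // => /(ki _ _ sAB sBA) /(congr1 (@up3 R)).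
rewrite !up3M -tA -rB => /(congr1 (fun M => M *m e1 R)); rewrite -!mulmxA t1 rE Rz_hvec.
have -> : hvec (0 * 1 - 1 * 0) (1 * 1 + 0 * 0) 0 0 = e2 R by congr hvec; ring.
rewrite t2 => /colP /(_ i1); rewrite !mxE /= => h.
have : (1 : R) + 1 = 0 by rewrite -{1}h addNr.
by apply/eqP; rewrite -[1 + 1]/(2%:R) pnatr_eq0.
Qed.

End IsomorphicToSO3.

Lemma rot2_SO2 (t : R) : special_orthogonal_group (rot2 t).
Proof.
split; last by rewrite det2 !mxE /= -(cos2Dsin2 t); ring.
rewrite /orthogonal_group /=; apply/matrixP => i j; rewrite mulmx2 !mxE.
have cs := cos2Dsin2 t.
by case: i => -[|[|//]] p; case: j => -[|[|//]] q; rewrite /= -?cs; ring.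
Qed.

Lemma rot2D (s t : R) : rot2 (s + t) = rot2 s *m rot2 t.
Proof.
apply/matrixP => i j; rewrite mulmx2 !mxE cosD sinD.
by case: i => -[|[|//]] p; case: j => -[|[|//]] q; rewrite /=; ring.
Qed.

Lemma rot2_continuous : continuous (@rot2 R).
Proof.
move=> t; have cN : - sin x @[x --> t] --> - sin t.
  by apply: cvgN; exact: continuous_sin.
apply: (@mx_cvg R _ _ (nbhs_filter t)) => i j; under eq_cvg do rewrite mxE; rewrite mxE.
by case: i => -[|[|//]] p; case: j => -[|[|//]] q /=;
  first [exact: continuous_cos | exact: cN | exact: continuous_sin].
Qed.

Lemma Omega_coordinates (Omega H : set 'M[R]_4) (Gamma : rotation_type) :
  matrix_group Omega -> Omega `<=` @AGL3 R ->
  topological_group_iso Omega (@special_orthogonal_group R 3) ->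
  H `<=` Omega -> matrix_group H -> topological_group_iso H (@rotation_group R Gamma) ->
  exists P : GL4 R,
    [/\ forall g, Omega (mx_of_GL g) <-> so (mulGL P (mulGL g (invGL P))),
        forall a, axial a -> H (mx_of_GL (mulGL (invGL P) (mulGL a P))) &
        Gamma = O2 -> exists s, H (mx_of_GL s) /\
          ~ axial (mulGL P (mulGL s (invGL P)))].
Proof.
move=> gO OA isoO HO gH isoH; have [OU O1 OM OV] := gO; have [HU H1 HM HV] := gH.
have cO : compact Omega by apply: (iso_compact isoO); exact: special_orthogonal_compact.
have [P0 P0O] := orthogonal_coordinates gO OA cO.
have uP0 := mx_of_GL_unit P0.
have det_conj G : \det (mx_of_GL P0 *m G *m invmx (mx_of_GL P0)) = \det G.
  by rewrite !det_mulmx mulrAC -det_mulmx mulmxV // det1 mul1r.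
(* The conjugates are orthogonal, so squares have determinant 1, and every element of [Omega] is a
   product of squares. *)
have detO G : Omega G -> \det G = 1.
  have sq A : Omega A -> \det (A *m A) = 1.
    move=> OmA; have [AA _] := P0O A OmA; have := det_orth AA.
    by rewrite det_conj det_mulmx => -[->|->]; rewrite ?mulrNN mulr1.
  move=> /(iso_squares OM isoO)[A [B [C [OmA OB OC ->]]]].
  by rewrite det_mulmx sq // mul1r det_mulmx !sq // mulr1.
have so0 g : Omega (mx_of_GL g) -> so (mulGL P0 (mulGL g (invGL P0))).
  move=> Og; have [gg g4] := P0O _ Og.
  by split; rewrite 2!mkGLE [mx_of_GL P0 *m (_ *m _)]mulmxA ?det_conj ?detO.
have [k [ck Gk ks ki kM]] := iso_inverse isoH HM.
have rotG t : @rotation_group R Gamma (rot2 t).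
  by have := rot2_SO2 t; case: (Gamma) => //= -[].
have uk t : k (rot2 t) \in unitmx by exact/HU/Gk.
pose E0 t : GL4 R := mkGL (uk t).
have E0H t : H (mx_of_GL (E0 t)) by exact/Gk.
have E0D s t : E0 (s + t) = mulGL (E0 s) (E0 t).
  by apply: GL_inj; rewrite !mkGLE rot2D kM // -rot2D.
pose conj P g := mulGL P (mulGL g (invGL P)).
have conjM P g h : conj P (mulGL g h) = mulGL (conj P g) (conj P h).
  by rewrite /conj -!mulGLA (mulGLA (invGL P)) mulVGL mul1GL.
(* The quarter-turn serves because its square is not the identity, as [circle_surjective] requires;
   its axis is then that of the whole circle. *)
have [e [e3' en Ee]] := SO3e_axis (so0 _ (HO _ (E0H (pi / 2)))).
have [Q [sQ Qe]] : exists Q, so Q /\ mx_of_GL Q *m e = e3 R.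
  have [p [p3 pn pe]] := unit_perp e3' en.
  have ep : dot e p = 0 by rewrite -pe !dotE; ring.
  have [G [sG G1 _]] := so_frame e3' p3 en pn ep.
  have [|||||F [sF F1 _]] := @so_frame R (e3 R) (e1 R); rewrite ?hvecs //.
  - by rewrite /normsq !hvecs; ring.
  - by rewrite /normsq !hvecs; ring.
  - by rewrite dotE !hvecs; ring.
  exists (mulGL F (invGL G)); split; first by apply: so_mul => //; exact: so_inv.
  by rewrite 2!mkGLE -mulmxA -G1 mulKmx ?mx_of_GL_unit.
pose P := mulGL Q P0.
have invP : invGL P = mulGL (invGL P0) (invGL Q).
  by apply: invGL_uniq; rewrite /P -mulGLA (mulGLA P0) mulGLV mul1GL mulGLV.
have conjP g : conj P g = conj Q (conj P0 g).
  by rewrite /conj invP /P -!mulGLA.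
clearbody P.
have soP g : Omega (mx_of_GL g) -> so (conj P g).
  move=> Og; rewrite conjP /conj; apply: so_mul => //; apply: so_mul; last exact: so_inv.
  exact: so0.
pose E t := conj P (E0 t).
have [||||||aE Esurj] := @circle_surjective R E (pi / 2).
- by move=> t; apply/soP/HO.
- by move=> s t; rewrite /E E0D conjM.
- move=> t; rewrite /E /conj.
  have c0 : k (rot2 x) @[x --> t] --> k (rot2 t).
    move/subspace_continuousP : ck => /(_ _ (rotG t)) ck U /ck kU.
    have := @rot2_continuous t _ kU; rewrite !nbhs_simpl /= => W.
    by apply: filterS W => x; apply; exact: rotG.
  have c1 := cvg_comp _ (fun X => X *m invmx (mx_of_GL P)) c0 (@mulmx_continuousl R _ _ _ _ _).
  have c2 := cvg_comp _ (fun X => mx_of_GL P *m X) c1 (@mulmx_continuousr R _ _ _ _ _).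
  exact: c2.
- by rewrite divr_gt0 // pi_gt0.
- split; first exact/soP/HO.
  rewrite /E conjP /conj 2!mkGLE -!mulmxA.
  have -> : mx_of_GL (invGL Q) *m e3 R = e by rewrite -Qe mkGLE mulKmx ?mx_of_GL_unit.
  move: Ee; rewrite 2!mkGLE -!mulmxA => ->; exact: Qe.
- have -> : pi / 2 + pi / 2 = pi :> R by field.
  move=> E1; have E01 : E0 pi = oneGL R.
    have -> : E0 pi = mulGL (invGL P) (mulGL (E pi) P).
      by rewrite /E /conj !mulGLA mulVGL mul1GL -mulGLA mulVGL mulGL1.
    by rewrite E1 mul1GL mulVGL.
  have E00 : E0 0 = oneGL R.
    have := congr1 (mulGL (invGL (E0 0))) (E0D 0 0).
    by rewrite addr0 mulGLA mulVGL mul1GL => <-.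
  have : k (rot2 pi) = k (rot2 0).
    by rewrite -[LHS]/(mx_of_GL (E0 pi)) -[RHS]/(mx_of_GL (E0 0)) E01 E00.
  move=> /(ki _ _ (rotG _) (rotG _)) /matrixP /(_ 0 0); rewrite !mxE /= cos0 cospi => h.
  have : (1 : R) + 1 = 0 by rewrite -{1}h addNr.
  by apply/eqP; rewrite -[1 + 1]/(2%:R) pnatr_eq0.
have unconjE g : mulGL (invGL P) (mulGL (conj P g) P) = g.
  by rewrite /conj !mulGLA mulVGL mul1GL -mulGLA mulVGL mulGL1.
have conjE g : conj P (mulGL (invGL P) (mulGL g P)) = g.
  by rewrite /conj !mulGLA mulGLV mul1GL -mulGLA mulGLV mulGL1.
have axH a : axial a -> H (mx_of_GL (mulGL (invGL P) (mulGL a P))).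
  by move=> /Esurj[t <-]; rewrite unconjE.
pose K : set (GL4 R) := [set g | Omega (mx_of_GL (mulGL (invGL P) (mulGL g P)))].
have Kso : K `<=` @so R by move=> g /soP; rewrite conjE.
(* If all of [Omega] kept the axis up to sign, squares would be axial; [Omega] would then consist of
   axial rotations and be commutative. *)
have noncomm : exists g, [/\ K g, mx_of_GL g *m e3 R <> e3 R & mx_of_GL g *m e3 R <> - e3 R].
  apply: contrapT => none.
  have pm g : Omega (mx_of_GL g) -> mx_of_GL (conj P g) *m e3 R = e3 R \/
      mx_of_GL (conj P g) *m e3 R = - e3 R.
    move=> Og; apply: contrapT => /not_orP[n1 n2]; apply: none.
    by exists (conj P g); split => //; rewrite /K /= unconjE.
  have ax g : Omega (mx_of_GL g) -> axial (conj P g).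
    have sq h : Omega (mx_of_GL h) -> axial (mulGL (conj P h) (conj P h)).
      move=> Oh; split; first by apply: so_mul; exact: soP.
      rewrite mkGLE -mulmxA; have [eq|eq] := pm h Oh; first by rewrite !eq.
      by rewrite eq mulmxN eq opprK.
    move=> Og; have [A [B [C [OmA OB OC gE]]]] := iso_squares OM isoO Og.
    have -> : g = mulGL (mulGL (mkGL (OU _ OmA)) (mkGL (OU _ OmA))) (mulGL
        (mulGL (mkGL (OU _ OB)) (mkGL (OU _ OB))) (mulGL (mkGL (OU _ OC)) (mkGL (OU _ OC)))).
      by apply: GL_inj; rewrite !mkGLE.
    by rewrite !conjM; apply: axial_mul; [|apply: axial_mul]; exact: sq.
  have [A [B [OmA OB AB]]] := iso_noncommutative OM isoO; apply: AB.
  pose a := mkGL (OU _ OmA); pose b := mkGL (OU _ OB).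
  have [u [v [_ aR]]] := axialE (ax a OmA); have [u' [v' [_ bR]]] := axialE (ax b OB).
  have ab : conj P (mulGL a b) = conj P (mulGL b a).
    apply: GL_inj; rewrite !conjM.
    transitivity (Rz u v *m Rz u' v'); first by rewrite -aR -bR.
    transitivity (Rz u' v' *m Rz u v); last by rewrite -aR -bR.
    by rewrite !RzM; congr Rz; ring.
  have : mulGL a b = mulGL b a by rewrite -(unconjE (mulGL a b)) ab unconjE.
  by move/(congr1 (@mx_of_GL R)); rewrite !mkGLE.
have soK : @so R `<=` K.
  apply: so_generated => //.
  - move=> g h Kg Kh; rewrite /K /=.
    have -> : mulGL (invGL P) (mulGL (mulGL g h) P) = mulGL
        (mulGL (invGL P) (mulGL g P)) (mulGL (invGL P) (mulGL h P)).
      by rewrite -!mulGLA (mulGLA P) mulGLV mul1GL.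
    exact: OM.
  - move=> g Kg; rewrite /K /=.
    have -> : mulGL (invGL P) (mulGL (invGL g) P) = invGL (mulGL (invGL P) (mulGL g P)).
      symmetry; apply: invGL_uniq.
      by rewrite -!mulGLA (mulGLA P) mulGLV mul1GL (mulGLA g) mulGLV mul1GL mulVGL.
    exact: OV.
  - by move=> a aa; apply: HO; exact: axH.
exists P; split => //.
- by move=> g; split=> [/soP //|/soK]; rewrite /K /= -/(conj P g) unconjE.
- move=> GE; have flipG : @rotation_group R Gamma (@flip2 R) by rewrite GE; exact: flip2_orth.
  (* [flip2] has determinant -1, so its image is not among those of the [rot2 t], which exhaust the
     axial elements. *)
  exists (mkGL (HU _ (Gk _ flipG))); split; first exact: Gk.
  move=> /Esurj[t Et].
  have : E0 t = mkGL (HU _ (Gk _ flipG)) by rewrite -[LHS]unconjE -/(E t) Et unconjE.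
  move=> /(congr1 (@mx_of_GL R)); rewrite !mkGLE => /(ki _ _ (rotG _) flipG).
  move=> /(congr1 determinant); have [_ ->] := rot2_SO2 t; rewrite det_flip2 => h.
  have : (1 : R) + 1 = 0 by rewrite {1}h addNr.
  by apply/eqP; rewrite -[1 + 1]/(2%:R) pnatr_eq0.
Qed.

End CoordinatesForOmega.

Theorem theorem5p4 (R : realType) (Gamma : rotation_type) (C : set (line R))
    (Omega : set 'M[R]_4)
    (hC : rotational Gamma C)
    (hOmega : matrix_group Omega)
    (hOmegaAGL : Omega `<=` @AGL3 R)
    (hOmegaSO3 : topological_group_iso Omega (@special_orthogonal_group R 3))
    (hadm : admissible Omega Gamma C) :
  (* (1) *)
  (Gamma = O2 -> topological_parallelism (orbit_lines Omega C)) /\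
  (~ rotational O2 C \/ ~ admissible Omega O2 C ->
   (* (2) *)
   (~ topological_parallelism (orbit_lines Omega C) /\
    forall Cp : set (oline R), oriented_spread_over C Cp ->
      oriented_topological_parallelism (orbit_olines Omega Cp)) /\
   (* (3) *)
   (forall Cp : set (oline R), oriented_spread_over C Cp ->
      ~ exists P : set (set (line R)),
          topological_parallelism P /\
          orbit_olines Omega Cp = oriented_cover P)).
Proof.
have [spC _] := hC; have [H [HO gH isoH HC]] := hadm.
have [P [OmegaE axH sH]] := Omega_coordinates hOmega hOmegaAGL hOmegaSO3 HO gH isoH.
have invPC g : axial g -> GL_line g @` (GL_line P @` C) = GL_line P @` C.
  move=> /axH/HC aC; rewrite -[in RHS]aC -!GL_lines_imageM.
  by rewrite mulGLA mulGLV mul1GL.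
have cO : compact [set g : GL4 R | Omega (mx_of_GL g)].
  have [OU _ _ _] := hOmega; apply: (compact_GL OU).
  by apply: (iso_compact hOmegaSO3); exact: special_orthogonal_compact.
split=> [/sH[s [Hs nas]]|not2].
  apply: (orbit_parallelism OmegaE spC invPC _ _ nas cO); first exact: HO.
  exact: HC.
split; first split.
- exact: (orbit_not_parallelism OmegaE spC invPC not2).
- by move=> D CD; exact: (orbit_oriented_parallelism OmegaE spC invPC CD cO).
- by move=> D CD; exact: (orbit_not_cover OmegaE spC invPC CD not2).
Qed.
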